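(* Let $K$ be a field of characteristic $0$ and let $\delta$ be any locally finite $K$-$\mathcal{E}$-derivation of the polynomial algebra $K[x,y]$. Then the image $\operatorname{Im}\delta$ is a Mathieu subspace of $K[x,y]$.
   Context: Algebra homomorphisms and endomorphisms are unital. A $K$-$\mathcal{E}$-derivation of a $K$-algebra $A$ is a $K$-linear map $\delta: A\to A$ such that $\mathrm{id}-\delta$ is a $K$-algebra endomorphism of $A$. A $K$-linear map $\delta$ of a $K$-vector space $V$ to itself is locally finite if for each $v\in V$ the $K$-subspace spanned by $\{\delta^i(v)\mid i\ge 0\}$ is finite dimensional. A $K$-subspace $M$ of a commutative $K$-algebra $A$ is a Mathieu subspace of $A$ if for all $f\in M$ such that $f^m\in M$ for all $m>0$, and for all $g\in A$, there exists an integer $n$ (depending on $f$ and $g$) such that $f^m g\in M$ for all $m>n$. *)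

(* Defs.v *)
From HB Require Import structures.
From mathcomp Require Import all_boot all_order all_algebra.
From mathcomp Require Export mpoly.

Set Implicit Arguments.
Unset Strict Implicit.
Unset Printing Implicit Defensive.

Import GRing.Theory.
Local Open Scope ring_scope.

(* Subsets and subspaces of a possibly infinite-dimensional K-space are Prop
   predicates: membership in the image of a linear map is not boolean here. *)

Definition is_subspace (K : fieldType) (V : lmodType K) (M : V -> Prop) : Prop :=
  M 0 /\ forall (a : K) (u v : V), M u -> M v -> M (a *: u + v).

Definition lin_span (K : fieldType) (V : lmodType K) (S : V -> Prop) (v : V) :
    Prop :=
  exists (n : nat) (c : 'I_n -> K) (u : 'I_n -> V),
    (forall i, S (u i)) /\ v = \sum_(i < n) c i *: u i.

Definition finite_dimensional (K : fieldType) (V : lmodType K)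
    (W : V -> Prop) : Prop :=
  exists b : seq V, forall v, W v <-> lin_span (fun u => u \in b) v.

Definition locally_finite (K : fieldType) (V : lmodType K)
    (delta : {linear V -> V}) : Prop :=
  forall v : V,
    finite_dimensional (lin_span (fun w => exists i : nat, w = iter i delta v)).

Definition is_E_derivation (K : fieldType) (A : algType K)
    (delta : {linear A -> A}) : Prop :=
  exists phi : {lrmorphism A -> A}, forall f : A, f - delta f = phi f.

Definition image_of (V W : Type) (h : V -> W) (w : W) : Prop :=
  exists v : V, h v = w.

Definition Mathieu_subspace (K : fieldType) (A : comAlgType K)
    (M : A -> Prop) : Prop :=
  is_subspace M /\
  forall f : A, M f -> (forall m : nat, (0 < m)%N -> M (f ^+ m)) ->
  forall g : A, exists n : nat, forall m : nat, (n < m)%N -> M (f ^+ m * g).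

(* Main.v *)
(* Write phi = id - delta and decompose K[x,y], after a finite extension of K,
   into the generalized eigenspaces of phi.  They multiply like their
   eigenvalues, and Im delta is determined by its trace on the eigenspace of 1,
   a subalgebra B.  If B = K, then Im delta is an ideal.  If phi is not the
   identity on B, then either delta is onto, or all eigenvalues are roots of
   unity of some order N; in the latter case phi^N is unipotent, a weak form of
   Rentschler's theorem shows that phi^N - 1 has an ideal as image, and Newton's
   identities, applied to the conjugates of f under the group of N-th roots of
   unity, put f^N into it.  If phi is the identity on B <> K, then any two
   eigenvectors are algebraically dependent over B, so that, up to an exponent,
   all nonzero eigenvalues are powers of one rho of infinite order.  This gives
   a grading by integer weights, and the theorem of Duistermaat and van der
   Kallen in one variable shows that the weights of f, outside the kernel of a
   power of phi, all have the same strict sign. *)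
Require Import Defs.
From HB Require Import structures.
From mathcomp Require Import all_boot all_order all_algebra.
From mathcomp Require Import perm ssrcomplements mpoly cyclic all_field.
From Stdlib Require Import Classical ClassicalEpsilon.
From mathcomp Require Import zify ring.
Set Implicit Arguments.
Unset Strict Implicit.
Unset Printing Implicit Defensive.
Import GRing.Theory.
Local Open Scope ring_scope.

(** * Newton identities *)

(** A relation between eigenvectors splits into eigenvalue components that vanish separately, and
    three polynomials in two variables always satisfy one. This ties the eigenvalues together. If
    [B] contains a fixed nonconstant [p] and an [s] that phi translates by a fixed nonzero element,
    then [p] and [s] are independent, and the eigenvalue of any further eigenvector has finite
    order. A single nonconstant element of [B] still forces a multiplicative relation between any
    two eigenvalues. Such relations hold only up to an exponent N, so an eigenvalue of weight 0 is
    merely an N-th root of unity. The projection to [B] is then an average over N conjugates, and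
    what has to be excluded is the vanishing of constant terms summed over N Laurent polynomials.
    Hence the one-variable theorem is proved for several polynomials at once, and algebraically,
    because their coefficients lie in the fraction field of K[x,y]. Eigenvalues require an extension
    L of K; membership in the image descends because K is a K-linear direct summand of L. *)

Lemma deriv_prod_XsubC (R : comNzRingType) (s : seq R) :
  (\prod_(a <- s) ('X - a%:P))^`() =
  \sum_(i < size s) \prod_(j < size s | j != i) ('X - (s`_j)%:P).
Proof.
rewrite (big_nth 0) big_mkord.
elim: (size s) => [|n IH]; first by rewrite !big_ord0 derivC.
rewrite big_ord_recr /= derivM IH derivXsubC mulr1 big_ord_recr /=.
congr (_ + _).
  rewrite mulr_suml; apply: eq_bigr => i _.
  rewrite [RHS]big_mkcond big_ord_recr /= [X in X * _ = _]big_mkcond /=.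
  have -> : ord_max != widen_ord (leqnSn n) i.
    by rewrite -val_eqE /= gtn_eqF.
  by congr (_ * _); apply: eq_bigr => j _.
rewrite [RHS]big_mkcond big_ord_recr /= eqxx mulr1; apply: eq_bigr => j _.
by have -> : widen_ord (leqnSn n) j != ord_max by rewrite -val_eqE /= ltn_eqF.
Qed.

Lemma newton_identity (R : comNzRingType) (s : seq R) (j : nat) :
  (j <= size s)%N ->
  let P := \prod_(a <- s) ('X - a%:P) in
  P`_(size s - j) *+ j =
  - \sum_(m < j) (\sum_(a <- s) a ^+ m.+1) * P`_(size s - j + m.+1).
Proof.
move=> le_jn P; set n := size s.
pose Q (i : 'I_n) := \prod_(j < n | j != i) ('X - (s`_j)%:P).
have PQ (i : 'I_n) : P = ('X - (s`_i)%:P) * Q i.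
  by rewrite /P (big_nth 0) big_mkord (bigD1 i).
have szP : size P = n.+1 by rewrite size_prod_XsubC.
have szQ i : (size (Q i) <= n)%N.
  have [->|Q0] := eqVneq (Q i) 0; first by rewrite size_poly0.
  move: szP; rewrite (PQ i) size_monicM ?monicXsubC // size_XsubC //.
  by move=> E; lia.
(* Here P' is the sum of the [Q i]. Splitting X^(j+1) as (X^(j+1) - a^(j+1)) + a^(j+1) turns the
   first summand times [Q i] into a multiple of [P]; the second does not reach degree [n], where
   coefficients are compared. *)
have key : 'X^(j.+1) * P^`() =
    \sum_(m < j.+1) (\sum_(i < n) s`_i ^+ m) *: (P * 'X^(j - m))
    + \sum_(i < n) (s`_i ^+ j.+1) *: Q i.
  rewrite /P deriv_prod_XsubC -/n mulr_sumr.
  rewrite [X in _ = X + _](eq_bigr (fun m : 'I_j.+1 =>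
    \sum_(i < n) s`_i ^+ m *: (P * 'X^(j - m)))); last first.
    by move=> m _; rewrite scaler_suml.
  rewrite [X in _ = X + _]exchange_big -big_split /=.
  apply: eq_bigr => i _; rewrite -/(Q i).
  have -> : 'X^(j.+1) = ('X^(j.+1) - ((s`_i)%:P) ^+ j.+1) + ((s`_i)%:P) ^+ j.+1.
    by rewrite subrK.
  rewrite mulrDl -rmorphXn /= mul_polyC; congr (_ + _).
  rewrite rmorphXn subrXX -/P (PQ i) mulrAC -mulrA mulr_sumr mulr_sumr.
  apply: eq_bigr => m _; rewrite -rmorphXn /= -mul_polyC /=.
  by rewrite -/(Q i) [RHS]mulrC !mulrA.
have := congr1 (fun p : {poly R} => p`_n) key; rewrite /=.
rewrite coefD coef_sum coef_sum [X in _ + X]big1 => [|i _]; last first.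
  by rewrite coefZ [(Q i)`_n]nth_default ?mulr0.
rewrite addr0 coefXnM coef_deriv big_ord_recl /=.
under eq_bigr => i _ do rewrite expr0.
rewrite sumr_const card_ord subn0 coefZ coefMXn.
rewrite [in RHS]ltnNge le_jn /=.
have -> : (if (n < j.+1)%N then 0 else P`_(n - j.+1).+1 *+ (n - j.+1).+1) =
    P`_(n - j) *+ (n - j).
  case: ltnP => [|h]; first by rewrite ltnS => h; rewrite (eqP h) mulr0n.
  by rewrite subnSK.
move=> E; apply/eqP.
rewrite -addr_eq0 -(inj_eq (addrI (P`_(n - j) *+ (n - j)))).
rewrite addr0 addrA -mulrnDr subnK // E -mulr_natl; apply/eqP; congr (_ + _).
apply: eq_bigr => m _; rewrite coefZ coefMXn ltnNge.
rewrite (leq_trans (leq_subr _ _)) //=.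
rewrite (big_nth 0) big_mkord; congr (_ * P`__).
by have := ltn_ord m; rewrite /bump /=; lia.
Qed.

(** Each term of Newton's identity contains a power sum, so absorption by [J] suffices without
    induction on [j]. Closure of [J] under division by integers plays the part of characteristic 0;
    [J] will be zero or the image of an operator. *)
Lemma newton_ideal (R : comNzRingType) (J : R -> Prop) (s : seq R) (M : nat) :
  J 0 -> (forall u v, J u -> J v -> J (u - v)) ->
  (forall u v, J u -> J (u * v)) ->
  (forall u n, J (u *+ n.+1) -> J u) ->
  (forall m, (0 < m <= M)%N -> J (\sum_(a <- s) a ^+ m)) ->
  forall j, (0 < j <= M)%N -> (j <= size s)%N ->
    J (\prod_(a <- s) ('X - a%:P))`_(size s - j).
Proof.
move=> J0 JB JM Jdiv Jp [//|j] /andP[_ leM] les.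
apply: (Jdiv _ j); rewrite newton_identity //.
have JN u : J u -> J (- u) by rewrite -sub0r; apply: JB.
have JD u v : J u -> J v -> J (u + v).
  by move=> Ju Jv; rewrite -[v]opprK; apply/JB/JN.
apply: JN; apply: (big_ind J) => // m _; apply/JM/Jp => /=.
by rewrite (leq_trans (ltn_ord m)).
Qed.

(** Modulo [J] the monic polynomial with roots [s] is a pure power of X, and [a] is one of its
    roots. *)
Lemma power_sums_ideal (R : comNzRingType) (J : R -> Prop) (s : seq R) :
  J 0 -> (forall u v, J u -> J v -> J (u - v)) ->
  (forall u v, J u -> J (u * v)) ->
  (forall u n, J (u *+ n.+1) -> J u) ->
  (forall m, (0 < m)%N -> J (\sum_(a <- s) a ^+ m)) ->
  forall a, a \in s -> J (a ^+ size s).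
Proof.
move=> J0 JB JM Jdiv Jp a sa; set P := \prod_(b <- s) ('X - b%:P).
have szP : size P = (size s).+1 by rewrite size_prod_XsubC.
have lcP : P`_(size s) = 1.
  by have := monic_prod_XsubC s xpredT id;
    rewrite monicE lead_coefE szP => /eqP.
have : P.[a] = 0.
  by rewrite /P (big_rem a) //= hornerM hornerXsubC subrr mul0r.
rewrite horner_coef szP big_ord_recr /= lcP mul1r => /eqP.
rewrite addr_eq0 => /eqP/(congr1 -%R); rewrite opprK => <-.
have JN u : J u -> J (- u) by rewrite -sub0r; apply: JB.
have JD u v : J u -> J v -> J (u + v).
  by move=> Ju Jv; rewrite -[v]opprK; apply/JB/JN.
apply: JN; apply: (big_ind J) => // i _; apply/JM.
have -> : (i : nat) = (size s - (size s - i))%N by have := ltn_ord i; lia.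
apply: (newton_ideal (M := size s) J0 JB JM Jdiv); last by lia.
- by move=> m /andP[m0 _]; apply: Jp.
- by have := ltn_ord i; lia.
Qed.

(** * Splitting extensions and their retractions *)

(** Only F-linearity is asked: a linear equation over F that is solvable over L can then be solved
    over F by applying [rho]. *)
Definition retraction (F L : fieldType) (iota : F -> L) (rho : L -> F) : Prop :=
  [/\ forall u v, rho (u + v) = rho u + rho v,
      forall a u, rho (iota a * u) = a * rho u & rho 1 = 1].

Lemma irreducible_factor (F : fieldType) (p : {poly F}) :
  (1 < size p)%N -> exists2 q : {poly F}, irreducible_poly q & q %| p.
Proof.
have [n] := ubnP (size p); elim: n p => // n IH p szp p1.
have [irr|nirr] := classic (irreducible_poly p); first by exists p.
have [q [q1 qp nqp]] : exists q : {poly F}, [/\ size q != 1, q %| p & ~ q %= p].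
  apply: NNPP => H; apply: nirr; split=> // q q1 qp.
  by apply: NNPP => nqp; apply: H; exists q; split.
have p0 : p != 0 by rewrite -size_poly_gt0 (ltn_trans _ p1).
have q0 : q != 0 by apply: contraTneq qp => ->; rewrite dvd0p.
have ltqp : (size q < size p)%N.
  rewrite ltn_neqAle dvdp_leq // andbT; apply/eqP => E; apply: nqp.
  by rewrite -dvdp_size_eqp // E.
have [|r rirr rq] := IH q (leq_trans ltqp szp).
  by rewrite ltn_neqAle eq_sym q1 size_poly_gt0.
by exists r => //; apply: dvdp_trans qp.
Qed.

(** Some basis coordinate does not vanish at 1; dividing it by its value there gives [rho]. *)
Lemma fieldExt_retraction (F : fieldType) (L : fieldExtType F) :
  exists rho, retraction (in_alg L) rho.
Proof.
pose b := vbasis {:L}.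
have [i Hi] : exists i, coord b i (1 : L) != 0.
  apply: NNPP => H; have /eqP := oner_neq0 L; apply.
  rewrite (coord_vbasis (memvf (1 : L))) big1 // => i _.
  case: (eqVneq (coord b i 1) 0) => [->|ne]; first by rewrite scale0r.
  by case: H; exists i.
exists (fun u => (coord b i 1)^-1 * coord b i u); split=> [u v|a u|].
- by rewrite linearD mulrDr.
- by rewrite mulr_algl linearZ /= mulrCA.
- by rewrite mulVf.
Qed.

(** Roots are adjoined one at a time and the retractions compose. The base field changes at each
    step, so the induction generalizes over it and [L] is a bare field. *)
Lemma splitting_extension (F : fieldType) (p : {poly F}) : p != 0 ->
  exists (L : fieldType) (iota : {rmorphism F -> L}) (s : seq L),
    (exists rho, retraction iota rho) /\
    map_poly iota p = iota (lead_coef p) *: \prod_(c <- s) ('X - c%:P).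
Proof.
have [n] := ubnP (size p); elim: n F p => // n IH F p szp p0.
have [p1|p1] := leqP (size p) 1.
  exists F, idfun, [::]; split; first by exists idfun; split.
  by rewrite (size1_polyC p1) map_polyC big_nil lead_coefC alg_polyC.
have [q qirr /dvdpP[q' Ep]] := irreducible_factor p1.
have [L1 _ [z rz _]] := irredp_FAdjoin qirr.
have [rho1 [D1 Z1 O1]] := fieldExt_retraction L1.
have /factor_theorem[p' Ep'] : root (map_poly (in_alg L1) p) z.
  by rewrite Ep rmorphM /= rootM rz orbT.
have mp0 : map_poly (in_alg L1) p != 0 by rewrite map_poly_eq0.
have p'0 : p' != 0 by apply: contraNneq mp0 => E; rewrite Ep' E mul0r.
have szp' : (size p' < n)%N.
  have : size (map_poly (in_alg L1) p) = size p by rewrite size_map_poly.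
  rewrite Ep' size_Mmonic ?monicXsubC // size_XsubC addn2 /= => E.
  by rewrite E.
have [L [iota [s [[rho [D2 Z2 O2]] Es]]]] := IH L1 p' szp' p'0.
exists L, (iota \o in_alg L1), (iota z :: s); split.
  exists (rho1 \o rho); split=> [u v|a u|] /=.
  - by rewrite D2 D1.
  - by rewrite Z2 Z1.
  - by rewrite O2 O1.
rewrite map_poly_comp Ep' rmorphM /= Es big_cons rmorphB /= map_polyX map_polyC.
have -> : lead_coef p' = in_alg L1 (lead_coef p).
  by rewrite -(lead_coef_map (in_alg L1)) Ep' lead_coef_Mmonic ?monicXsubC.
by rewrite mulrC scalerAr.
Qed.

Lemma primitive_root_extension (F : fieldType) (n : nat) :
  [pchar F] =i pred0 -> (0 < n)%N ->
  exists (L : fieldType) (iota : {rmorphism F -> L}) (z : L),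
    n.-primitive_root z.
Proof.
move=> ch n0.
have p0 : 'X^n - 1 != 0 :> {poly F} by rewrite monic_neq0 ?monic_Xn_sub_1.
have [L [iota [s [_ Es]]]] := splitting_extension p0.
exists L, iota; move: Es.
have /monicP -> := monic_Xn_sub_1 F n0.
rewrite rmorph1 scale1r rmorphB /= map_polyXn rmorph1 => Es.
have szs : size s = n.
  by have := size_prod_XsubC s id; rewrite -Es size_Xn_sub_1 // => - [].
have nL : n%:R != 0 :> L.
  by rewrite -(rmorph_nat iota) fmorph_eq0 (proj1 (pcharf0P F) ch) -lt0n.
have us : uniq s.
  rewrite -separable_prod_XsubC -Es; apply/separable_Xn_sub_1: nL.
have : has n.-primitive_root s.
  apply: has_prim_root => //; last by rewrite szs.
  apply/allP => x; rewrite -root_prod_XsubC -Es => /rootP.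
  by rewrite !hornerE => /eqP; rewrite subr_eq0 unity_rootE.
by case/hasP => z _ zp; exists z.
Qed.

(** * Sequences with a recurrence that runs backwards *)

(** Running from [n.+1] to [n] puts the leading coefficient 1 of the characteristic polynomial on
    the term of smallest index, the only one that survives at t = 0 in the later contradiction. An
    arbitrary finite index type lets sums and products of sequences use disjoint sums and pairs of
    indices. *)
Definition backward_linear (R : comNzRingType) (a : nat -> R) : Prop :=
  exists (I : finType) (V : I -> I -> R) (b : nat -> I -> R) (u : I -> R),
    (forall n i, b n i = \sum_j V i j * b n.+1 j) /\
    (forall n, a n = \sum_i u i * b n i).

Section BackwardLinear.
Variable R : comNzRingType.
Implicit Types a : nat -> R.

Lemma backward_linear_eq a a' : a =1 a' ->
  backward_linear a -> backward_linear a'.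
Proof.
by move=> E [I [V [b [u [H1 H2]]]]]; exists I, V, b, u; split=> // n;
  rewrite -E.
Qed.

Lemma backward_linear_const c : backward_linear (fun=> c : R).
Proof.
exists unit, (fun _ _ => 1), (fun _ _ => 1), (fun=> c); split=> n.
  by move=> i; rewrite big_const card_unit /= mulr1 addr0.
by rewrite big_const card_unit /= mulr1 addr0.
Qed.

Lemma backward_linearD a1 a2 : backward_linear a1 -> backward_linear a2 ->
  backward_linear (fun n => a1 n + a2 n).
Proof.
move=> [I [V [b [u [H1 H2]]]]] [J [W [c [v [G1 G2]]]]].
exists (I + J)%type, (fun x y => match x, y with
    inl i, inl i' => V i i' | inr j, inr j' => W j j' | _, _ => 0 end),
  (fun n x => match x with inl i => b n i | inr j => c n j end),
  (fun x => match x with inl i => u i | inr j => v j end).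
split=> n; last by rewrite big_sumType /= H2 G2.
case=> i; rewrite big_sumType /=.
  by rewrite [X in _ + X]big1 ?addr0 // => j _; rewrite mul0r.
by rewrite [X in X + _]big1 ?add0r // => j _; rewrite mul0r.
Qed.

Lemma backward_linearM a1 a2 : backward_linear a1 -> backward_linear a2 ->
  backward_linear (fun n => a1 n * a2 n).
Proof.
move=> [I [V [b [u [H1 H2]]]]] [J [W [c [v [G1 G2]]]]].
exists (I * J)%type, (fun x y => V x.1 y.1 * W x.2 y.2),
  (fun n x => b n x.1 * c n x.2), (fun x => u x.1 * v x.2).
have mulss (f : I -> R) (g : J -> R) :
    (\sum_i f i) * (\sum_j g j) = \sum_x f x.1 * g x.2.
  rewrite mulr_suml -(pair_bigA _ (fun i j => f i * g j)) /=.
  by apply: eq_bigr => i _; rewrite mulr_sumr.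
split=> n; last by rewrite H2 G2 mulss; apply: eq_bigr => x _; rewrite mulrACA.
by case=> i j /=; rewrite H1 G1 mulss; apply: eq_bigr => x _; rewrite mulrACA.
Qed.

Lemma backward_linear_sum (I : Type) (r : seq I) (P : pred I)
    (a : I -> nat -> R) :
  (forall i, P i -> backward_linear (a i)) ->
  backward_linear (fun n => \sum_(i <- r | P i) a i n).
Proof.
move=> H; elim: r => [|i r IH].
  by apply: backward_linear_eq (backward_linear_const 0) => n; rewrite big_nil.
case Pi : (P i).
  apply: backward_linear_eq (backward_linearD (H i Pi) IH) => n.
  by rewrite big_cons Pi.
by apply: backward_linear_eq IH => n; rewrite big_cons Pi.
Qed.

Lemma backward_linear_prod (I : Type) (r : seq I) (P : pred I)
    (a : I -> nat -> R) :
  (forall i, P i -> backward_linear (a i)) ->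
  backward_linear (fun n => \prod_(i <- r | P i) a i n).
Proof.
move=> H; elim: r => [|i r IH].
  by apply: backward_linear_eq (backward_linear_const 1) => n; rewrite big_nil.
case Pi : (P i).
  apply: backward_linear_eq (backward_linearM (H i Pi) IH) => n.
  by rewrite big_cons Pi.
by apply: backward_linear_eq IH => n; rewrite big_cons Pi.
Qed.

Lemma horner_mxE n (A : 'M[R]_n.+1) (p : {poly R}) :
  horner_mx A p = \sum_(i < size p) p`_i *: A ^+ i.
Proof.
rewrite -{1}[p]coefK poly_def linear_sum /=; apply: eq_bigr => i _.
by rewrite linearZ /= rmorphXn /= horner_mx_X.
Qed.

Lemma backward_linear_recurrence a : backward_linear a ->
  exists (D : nat) (chi : {poly R}), chi`_D = 1 /\
    forall n, \sum_(j < D.+1) chi`_j * a (n + (D - j))%N = 0.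
Proof.
move=> [I [V [b [u [H1 H2]]]]].
have [m Em] : {m | #|I| = m} by exists #|I|.
case: m Em => [|m] Em.
  exists 0%N, 1; split=> [|n]; first by rewrite coefC.
  rewrite big_ord1 H2 big1 ?mulr0 // => i _.
  by have := fintype0 i Em.
pose e (i : 'I_m.+1) : I := enum_val (cast_ord (esym Em) i).
have e_bij : bijective e.
  exists (fun x => cast_ord Em (enum_rank x)) => x; rewrite /e.
    by rewrite enum_valK cast_ordKV.
  by rewrite cast_ordK enum_rankK.
pose M : 'M[R]_m.+1 := \matrix_(i, j) V (e i) (e j).
pose B n : 'cV[R]_m.+1 := \col_i b n (e i).
have BS n : B n = M *m B n.+1.
  apply/colP => i; rewrite !mxE H1 (reindex e) /=; last by apply: onW_bij.
  by apply: eq_bigr => j _; rewrite !mxE.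
have BD n k : B n = (M ^+ k) *m B (n + k)%N.
  elim: k => [|k IH]; first by rewrite expr0 mul1mx addn0.
  by rewrite IH BS exprSr mulmxA addnS.
exists m.+1, (char_poly M); split.
  by have /monicP := char_poly_monic M; rewrite lead_coefE size_char_poly.
move=> n; have CH := Cayley_Hamilton M; rewrite horner_mxE size_char_poly in CH.
have E : \sum_(i < m.+2) (char_poly M)`_i *: B (n + (m.+1 - i))%N = 0.
  transitivity ((\sum_(i < m.+2) (char_poly M)`_i *: M ^+ i) *m B (n + m.+1)%N).
    rewrite mulmx_suml; apply: eq_bigr => i _.
    by rewrite (BD _ i) -addnA subnK ?leq_ord // scalemxAl.
  by rewrite CH mul0mx.
under eq_bigr => i _ do rewrite H2 mulr_sumr.
rewrite exchange_big /= big1 // => x _.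
have [y ->] : exists y, x = e y.
  by case: e_bij => e' _ e'K; exists (e' x); rewrite e'K.
move/colP/(_ y): E; rewrite summxE !mxE => E.
rewrite -[RHS](mulr0 (u (e y))) -[in RHS]E mulr_sumr; apply: eq_bigr => i _.
by rewrite !mxE mulrCA.
Qed.

End BackwardLinear.

(** Leibniz formula: the entries of [C ^+ n] run backwards through the inverse of [C]. *)
Lemma backward_linear_det (R : comUnitRingType) r (C : 'M[R]_r.+1) :
  C \in unitmx ->
  backward_linear (fun n => \det (C ^+ n - 1)).
Proof.
move=> Cu; rewrite /determinant; apply: backward_linear_sum => s _.
apply: backward_linearM; first exact: backward_linear_const.
apply: backward_linear_prod => i _.
have bl : backward_linear (fun n => (C ^+ n) i (s i)).
  exists 'I_r.+1, (fun x y => invmx C x y), (fun n x => (C ^+ n) x (s i)),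
    (fun x => (x == i)%:R); split=> n.
    move=> x; rewrite exprS; transitivity ((invmx C *m (C *m C ^+ n)) x (s i)).
      by rewrite mulKmx.
    by rewrite mxE.
  rewrite (bigD1 i) //= eqxx mul1r big1 ?addr0 // => j /negPf ->.
  by rewrite mul0r.
apply: backward_linear_eq
  (backward_linearD bl (backward_linear_const (- (1 : 'M[R]_r.+1) i (s i))))
    => n.
by rewrite !mxE.
Qed.

(** * The theorem of Duistermaat and van der Kallen in one variable *)

Lemma det_sub_scalar (R : comNzRingType) r (C : 'M[R]_r.+1) (c : R) :
  \det (C - c%:M) = (-1) ^+ r.+1 * (char_poly C).[c].
Proof.
rewrite /char_poly -[_.[c]]/(horner_eval c _) -det_map_mx.
have -> : map_mx (horner_eval c) (char_poly_mx C) = c%:M - C.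
  apply/matrixP => i j; rewrite !mxE /horner_eval hornerD hornerN hornerC.
  by rewrite hornerMn hornerX.
by rewrite -detZ scaleN1r opprB.
Qed.

Lemma det_expr_sub1 (F : fieldType) n (z : F) r (C : 'M[{poly F}]_r.+1) :
  n.-primitive_root z ->
  \det (C ^+ n - 1) =
  \prod_(i < n) ((-1) ^+ r.+1 * (char_poly C).[(z ^+ i)%:P]).
Proof.
move=> pz; have E : 'X^n - 1 =
    \prod_(i < n) ('X - ((z ^+ i)%:P)%:P) :> {poly {poly F}}.
  have := congr1 (map_poly polyC) (factor_Xn_sub_1 pz).
  rewrite rmorphB /= map_polyXn rmorph1 big_mkord rmorph_prod /= => <-.
  by apply: eq_bigr => i _; rewrite rmorphB /= map_polyX map_polyC.
have -> : C ^+ n - 1 = horner_mx C ('X^n - 1).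
  by rewrite rmorphB /= rmorphXn /= horner_mx_X rmorph1.
rewrite E rmorph_prod /= (big_morph _ (@det_mulmx _ _) (det1 _ _)).
apply: eq_bigr => i _; rewrite rmorphB /= horner_mx_X horner_mx_C.
exact: det_sub_scalar.
Qed.

Lemma sum_expr_unity (F : fieldType) n (z : F) : z ^+ n = 1 ->
  \sum_(i < n) z ^+ i = if z == 1 then n%:R else 0.
Proof.
move=> zn; have [->|z1] := eqVneq z 1.
  under eq_bigr => i _ do rewrite expr1n.
  by rewrite sumr_const card_ord.
apply/eqP; have := subrX1 z n; rewrite zn subrr => /esym/eqP.
by rewrite mulf_eq0 subr_eq0 (negPf z1).
Qed.

Lemma sum_primitive_root_exp (F : fieldType) n (z : F) a :
  n.-primitive_root z ->
  \sum_(i < n) (z ^+ i) ^+ a = if (n %| a)%N then n%:R else 0.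
Proof.
move=> pz; rewrite (prim_order_dvd pz).
under eq_bigr => i _ do rewrite exprAC.
by rewrite sum_expr_unity // exprAC (prim_expr_order pz) expr1n.
Qed.

Lemma prod_primitive_root (F : fieldType) n (z : F) :
  n.-primitive_root z -> (0 < n)%N ->
  \prod_(i < n) z ^+ i = (-1) ^+ n.+1.
Proof.
move=> pz n0.
have := congr1 (horner^~ 0) (factor_Xn_sub_1 pz).
rewrite big_mkord horner_prod !hornerE expr0n gtn_eqF // add0r.
under eq_bigr => i _ do rewrite hornerXsubC sub0r -mulN1r.
rewrite big_split /= prodr_const card_ord => E.
transitivity ((-1) ^+ n * ((-1) ^+ n * \prod_(i < n) z ^+ i)).
  by rewrite mulrA -expr2 sqrr_sign mul1r.
by rewrite E exprSr.
Qed.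

Section LaurentPencil.
Variables (F : fieldType) (d k l : nat).
Hypothesis charF : [pchar F] =i pred0.

(* The outer variable is [z] and the coefficient variable [t]: the factors are
   the [z^k * (z^-k * h i - t)], made monic in [z]. *)
Definition pencil (h : 'I_d -> {poly F}) : {poly {poly F}} :=
  \prod_i ((lead_coef (h i))^-1%:P *: (map_poly polyC (h i) - 'X *: 'X^k)).

(** The ratio of the leading coefficients of [det (C^n - 1)] for consecutive [n]. Its sign factor
    arises because the n-th roots of unity have product (-1)^(n+1). *)
Definition pencil_ratio (h : 'I_d -> {poly F}) r : F :=
  (-1) ^+ r * \prod_i - (lead_coef (h i))^-1 * (-1) ^+ (k * d).

Lemma pencil_leading_term (h : 'I_d -> {poly F}) n (z : F) r
    (C : 'M[{poly F}]_r.+1) :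
  (forall i, size (h i) = (k + l).+1) -> (0 < k + l)%N ->
  (forall m, (0 < m)%N -> \sum_i ((h i) ^+ m)`_(k * m) = 0) ->
  n.-primitive_root z -> (0 < n)%N -> char_poly C = pencil h ->
  (size (\det (C ^+ n - 1) -
        ((-1) ^+ (k * d) * pencil_ratio h r.+1 ^+ n)%:P * 'X^(d * n))%R
    <= d * n - n.-1 %/ (k + l))%N.
Proof.
move=> szh kl0 CT pz n0 charC; rewrite (det_expr_sub1 _ pz) charC.
(* The value of z^-k h_i at z^j: since z^n = 1, the exponent [n.-1 * k] stands for -k. These values
   are the roots of [det (C^n - 1)] as a polynomial in t. *)
pose th (i : 'I_d) (j : 'I_n) := (z ^+ j) ^+ (n.-1 * k) * (h i).[z ^+ j].
pose s := [seq th x.1 x.2 | x : 'I_d * 'I_n].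
have thE (i : 'I_d) (j : 'I_n) : (z ^+ j) ^+ k * th i j = (h i).[z ^+ j].
  rewrite /th mulrA -exprD -mulSn prednK // exprM [z ^+ j ^+ n]exprAC.
  by rewrite (prim_expr_order pz) !expr1n mul1r.
have -> : \prod_(j < n) ((-1) ^+ r.+1 * (pencil h).[(z ^+ j)%:P]) =
   ((-1) ^+ (k * d) * pencil_ratio h r.+1 ^+ n)%:P * \prod_(a <- s) ('X - a%:P).
  have E (j : 'I_n) : (pencil h).[(z ^+ j)%:P] =
      (\prod_i (- (lead_coef (h i))^-1) * (z ^+ j) ^+ (k * d))%:P *
      \prod_i ('X - (th i j)%:P).
    rewrite horner_prod exprM.
    have -> : ((z ^+ j) ^+ k) ^+ d = \prod_(i < d) (z ^+ j) ^+ k.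
      by rewrite prodr_const card_ord.
    rewrite -big_split rmorph_prod -big_split /=; apply: eq_bigr => i _.
    rewrite hornerZ hornerD hornerN hornerZ hornerXn horner_map /= -(thE i j).
    rewrite mulNr !(polyCN, polyCM, polyC_exp); ring.
  have Es : \prod_(a <- s) ('X - a%:P) =
      \prod_(j < n) \prod_i ('X - (th i j)%:P).
    rewrite big_image /= exchange_big /= pair_bigA /=.
    by apply: eq_bigl => x; rewrite inE.
  rewrite Es; transitivity (\prod_(j < n)
     (((-1) ^+ r.+1 * \prod_i (- (lead_coef (h i))^-1) * (z ^+ j) ^+ (k * d))%:P
       * \prod_i ('X - (th i j)%:P))).
    apply: eq_bigr => j _; rewrite E mulrA; congr (_ * _).
    by rewrite -mulrA [in RHS]polyCM polyC_exp polyCN.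
  rewrite big_split /=; congr (_ * _); rewrite -rmorph_prod; congr (_%:P).
  rewrite big_split /= prodr_const card_ord prodrXl (prod_primitive_root pz) //.
  by rewrite /pencil_ratio [in RHS]exprMn mulrCA; congr (_ * _);
     rewrite exprAC exprS.
set c := _ * _ ^+ n; rewrite -mulrBr.
have szs : size s = (d * n)%N by rewrite size_image card_prod !card_ord.
(* Summation over the n-th roots of unity keeps the exponents divisible by [n]. For m (k + l) < n
   the only such exponent in (z^-k h_i)^m is 0, so [n] times a sum of constant terms remains. *)
have ps m : (0 < m <= n.-1 %/ (k + l))%N -> \sum_(a <- s) a ^+ m = 0.
  move=> /andP[m0 lem].
  have ltm : (m * (k + l) < n)%N.
    rewrite -[n in (_ < n)%N]prednK // ltnS (leq_trans _ (leq_divM _ (k + l)))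
      //.
    by rewrite leq_mul2r lem orbT.
  transitivity (\sum_i n%:R * ((h i) ^+ m)`_(k * m)); last first.
    by rewrite -mulr_sumr CT // mulr0.
  rewrite big_image /= -(pair_bigA _ (fun i j => th i j ^+ m)) /=.
  apply: eq_bigr => i _.
  have szm : size (h i ^+ m) = ((k + l) * m).+1.
    by rewrite polySpred ?size_exp ?szh // expf_neq0 // -size_poly_eq0 szh.
  transitivity (\sum_(j < n) \sum_(e < ((k + l) * m).+1)
      (h i ^+ m)`_e * (z ^+ j) ^+ (n.-1 * k * m + e)).
    apply: eq_bigr => j _; rewrite exprMn -horner_exp horner_coef szm mulr_sumr.
    by apply: eq_bigr => e _; rewrite exprD (exprM _ _ m) mulrCA.
  rewrite exchange_big /=.
  under eq_bigr => e _ do rewrite -mulr_sumr sum_primitive_root_exp //.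
  have km : (k * m < ((k + l) * m).+1)%N by nia.
  rewrite (bigD1 (Ordinal km)) //= big1 ?addr0 => [|e ne].
    have -> : (n.-1 * k * m + k * m = k * m * n)%N by nia.
    by rewrite dvdn_mull // mulrC.
  rewrite ifF ?mulr0 //; apply/negbTE; apply: contra ne => dv.
  rewrite -val_eqE /=.
  have lee := ltn_ord e.
  have : (k * m == e %[mod n])%N.
    rewrite -(eqn_modDl (n.-1 * k * m)) (eqP dv).
    have -> : (n.-1 * k * m + k * m = k * m * n)%N by nia.
    by rewrite modnMl.
  by rewrite !modn_small 1?eq_sym //; nia.
have Ecoef j : (0 < j <= n.-1 %/ (k + l))%N -> (j <= d * n)%N ->
    (\prod_(a <- s) ('X - a%:P))`_(d * n - j) = 0.
  move=> j1 j2; rewrite -szs.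
  apply: (newton_ideal (J := fun u => u = 0) (M := n.-1 %/ (k + l))) => //.
  - by move=> u v -> ->; rewrite subr0.
  - by move=> u v ->; rewrite mul0r.
  - move=> u m /eqP; rewrite -mulr_natr mulf_eq0 (proj1 (pcharf0P F) charF).
    by rewrite orbF => /eqP.
  - by rewrite szs.
apply: leq_trans (size_mul_leq _ _) _; rewrite size_polyC.
apply: (@leq_trans (size (\prod_(a <- s) ('X - a%:P) - 'X^(d * n))%R)).
  by case: (c != 0) => //=; rewrite add0n leq_pred.
apply/leq_sizeP => j lej; rewrite coefB coefXn.
have [ltj|] := ltnP (d * n) j.
  rewrite gtn_eqF // subr0 nth_default // size_prod_XsubC szs //.
rewrite leq_eqVlt => /orP[/eqP ->|ltj].
  rewrite eqxx; have := monic_prod_XsubC s xpredT id.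
  by rewrite monicE lead_coefE size_prod_XsubC szs /= => /eqP ->; rewrite subrr.
rewrite ltn_eqF // subr0; have -> : j = (d * n - (d * n - j))%N by lia.
by rewrite Ecoef //; lia.
Qed.

End LaurentPencil.

(** The primitive root is needed only inside the argument: sizes of polynomials do not change under
    extension of the field. *)
Lemma pencil_det_bound (F : fieldType) (d k l : nat) (h : 'I_d -> {poly F}) n r
    (C : 'M[{poly F}]_r.+1) :
  [pchar F] =i pred0 ->
  (forall i, size (h i) = (k + l).+1) -> (0 < k + l)%N ->
  (forall m, (0 < m)%N -> \sum_i ((h i) ^+ m)`_(k * m) = 0) ->
  (0 < n)%N -> char_poly C = pencil k h ->
  (size (\det (C ^+ n - 1) -
        ((-1) ^+ (k * d) * pencil_ratio k h r.+1 ^+ n)%:P * 'X^(d * n))%R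
    <= d * n - n.-1 %/ (k + l))%N.
Proof.
move=> charF szh kl0 CT n0 charC.
have [L [iota [z pz]]] := primitive_root_extension charF n0.
pose f := map_poly iota; pose h' i := f (h i); pose C' := map_mx f C.
have charL : [pchar L] =i pred0 by move=> p; rewrite (fmorph_pchar iota) charF.
have szh' i : size (h' i) = (k + l).+1 by rewrite size_map_poly.
have CT' m : (0 < m)%N -> \sum_i ((h' i) ^+ m)`_(k * m) = 0.
  move=> m0; transitivity (iota (\sum_i ((h i) ^+ m)`_(k * m))).
    rewrite rmorph_sum; apply: eq_bigr => i _.
    by rewrite -rmorphXn coef_map.
  by rewrite CT // rmorph0.
have charC' : char_poly C' = pencil k h'.
  rewrite -map_char_poly charC /pencil rmorph_prod; apply: eq_bigr => i _ /=.
  rewrite map_polyZ /= rmorphB /= map_polyZ /= map_polyXn map_polyX map_polyC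
    /=.
  rewrite /h' lead_coef_map fmorphV -!map_poly_comp; congr (_ *: (_ - _)).
  by apply: eq_map_poly => x /=; rewrite map_polyC.
have := pencil_leading_term charL szh' kl0 CT' pz n0 charC'.
have -> : pencil_ratio k h' r.+1 = iota (pencil_ratio k h r.+1).
  rewrite /pencil_ratio !rmorphM !rmorphXn !rmorphN1 rmorph_prod /=.
  congr (_ * _ * _); apply: eq_bigr => i _.
  by rewrite rmorphN fmorphV lead_coef_map.
rewrite -[X in _ -> (X <= _)%N](size_map_poly iota) -/f.
suff -> : f (\det (C ^+ n - 1) -
    ((-1) ^+ (k * d) * pencil_ratio k h r.+1 ^+ n)%:P * 'X^(d * n)) =
  \det (C' ^+ n - 1) -
    ((-1) ^+ (k * d) * iota (pencil_ratio k h r.+1) ^+ n)%:P * 'X^(d * n) by [].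
rewrite [LHS]rmorphB /= [X in _ - X]rmorphM /= /f map_polyC map_polyXn /=.
rewrite rmorphM !rmorphXn rmorphN1 -det_map_mx map_mxB map_mx1.
by rewrite /C' -[map_mx f C ^+ n]rmorphXn.
Qed.

Lemma companion_exists (R : comNzRingType) (p : {poly R}) r :
  p \is monic -> size p = r.+2 -> exists C : 'M[R]_r.+1, char_poly C = p.
Proof.
move=> pm szp; have := companionmxK pm; move: (companionmx p); rewrite szp /=.
by move=> C EC; exists C.
Qed.

(* Let [C] be the companion matrix of the pencil over [F[t]].  By Newton's
   identities the hypothesis forces [a_n = det (C^n - 1)] to have the leading
   term [b * g^n * t^(d n)], far above its other terms.  But [C] is invertible,
   so the [a_n] satisfy a recurrence [\sum_(j <= D) chi_j * a_(n + D - j) = 0]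
   with [chi_D = 1].  Hence [\sum_(j <= D) chi_j * (g * t^d)^(D - j) = 0],
   which is absurd at [t = 0]. *)
Lemma no_vanishing_constant_terms_pos (F : fieldType) (d k l : nat)
    (h : 'I_d -> {poly F}) :
  [pchar F] =i pred0 -> (0 < d)%N -> (0 < k)%N -> (0 < l)%N ->
  (forall i, (h i)`_0 != 0) -> (forall i, size (h i) = (k + l).+1) ->
  ~ (forall m, (0 < m)%N -> \sum_i ((h i) ^+ m)`_(k * m) = 0).
Proof.
move=> charF d0 k0 l0 h0 szh CT.
have kl0 : (0 < k + l)%N by rewrite addn_gt0 k0.
pose a i := lead_coef (h i).
have a0 i : a i != 0 by rewrite lead_coef_eq0 -size_poly_eq0 szh.
pose p i := (a i)^-1%:P *: (map_poly polyC (h i) - 'X *: 'X^k).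
have szX i : (size (- ('X *: 'X^k) : {poly {poly F}})%R <
              size (map_poly (polyC : F -> _) (h i)))%N.
  rewrite size_polyN size_scale ?polyX_eq0 // size_polyXn size_map_poly szh.
  by rewrite ltnS -addSn leq_add2r || lia.
have szp i : size (p i) = (k + l).+1.
  rewrite size_scale ?polyC_eq0 ?invr_eq0 // size_polyDl //.
  by rewrite size_map_poly szh.
have pm i : p i \is monic.
  rewrite monicE lead_coefZ lead_coefDl // lead_coef_map -polyCM mulVf //.
have Pm : pencil k h \is monic by apply: monic_prod => i _; apply: pm.
have szP : size (pencil k h) = (d * (k + l)).+1.
  rewrite size_prod => [|i _]; last by rewrite -size_poly_eq0 szp.
  rewrite (eq_bigr (fun=> (k + l).+1)) => [|i _]; last exact: szp.
  by rewrite sum_nat_const card_ord; nia.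
have [r Er] : exists r, (d * (k + l))%N = r.+1.
  by exists (d * (k + l)).-1; rewrite prednK // muln_gt0 d0.
rewrite Er in szP; have [C charC] := companion_exists Pm szP.
(* As k > 0, the variable t is absent from the constant term of the pencil, which is a nonzero
   element of [F] because all h_i(0) are nonzero. *)
have Cu : C \in unitmx.
  have : (char_poly C)`_0 \is a GRing.unit.
    rewrite charC -horner_coef0 horner_prod rpred_prod // => i _.
    rewrite hornerZ hornerD hornerN hornerZ hornerXn expr0n gtn_eqF // mulr0
      subr0.
    rewrite horner_coef0 coef_map -polyCM poly_unitE size_polyC coefC /=.
    by rewrite mulf_neq0 ?invr_eq0 ?a0 ?h0 //= unitfE mulf_neq0 ?invr_eq0 ?a0
      ?h0.
  by rewrite char_poly_det unitrMr ?unitrX ?unitrN1.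
have [D [chi [chiD rec]]] :=
  backward_linear_recurrence (backward_linear_det Cu).
pose b : F := (-1) ^+ (k * d); pose g := pencil_ratio k h r.+1.
have b0 : b != 0 by rewrite signr_eq0.
have g0 : g != 0.
  rewrite /g /pencil_ratio !mulf_neq0 ?signr_eq0 //.
  by apply/prodf_neq0 => i _; rewrite oppr_eq0 invr_eq0 a0.
pose q n := \det (C ^+ n - 1) - (b * g ^+ n)%:P * 'X^(d * n).
have szq n : (0 < n)%N -> (size (q n) <= d * n - n.-1 %/ (k + l))%N.
  by move=> n0; apply: pencil_det_bound.
pose Y := \sum_(j < D.+1) chi`_j * ((g ^+ (D - j))%:P * 'X^(d * (D - j))).
have Y0 : Y != 0.
  apply: contraTneq (oner_neq0 F) => /(congr1 (horner^~ 0)).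
  rewrite /Y horner_sum horner0 big_ord_recr big1 /= => [|j _].
    by rewrite chiD subnn muln0 !hornerE => ->; rewrite eqxx.
  rewrite !hornerM hornerXn hornerC expr0n.
  by rewrite gtn_eqF ?mulr0 ?mulr0 // muln_gt0 d0 subn_gt0 ltn_ord.
have key n : ((b * g ^+ n)%:P * 'X^(d * n)) * Y =
    - \sum_(j < D.+1) chi`_j * q (n + (D - j))%N.
  apply/eqP; rewrite -addr_eq0 /Y mulr_sumr -big_split /=.
  apply/eqP; rewrite -[RHS](rec n); apply: eq_bigr => j _.
  rewrite /q mulrBr addrCA -[RHS]addr0; congr (_ + _).
  rewrite exprD mulnDr exprD !polyCM; ring.
pose B := \max_(j < D.+1) size (chi`_j)%R.
(* Chosen so that the gap [n.-1 %/ (k + l)] below the leading term exceeds the degrees of all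
   [chi_j] plus the shift [d * D]. The right side of [key] then has degree below [d * n], while the
   left side is t^(d n) times a nonzero polynomial. *)
pose n := ((k + l) * (B + d * D + 2)).+1.
have Hn : (n.-1 %/ (k + l) = B + d * D + 2)%N by rewrite /= mulKn.
have szR : (size (\sum_(j < D.+1) chi`_j * q (n + (D - j))%N)%R <= d * n)%N.
  apply: leq_trans (size_sum _ _ _) _; apply/bigmax_leqP => j _.
  apply: leq_trans (size_polyMleq _ _) _.
  have arith u v x y z t : (u <= z)%N -> (v <= x - y)%N -> (z + t + 2 <= y)%N ->
    (x <= d * n + t)%N -> (z <= d * n)%N -> ((u + v).-1 <= d * n)%N by lia.
  apply: (arith _ _ (d * (n + (D - j)))%N ((n + (D - j)).-1 %/ (k + l))%N B
            (d * D)%N).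
  - exact: (leq_bigmax (F := fun j : 'I_D.+1 => size (chi`_j)%R)).
  - exact: szq.
  - by rewrite -Hn; apply: leq_div2r; rewrite /n /=; lia.
  - by rewrite -mulnDr leq_mul2l leq_add2l leq_subr orbT.
  - by apply: (@leq_trans n); rewrite ?leq_pmull // /n; nia.
have := congr1 (fun u : {poly F} => size u) (key n); rewrite size_polyN => Esz.
move: szR; rewrite -Esz -mulrA size_Cmul;
  last by rewrite mulf_neq0 // expf_neq0.
rewrite mulrC size_mulXn // leqNgt => /negP; apply.
by rewrite -size_poly_gt0 in Y0; lia.
Qed.

Lemma power_sums_eq0 (R : idomainType) (I : finType) (a : I -> R) :
  [pchar R] =i pred0 ->
  (forall m, (0 < m)%N -> \sum_i a i ^+ m = 0) -> forall i, a i = 0.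
Proof.
move=> charR H i.
have : a i ^+ size [seq a j | j : I] = 0.
  apply: (power_sums_ideal (J := fun u => u = 0)) => //.
  - by move=> u v -> ->; rewrite subr0.
  - by move=> u v ->; rewrite mul0r.
  - move=> u m /eqP; rewrite -mulr_natr mulf_eq0 (proj1 (pcharf0P R) charR).
    by rewrite orbF => /eqP.
  - by move=> m m0; rewrite big_image /= H.
  - by apply: image_f.
by move/eqP; rewrite expf_eq0 => /andP[_ /eqP].
Qed.

(* A several-polynomial form of the one-variable Duistermaat-van der Kallen
   theorem: [h i] stands for the Laurent polynomial [z^-k * h i]. *)
Lemma no_vanishing_constant_terms (F : fieldType) (d k l : nat)
    (h : 'I_d -> {poly F}) :
  [pchar F] =i pred0 -> (0 < d)%N ->
  (forall i, (h i)`_0 != 0) -> (forall i, size (h i) = (k + l).+1) ->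
  ~ (forall m, (0 < m)%N -> \sum_i ((h i) ^+ m)`_(k * m) = 0).
Proof.
move=> charF d0 h0 szh CT; have i0 : 'I_d := Ordinal d0.
have [k0|k0] := posnP k.
  apply/negP: (h0 i0); rewrite negbK; apply/eqP.
  apply: (power_sums_eq0 (a := fun i => (h i)`_0)) => // m m0.
  rewrite -[RHS](CT m m0) k0 mul0n.
  by apply: eq_bigr => i _; rewrite -!horner_coef0 horner_exp.
have [l0|l0] := posnP l;
  last exact: (no_vanishing_constant_terms_pos charF d0 k0 l0).
have lc i : lead_coef (h i) = (h i)`_k by rewrite lead_coefE szh l0 addn0.
have hk i : (h i)`_k != 0 by rewrite -lc lead_coef_eq0 -size_poly_eq0 szh.
apply/negP: (hk i0); rewrite negbK; apply/eqP.
apply: (power_sums_eq0 (a := fun i => (h i)`_k)) => // m m0.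
 rewrite -[RHS](CT m m0); apply: eq_bigr => i _.
by rewrite -lc -lead_coef_exp lead_coefE size_exp szh l0 addn0.
Qed.

(** * Prime divisors in two variables *)

Definition divides (R : nzRingType) (a b : R) : Prop := exists c, b = a * c.

Definition prime_element (R : nzRingType) (p : R) : Prop :=
  [/\ p != 0, ~ divides p 1 &
      forall a b, divides p (a * b) -> divides p a \/ divides p b].

Lemma irreducible_poly_prime (K : fieldType) (p u v : {poly K}) :
  irreducible_poly p -> p %| u * v -> p %| u \/ p %| v.
Proof.
move=> irr puv; have [c|nc] := boolP (coprimep p u).
  by right; rewrite -(Gauss_dvdpr _ c).
by left; rewrite -(eqp_dvdl _ (irr.2 _ nc (dvdp_gcdl p u))) dvdp_gcdr.
Qed.

Lemma ltn_predD m n : (1 < n)%N -> (m < (m + n).-1)%N.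
Proof. by lia. Qed.

Lemma ex_minimizer (T : Type) (P : T -> Prop) (m : T -> nat) :
  (exists x, P x) -> exists x, P x /\ forall y, P y -> (m x <= m y)%N.
Proof.
case=> x; have [n] := ubnP (m x); elim: n x => // n IH x ltn Px.
have [min|nmin] := classic (forall y, P y -> (m x <= m y)%N); first by exists x.
have [y Py lty] : exists2 y, P y & (m y < m x)%N.
  apply: NNPP => H; apply: nmin => y Py; rewrite leqNgt; apply/negP => lt.
  by apply: H; exists y.
exact: IH (leq_trans lty ltn) Py.
Qed.

Section Gauss.
Variable K : fieldType.
Implicit Types (f g : {poly {poly K}}) (c : {poly K}).

Definition primitive f : Prop :=
  forall c, irreducible_poly c -> ~ divides c%:P f.

(** Gauss's lemma: [c] divides one of the two leading coefficients, and that leading term can be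
    removed modulo [c]. *)
Lemma irreducible_polyC_prime c : irreducible_poly c ->
  prime_element (c%:P : {poly {poly K}}).
Proof.
move=> irr; have c0 := irredp_neq0 irr; split.
- by rewrite polyC_eq0.
- case=> g /(congr1 (fun f => f`_0)); rewrite coefC coefCM /= => E.
  have : c %| 1 by rewrite E dvdp_mulr.
  by rewrite dvdp1 => /eqP E1; case: irr; rewrite E1.
move=> a b; have [n] := ubnP (size a + size b); elim: n a b => // n IH a b szn.
have [->|a0] := eqVneq a 0; first by left; exists 0; rewrite mulr0.
have [->|b0] := eqVneq b 0; first by right; exists 0; rewrite mulr0.
move=> [g E].
have : c %| lead_coef a * lead_coef b.
  by rewrite -lead_coefM E lead_coefM lead_coefC dvdp_mulr.
have red (f : {poly {poly K}}) : f != 0 -> c %| lead_coef f ->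
    exists f' w, (size f' < size f)%N /\ f = f' + c%:P * w.
  move=> f0 /dvdpP[w Ew].
  exists (f - lead_coef f *: 'X^((size f).-1)), (w *: 'X^((size f).-1)); split.
    rewrite [in X in (_ < X)%N]polySpred // ltnS; apply/leq_sizeP => j.
    rewrite coefB coefZ coefXn leq_eqVlt => /orP[/eqP <-|lt].
      by rewrite eqxx mulr1 -lead_coefE subrr.
    rewrite gtn_eqF // mulr0 subr0 nth_default //.
    by move: lt; rewrite -polySpred.
  by rewrite mul_polyC scalerA mulrC -Ew subrK.
case/(irreducible_poly_prime irr) => H.
  have [a' [w [lt Ea]]] := red _ a0 H.
  have [| |Ha|Hb] := IH a' b.
  - by rewrite ltnS in szn; apply: leq_trans szn; rewrite ltn_add2r.
  - by exists (g - w * b); rewrite mulrBr -E Ea; ring.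
  - by case: Ha => x Ex; left; exists (x + w); rewrite Ea Ex mulrDr.
  - by right.
have [b' [w [lt Eb]]] := red _ b0 H.
have [| |Ha|Hb] := IH a b'.
- by rewrite ltnS in szn; apply: leq_trans szn; rewrite ltn_add2l.
- by exists (g - w * a); rewrite mulrBr -E Eb; ring.
- by left.
- by case: Hb => x Ex; right; exists (x + w); rewrite Eb Ex mulrDr.
Qed.

(** The irreducible factors of [c] are stripped one by one: each is prime and does not divide [f],
    so it divides [h]. *)
Lemma primitive_cancel f g h c : primitive f -> c != 0 ->
  c%:P * g = f * h -> divides f g.
Proof.
move=> pf; have [n] := ubnP (size c); elim: n c h => // n IH c h szc c0 E.
have [c1|c1] := leqP (size c) 1.
  move: E c0; rewrite (size1_polyC c1) => E; rewrite polyC_eq0 => c0.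
  exists ((c`_0)^-1%:P%:P * h); rewrite mulrCA -E mulrA -!polyCM mulVf //.
  by rewrite mul1r.
have [p irr /dvdpP[c' Ec]] := irreducible_factor c1.
have [p0 _ pp] := irreducible_polyC_prime irr.
have [|/(pf p irr)//|[h' Eh]] := pp f h.
  by exists (c'%:P * g); rewrite -E Ec polyCM; ring.
apply: (IH c' h').
- rewrite ltnS in szc; apply: leq_trans szc; rewrite Ec.
  have [c'0 pn0] : c' != 0 /\ p != 0.
    by move: c0; rewrite Ec mulf_eq0 negb_or => /andP.
  by rewrite size_mul // ltn_predD //; have [] := irr.
- by apply: contraNneq c0 => z; rewrite Ec z mul0r.
- by apply: (mulfI p0); rewrite [RHS]mulrCA -Eh -E Ec polyCM; ring.
Qed.

Lemma primitive_part f : f != 0 ->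
  exists (c : {poly K}) f', [/\ c != 0, f = c%:P * f' & primitive f'].
Proof.
have [n] := ubnP (size (lead_coef f)); elim: n f => // n IH f szf f0.
have [pf|npf] := classic (primitive f).
  by exists 1, f; rewrite oner_eq0 mul1r.
have [p [irr [g E]]] : exists p, irreducible_poly p /\ divides p%:P f.
  by apply: NNPP => H; apply: npf => p irr d; apply: H; exists p.
have g0 : g != 0 by apply: contraNneq f0 => z; rewrite E z mulr0.
have p0 := irredp_neq0 irr.
have [||c [f' [c0 Ef' pf']]] := IH g.
- rewrite ltnS in szf; apply: leq_trans szf; rewrite E lead_coefM lead_coefC.
  rewrite size_mul ?lead_coef_eq0 // addnC ltn_predD //; by have [] := irr.
- by [].
exists (p * c), f'; split=> //; first by rewrite mulf_neq0.
by rewrite E Ef' polyCM mulrA.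
Qed.

(** If [f] is primitive, a primitive nonconstant divisor [g] of least degree is prime. Given g
    dividing a b, let [d'] be the primitive part of an element of least degree in the ideal (g, a);
    it divides [g] and [a]. If [d'] is constant in the outer variable, a nonzero element of K[X]
    times [b] is a multiple of [g], and cancels; otherwise minimality makes [g] and [d'] associates,
    and [g] divides [a]. *)
Lemma prime_divisor_poly2 f : (forall c : K, f <> c%:P%:P) ->
  exists2 p, prime_element p & divides p f.
Proof.
move=> ncf; have [pf|npf] := classic (primitive f); last first.
  have [p [irr d]] : exists p, irreducible_poly p /\ divides p%:P f.
    by apply: NNPP => H; apply: npf => p irr d; apply: H; exists p.
  by exists p%:P => //; apply: irreducible_polyC_prime.
have f1 : (1 < size f)%N.
  rewrite ltnNge; apply/negP => /size1_polyC Ef.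
  have [/size1_polyC E|c1] := leqP (size f`_0) 1.
    by apply: (ncf f`_0`_0); rewrite -E.
  have [p irr /dvdpP[q Eq]] := irreducible_factor c1.
  by apply: (pf p irr); exists q%:P; rewrite Ef Eq polyCM mulrC.
have [g [[g1 pg [u Eg]] gmin]] := ex_minimizer
    (fun g : {poly {poly K}} => size g)
  (ex_intro (fun g => [/\ (1 < size g)%N, primitive g & divides g f]) f
    (And3 f1 pf (ex_intro _ 1 (esym (mulr1 f))))).
exists g; last by exists u.
have g0 : g != 0 by rewrite -size_poly_gt0 (ltn_trans _ g1).
split=> //.
  case=> v /esym/(congr1 (fun x : {poly {poly K}} => size x)).
  have [->|v0] := eqVneq v 0; first by rewrite mulr0 size_poly0 size_poly1.
  rewrite size_mul ?size_poly1 //; rewrite -size_poly_gt0 in v0.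
  by have := ltn_predD (size v) g1; rewrite addnC => lt E; move: lt v0;
     rewrite E; case: (size v).
move=> a b [w Eab]; have [da|nda] := classic (divides g a); [by left|right].
pose I d := exists x y, d = x * g + y * a.
have [|d [[d0 [x [y Ed]]] dmin']] :=
    @ex_minimizer _ (fun d => d != 0 /\ I d)
      (fun d : {poly {poly K}} => size d).
  by exists g; split=> //; exists 1, 0; rewrite mul1r mul0r addr0.
have dmin r : I r -> (size r < size d)%N -> r = 0.
  move=> Ir; rewrite ltnNge; have [//|r0 /negP[]] := eqVneq r 0.
  exact: dmin'.
(* Pseudo-division by [d]: the remainder lies in [I] and has smaller degree, so it is zero. *)
have pdiv z : I z -> exists c q, c != 0 /\ c%:P * z = q * d.
  move=> [x' [y' Ez]].
  exists (lead_coef d ^+ scalp z d), (z %/ d).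
  have E := Pdiv.Idomain.divp_eq z d.
  split; first by rewrite expf_neq0 // lead_coef_eq0.
  rewrite mul_polyC E (dmin (z %% d)) ?addr0 ?ltn_modp //.
  pose l := lead_coef d ^+ scalp z d.
  exists (l%:P * x' - (z %/ d) * x), (l%:P * y' - (z %/ d) * y).
  have -> : z %% d = l%:P * z - (z %/ d) * d by rewrite mul_polyC E addrC addKr.
  by rewrite Ez Ed; ring.
have [c0 [q0 [c00 E0]]] : exists c q, c != 0 /\ c%:P * g = q * d.
  by apply: pdiv; exists 1, 0; rewrite mul1r mul0r addr0.
have [c1 [q1 [c10 E1]]] : exists c q, c != 0 /\ c%:P * a = q * d.
  by apply: pdiv; exists 0, 1; rewrite mul1r mul0r add0r.
have [k [d' [k0 Ed' pd']]] := primitive_part d0.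
have [d'1|d'1] := leqP (size d') 1.
  have Ed'' := size1_polyC d'1.
  apply: (primitive_cancel (h := x * b + y * w) (c := k * d'`_0) pg).
    by apply: contraNneq d0 => z; rewrite Ed' Ed'' -polyCM z.
  by rewrite polyCM -Ed'' -Ed' Ed mulrDl -!mulrA Eab; ring.
have [v Ev] : divides d' g.
  apply: (primitive_cancel (h := q0 * k%:P) pd' c00).
  by rewrite E0 Ed'; ring.
have v0 : v != 0 by apply: contraNneq g0 => z; rewrite Ev z mulr0.
have d'0 : d' != 0 by apply: contraNneq d0 => z; rewrite Ed' z mulr0.
have v1 : (size v <= 1)%N.
  have : (size g <= size d')%N.
    by apply: gmin; split=> //; exists (v * u); rewrite mulrA -Ev.
  rewrite Ev size_mul // leqNgt; apply: contraNT; rewrite -ltnNge.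
  exact: ltn_predD.
case: nda; have [z Ez] : divides d' a.
  apply: (primitive_cancel (h := q1 * k%:P) pd' c10).
  by rewrite E1 Ed'; ring.
move: Ev v0; rewrite (size1_polyC v1) polyC_eq0 => Ev v00.
have [/size1_polyC E|c1'] := leqP (size v`_0) 1; last first.
  have [p irr /dvdpP[q Eq]] := irreducible_factor c1'.
  by case: (pg p irr); exists (q%:P * d'); rewrite Ev Eq polyCM; ring.
move: Ev v00; rewrite E polyC_eq0 => Ev v00.
exists ((v`_0`_0)^-1%:P%:P * z); rewrite Ez Ev -mulrA; congr (_ * _).
by rewrite mulrA -!polyCM mulfV // mul1r.
Qed.

End Gauss.

(** * Evaluation at pairs of elements, and algebraic dependence in the plane *)

Section Evaluation.
Variables (K : fieldType) (A : comAlgType K).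
Implicit Types (s t : A) (q : {poly K}) (Q : {poly {poly K}}).

Definition eval2 s t Q : A := (map_poly (horner_alg s) Q).[t].

Lemma horner_algE s q : horner_alg s q = \sum_(i < size q) q`_i *: s ^+ i.
Proof.
rewrite -{1}[q]coefK poly_def linear_sum /=; apply: eq_bigr => i _.
by rewrite linearZ /= rmorphXn /= horner_algX mulr_algl.
Qed.

Lemma eval2E s t Q : eval2 s t Q = \sum_(i < size Q) horner_alg s Q`_i * t ^+ i.
Proof.
rewrite /eval2 (horner_coef_wide _ (size_poly _ _)).
by apply: eq_bigr => i _; rewrite coef_map.
Qed.

Lemma eval2_is_zmod_morphism s t : {morph eval2 s t : P Q / P - Q}.
Proof. by move=> P Q; rewrite /eval2 rmorphB hornerD hornerN. Qed.

Lemma eval2_is_monoid_morphism s t : GRing.monoid_morphism (eval2 s t).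
Proof.
split=> [|P Q]; first by rewrite /eval2 rmorph1 hornerC.
by rewrite /eval2 rmorphM hornerM.
Qed.

HB.instance Definition _ s t :=
  GRing.isZmodMorphism.Build {poly {poly K}} A (eval2 s t)
    (eval2_is_zmod_morphism s t).
HB.instance Definition _ s t :=
  GRing.isMonoidMorphism.Build {poly {poly K}} A (eval2 s t)
    (eval2_is_monoid_morphism s t).

Lemma eval2C s t q : eval2 s t q%:P = horner_alg s q.
Proof. by rewrite /eval2 map_polyC hornerC. Qed.

Lemma eval2X s t : eval2 s t 'X = t.
Proof. by rewrite /eval2 map_polyX hornerX. Qed.

End Evaluation.

Section Plane.
Variable K : fieldType.
Notation A := {mpoly K[2]}.
Implicit Types (h u v : A).

Definition poly2_of h : {poly {poly K}} :=
  mmap (polyC \o polyC) (fun i : 'I_2 => if i == ord0 then 'X%:P else 'X) h.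

Definition of_poly2 : {poly {poly K}} -> A := eval2 'X_ord0 'X_ord_max.

Lemma poly2_ofK : cancel poly2_of of_poly2.
Proof.
move=> h; rewrite [in RHS](mpolyE h) {1}(mpolyE h) /of_poly2 /poly2_of.
rewrite [mmap _ _ _]raddf_sum [LHS]raddf_sum /=.
apply: eq_bigr => m _; rewrite mmapZ mmapX /mmap1 /= !big_ord_recl big_ord0 /=.
rewrite !rmorphM !rmorphXn rmorph1 /= eval2X !eval2C horner_algC.
rewrite horner_algX mulr1 -mul_mpolyC [in RHS]mpolyXE_id !big_ord_recl big_ord0.
rewrite mulr1 alg_mpolyC.
by have -> : ord_max = lift ord0 ord0 :> 'I_2 by apply: val_inj.
Qed.

Lemma of_poly2K : cancel of_poly2 poly2_of.
Proof.
have toD u v : poly2_of (u + v) = poly2_of u + poly2_of v by apply: rmorphD.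
have toM u v : poly2_of (u * v) = poly2_of u * poly2_of v by apply: rmorphM.
have toX i : poly2_of 'X_i = if i == ord0 then 'X%:P else 'X.
  by rewrite /poly2_of mmapX mmap1U.
have toC c : poly2_of c%:MP = c%:P%:P by rewrite /poly2_of mmapC.
have to0 : poly2_of 0 = 0 by apply: rmorph0.
elim/poly_ind => [|Q q IH]; first by rewrite /of_poly2 rmorph0.
have -> : of_poly2 (Q * 'X + q%:P) =
    of_poly2 Q * 'X_ord_max + horner_alg 'X_ord0 q.
  by rewrite /of_poly2 rmorphD rmorphM /= eval2X eval2C.
rewrite toD toM IH toX; congr (_ + _).
elim/poly_ind: q => [|q c IHq]; first by rewrite rmorph0.
rewrite rmorphD rmorphM /= horner_algX horner_algC alg_mpolyC toD toM IHq.
by rewrite toX toC polyCD polyCM.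
Qed.

Lemma prime_divisor_mpoly2 h : (1 < msize h)%N ->
  exists2 p : A, prime_element p & divides p h.
Proof.
move=> h1; have [|p [p0 pu pp] [q Eq]] := @prime_divisor_poly2 K (poly2_of h).
  move=> c E; move: h1; rewrite -(poly2_ofK h) E /of_poly2 eval2C horner_algC.
  by rewrite alg_mpolyC msizeC; case: eqP.
have of1 : of_poly2 1 = 1 by apply: rmorph1.
have ofM P Q : of_poly2 (P * Q) = of_poly2 P * of_poly2 Q by apply: rmorphM.
have toM u v : poly2_of (u * v) = poly2_of u * poly2_of v by apply: rmorphM.
have dto u v : divides u v -> divides (poly2_of u) (poly2_of v).
  by case=> w ->; exists (poly2_of w).
have dof P Q : divides P Q -> divides (of_poly2 P) (of_poly2 Q).
  by case=> w ->; exists (of_poly2 w).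
exists (of_poly2 p); last by exists (of_poly2 q); rewrite -ofM -Eq poly2_ofK.
split.
- apply: contraNneq p0 => /(congr1 poly2_of); rewrite of_poly2K => ->.
  by rewrite /poly2_of rmorph0.
- by move/dto; rewrite of_poly2K -of1 of_poly2K.
move=> a b /dto; rewrite of_poly2K toM => /pp[] /dof; rewrite poly2_ofK.
  by left.
by right.
Qed.

Lemma transcendental_mpoly h : (1 < msize h)%N ->
  forall q : {poly K}, horner_alg h q = 0 -> q = 0.
Proof.
move=> h1; have h0 : h != 0 by apply: contraTneq h1 => ->; rewrite msize0.
(* Substituting a nonconstant [h] cannot lower the degree. *)
have lb (q : {poly K}) : (size q <= msize (horner_alg h q))%N.
  elim/poly_ind: q => [|q c IH]; first by rewrite size_poly0.
  rewrite rmorphD rmorphM /= horner_algX horner_algC alg_mpolyC size_MXaddC.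
  case: ifP => // nz; have [q0|q0] := eqVneq q 0.
    rewrite q0 rmorph0 mul0r add0r size_poly0 msizeC.
    by move: nz; rewrite q0 eqxx /= => ->.
  rewrite -size_poly_gt0 in q0; set x := horner_alg h q in IH *.
  have x0 : x != 0 by rewrite -msize_poly_eq0 -lt0n (leq_trans q0).
  have := msizeD_le (x * h + c%:MP) (- c%:MP).
  rewrite addrK msizeN msizeC msizeM //.
  have arith (k l m n : nat) (b : bool) :
    (0 < k)%N -> (k <= l)%N -> (1 < m)%N ->
      ((l + m).-1 <= maxn n b)%N -> (k < n)%N by case: b => /=; lia.
  exact: arith q0 IH h1.
move=> q E; apply/eqP; rewrite -size_poly_eq0 -leqn0 (leq_trans (lb q)) //.
by rewrite E msize0.
Qed.

Lemma algebraically_dependent3 (a b c : A) : c != 0 ->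
  exists E : {poly {poly {poly K}}}, E`_0 != 0 /\
    \sum_(k < size E) eval2 a b E`_k * c ^+ k = 0.
Proof.
move=> c0.
(* Any nonzero relation is enough, since powers of [c] common to all terms can be divided out. *)
suff [E [E0 HE]] : exists E : {poly {poly {poly K}}}, E != 0 /\
    (map_poly (eval2 a b) E).[c] = 0.
  have [n] := ubnP (size E); elim: n E E0 HE => // n IH E E0 HE szE.
  have [E00|E00] := eqVneq E`_0 0; last first.
    exists E; split=> //; rewrite -[RHS]HE (horner_coef_wide _ (size_poly _ _)).
    by apply: eq_bigr => k _; rewrite coef_map.
  have [E' EE'] : exists E', E = E' * 'X.
    have : root E 0 by rewrite /root horner_coef0 E00.
    by case/factor_theorem => E' ->; exists E'; rewrite subr0.
  have E'0 : E' != 0 by apply: contraNneq E0 => z; rewrite EE' z mul0r.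
  apply: (IH E') => //; last by move: szE; rewrite EE' size_mulX.
  apply/eqP; move/eqP: HE; rewrite EE' rmorphM /= map_polyX hornerM hornerX.
  by rewrite mulf_eq0 (negPf c0) orbF.
(* Dimension count: the n^3 products with exponents below [n] involve at most W^2 monomials, and W
   <= (3m + 1) n gives W^2 < n^3 as soon as n > (3m + 1)^2. *)
pose m := (msize a + msize b + msize c)%N.
pose n := ((3 * m).+1 ^ 2).+1; pose W := (3 * m * n).+1.
pose I := ('I_n * 'I_n * 'I_n)%type; pose J := ('I_W * 'I_W)%type.
pose F (x : I) : A := a ^+ x.1.1 * b ^+ x.1.2 * c ^+ x.2.
pose mon (y : J) : 'X_{1..2} :=
  [multinom (if i == ord0 then y.1 : nat else y.2 : nat) | i < 2].
have szF x : (msize (F x) <= W)%N.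
  have szM (u v : A) : (msize (u * v) <= msize u + msize v)%N.
    have [->|u0] := eqVneq u 0; first by rewrite mul0r msize0.
    have [->|v0] := eqVneq v 0; first by rewrite mulr0 msize0.
    by rewrite msizeM // leq_pred.
  have szX (u : A) i : (msize (u ^+ i) <= i * msize u + 1)%N.
    elim: i => [|i IH]; first by rewrite expr0 msize1.
    by rewrite exprS (leq_trans (szM _ _)) // mulSn -addnA leq_add2l.
  have m0 : (0 < msize c)%N by rewrite lt0n msize_poly_eq0.
  case: x => [[i j] k]; rewrite /F /=.
  have := szX a i; have := szX b j; have := szX c k.
  have := szM (a ^+ i * b ^+ j) (c ^+ k); have := szM (a ^+ i) (b ^+ j).
  have : (i * msize a <= n * msize a)%N by rewrite leq_mul2r ltnW ?orbT.
  have : (j * msize b <= n * msize b)%N by rewrite leq_mul2r ltnW ?orbT.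
  have : (k * msize c <= n * msize c)%N by rewrite leq_mul2r ltnW ?orbT.
  have E : (n * m = n * msize a + n * msize b + n * msize c)%N.
    by rewrite /m !mulnDr.
  have : (1 <= m)%N by rewrite /m addn_gt0 m0 orbT.
  have : (1 <= n)%N by [].
  rewrite /W -mulnA (mulnC m) E; move: m0.
  nia.
pose M : 'M[K]_(#|{: I}|, #|{: J}|) :=
  \matrix_(i, j) (F (enum_val i))@_(mon (enum_val j)).
have : kermx M != 0.
  rewrite kermx_eq0 /row_free neq_ltn; apply/orP; left.
  apply: leq_ltn_trans (rank_leq_col _) _.
  rewrite !card_prod !card_ord -/n -/W.
  have lt : (((3 * m).+1 * n) ^ 2 < n ^ 3)%N.
    by rewrite expnMn (expnS n 2) ltn_mul2r expn_gt0 /= /n ltnSn.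
  have leW : (W <= (3 * m).+1 * n)%N by rewrite /W; nia.
  rewrite (_ : n * n * n = n ^ 3)%N; last by rewrite !expnS expn0 muln1 mulnA.
  by apply: leq_ltn_trans lt; rewrite !expnS expn0 muln1; apply: leq_mul.
case/rowV0Pn => v /sub_kermxP vM v0.
pose e x : K := v 0 (enum_rank x).
have HF : \sum_(x : I) e x *: F x = 0.
  apply/mpolyP => m'; rewrite mcoeff0 raddf_sum /=.
  have [small|] := boolP ((m' ord0 < W) && (m' ord_max < W))%N; last first.
    move=> big; rewrite big1 // => x _;
      rewrite mcoeffZ memN_msupp_eq0 ?mulr0 //.
    apply/msize_mdeg_ge/(leq_trans (szF x)).
    rewrite mdegE !big_ord_recl big_ord0 addn0.
    have E1 : lift ord0 ord0 = ord_max :> 'I_2 by apply: val_inj.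
    by move: big; rewrite E1 negb_and -!leqNgt => /orP[] h;
      apply: leq_trans h _; rewrite ?leq_addr ?leq_addl.
  case/andP: small => s0 s1.
  pose y : J := (Ordinal s0, Ordinal s1).
  have Ey : mon y = m'.
    by apply/mnmP => -[[|[|//]] lt]; rewrite mnmE /=; congr (m' _);
      apply: val_inj.
  transitivity (\sum_i v 0 i * M i (enum_rank y)); last first.
    by move/matrixP/(_ 0 (enum_rank y)): vM; rewrite !mxE.
  rewrite (reindex (@enum_val I predT)) /=; last first.
    by apply: onW_bij; exists enum_rank; [apply: enum_valK | apply: enum_rankK].
  apply: eq_bigr => i _; rewrite mcoeffZ /e enum_valK mxE enum_rankK Ey //.
pose E : {poly {poly {poly K}}} :=
  \poly_(k < n) \poly_(j < n) \poly_(i < n) e (inord i, inord j, inord k).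
have Ee (i j k : 'I_n) : E`_k`_j`_i = e (i, j, k).
  by rewrite /E !(coef_poly, ltn_ord) !inord_val.
exists E; split.
  have [x vx] : exists x, v 0 x != 0.
    by apply: NNPP => H; case/negP: v0; apply/eqP/rowP => x; rewrite mxE;
      apply: NNPP => nx; apply: H; exists x; apply/eqP.
  apply: contraNneq vx => E0; case Ex : (enum_val x) => [[i j] k].
  by rewrite -[x]enum_valK Ex -/(e _) -Ee E0 !coef0.
rewrite -[RHS]HF (horner_coef_wide (n := n)); last first.
  by rewrite (leq_trans (size_poly _ _)) // size_poly.
transitivity (\sum_(y : 'I_n * 'I_n) \sum_(k < n) e (y, k) *: F (y, k));
  last first.
  by rewrite pair_bigA; apply: eq_bigr => -[].
rewrite exchange_big /=; apply: eq_bigr => k _.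
rewrite coef_map /= /eval2 (horner_coef_wide (n := n)); last first.
  by rewrite (leq_trans (size_poly _ _)) // /E coef_poly ltn_ord size_poly.
transitivity (\sum_(i < n) \sum_(j < n) e (i, j, k) *: F (i, j, k)); last first.
  by rewrite pair_bigA; apply: eq_bigr => -[].
rewrite mulr_suml.
rewrite exchange_big /=; apply: eq_bigr => j _.
rewrite coef_map /= horner_algE.
rewrite (big_ord_widen n (fun i => E`_k`_j`_i *: a ^+ i)); last first.
  by rewrite /E !(coef_poly, ltn_ord) size_poly.
rewrite big_mkcond !mulr_suml; apply: eq_bigr => i _; rewrite Ee.
case: ifP => [_|/negbT]; first by rewrite -!scalerAl.
rewrite -leqNgt -(Ee i j k) => lei; rewrite nth_default // scale0r !mul0r.
by [].
Qed.

End Plane.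

(** * Base change *)

Section BaseChange.
Variables (n : nat) (K L : fieldType) (iota : {rmorphism K -> L}).
Notation A := {mpoly K[n]}.
Notation AL := {mpoly L[n]}.
Implicit Types (f g : A) (h : AL).
Variable delta : {linear A -> A}.

Definition base_change_fun h : AL :=
  \sum_(m <- msupp h) h@_m *: map_mpoly iota (delta 'X_[m]).

Lemma base_change_wide h k : (msize h <= k)%N ->
  base_change_fun h =
  \sum_(m : 'X_{1..n < k}) h@_m *: map_mpoly iota (delta 'X_[m]).
Proof.
move=> le_hk; rewrite /base_change_fun.
rewrite (big_mksub ('X_{1..n < k} : subFinType _)) ?msupp_uniq //=; last first.
  by move=> x /msize_mdeg_lt /leq_trans; apply.
by rewrite big_rmcond //= => m /memN_msupp_eq0 ->; rewrite scale0r.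
Qed.

Lemma base_change_is_linear : linear base_change_fun.
Proof.
move=> c u v; pose k := maxn (msize (c *: u + v)) (maxn (msize u) (msize v)).
rewrite !(@base_change_wide _ k) ?leq_max ?leqnn ?orbT //.
rewrite scaler_sumr -big_split; apply: eq_bigr => m _ /=.
by rewrite mcoeffD mcoeffZ scalerDl scalerA.
Qed.

Definition base_change : {linear AL -> AL} :=
  HB.pack base_change_fun
    (GRing.isLinear.Build L AL AL *:%R base_change_fun base_change_is_linear).

Lemma base_change_map f :
  base_change (map_mpoly iota f) = map_mpoly iota (delta f).
Proof.
rewrite /= /base_change_fun (perm_big _ (msupp_map_mpoly f (fmorph_inj iota)))
  /=.
rewrite [in RHS](mpolyE f) linear_sum raddf_sum /=; apply: eq_bigr => m _.
by rewrite mcoeff_map_mpoly linearZ /= map_mpolyZ.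
Qed.

Lemma base_change_ind (P : AL -> Prop) :
  (forall f, P (map_mpoly iota f)) -> (forall u v, P u -> P v -> P (u + v)) ->
  (forall c u, P u -> P (c *: u)) -> forall h, P h.
Proof.
move=> Pm PD PZ h; rewrite (mpolyE h).
have P0 : P 0 by have := Pm 0; rewrite rmorph0.
elim/big_ind: _ => // m _; apply: PZ.
by have := Pm 'X_[m]; rewrite map_mpolyX.
Qed.

(** Applied to coefficients, [rho] intertwines [base_change] with [delta] by K-linearity and undoes
    [iota]. *)
Lemma base_change_descent (rho : L -> K) f h : retraction iota rho ->
  base_change h = map_mpoly iota f -> exists g, delta g = f.
Proof.
case=> rhoD rhoZ rho1.
have rhoB : {morph rho : u v / u - v}.
  move=> u v; apply/eqP; rewrite -(inj_eq (addIr (rho v))) -rhoD !subrK.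
  exact: eqxx.
pose r : {additive L -> K} :=
  HB.pack rho (GRing.isZmodMorphism.Build L K rho rhoB).
have retr h' : map_mpoly r (base_change h') = delta (map_mpoly r h').
  transitivity (\sum_(m <- msupp h') rho h'@_m *: delta 'X_[m]).
    rewrite [X in map_mpoly _ X]/= (raddf_sum (map_mpoly r)).
    apply: eq_bigr => m _; apply/mpolyP => m'.
    by rewrite mcoeff_map_mpoly !mcoeffZ mcoeff_map_mpoly /= mulrC rhoZ mulrC.
  rewrite [in RHS](mpolyE h') (raddf_sum (map_mpoly r)) linear_sum.
  apply: eq_bigr => m _; rewrite -linearZ; congr (delta _); apply/mpolyP => m'.
  rewrite mcoeff_map_mpoly !mcoeffZ !mcoeffX /=.
  by rewrite -(rmorph_nat iota) [h'@_m * _]mulrC rhoZ mulrC.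
move=> E; exists (map_mpoly r h); rewrite -retr E; apply/mpolyP => m.
by rewrite !mcoeff_map_mpoly /= -[iota _]mulr1 rhoZ rho1 mulr1.
Qed.

End BaseChange.

(** * Locally nilpotent derivations of the plane *)

Lemma iter_linearP (K : nzRingType) (V : lmodType K) (f : {linear V -> V}) n
  a u v : iter n f (a *: u + v) = a *: iter n f u + iter n f v.
Proof. by elim: n => //= n ->; rewrite linearP. Qed.

Lemma iter_linear0 (K : nzRingType) (V : lmodType K) (f : {linear V -> V}) n :
  iter n f 0 = 0.
Proof. by elim: n => //= n ->; rewrite linear0. Qed.

Section LND.
Variables (K : fieldType) (A : comAlgType K).
Implicit Types (D : {linear A -> A}) (u v : A).

Definition derivation D := forall u v, D (u * v) = D u * v + u * D v.

Definition locally_nilpotent D := forall u, exists n, iter n D u = 0.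

Variables (D : {linear A -> A}) (Dder : derivation D).

Lemma derivation1 : D 1 = 0.
Proof.
have := Dder 1 1; rewrite !mulr1 mul1r => /eqP.
by rewrite -subr_eq0 opprD addNKr oppr_eq0 => /eqP.
Qed.

Lemma derivation_horner_alg u (q : {poly K}) :
  D (horner_alg u q) = horner_alg u q^`() * D u.
Proof.
elim/poly_ind: q => [|q c IH]; first by rewrite deriv0 !rmorph0 linear0 mul0r.
rewrite derivMXaddC !rmorphD !rmorphM /= horner_algX horner_algC.
rewrite linearD Dder IH linearZ /= derivation1 scaler0 addr0.
by rewrite mulrDl mulrAC addrC.
Qed.

(** The cofactor of [D s] can stay anonymous: the rule is used modulo a prime that divides [D s]. *)
Lemma derivation_eval2 s t (Q : {poly {poly K}}) :
  exists x, D (eval2 s t Q) = x * D s + eval2 s t Q^`() * D t.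
Proof.
elim/poly_ind: Q => [|Q q [x IH]].
  by exists 0; rewrite deriv0 !rmorph0 linear0 !mul0r addr0.
exists (x * t + horner_alg s q^`()).
rewrite derivMXaddC !rmorphD !rmorphM /= eval2X eval2C linearD Dder IH.
by rewrite derivation_horner_alg; ring.
Qed.

Lemma derivation_leibniz n u v : iter n D (u * v) =
  \sum_(i < n.+1) (iter (n - i) D u * iter i D v) *+ 'C(n, i).
Proof.
elim: n => [|n IH]; first by rewrite big_ord1.
rewrite iterS IH linear_sum.
under eq_bigr => i _ do rewrite linearMn Dder mulrnDl.
rewrite big_split /= [RHS]big_ord_recl [X in X + _ = _]big_ord_recl /=.
rewrite !subn0 !bin0 -addrA; congr (_ + _).
under [in RHS]eq_bigr => i _ do rewrite /bump /= add1n binS mulrnDr.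
rewrite big_split /= addrC [X in _ = X + _]big_ord_recr /=.
rewrite bin_small // mulr0n addr0 addrC; congr (_ + _).
by apply: eq_bigr => i _; rewrite /bump /= add1n -iterS subnSK // ltn_ord.
Qed.

(** Integration by parts: up to the factor k + 1, a primitive of s^k u is s^(k+1) u minus a
    primitive of s^(k+1) D u. Hence the strengthening by powers of [s]. *)
Lemma derivation_surjective s : [pchar K] =i pred0 -> D s = 1 ->
  locally_nilpotent D -> forall u, exists w, D w = u.
Proof.
move=> charK Ds nil u; have [n] := nil u.
suff H : forall k, iter n D u = 0 -> exists w, D w = s ^+ k * u.
  by case/(H 0%N) => w; rewrite expr0 mul1r; exists w.
have DX k : D (s ^+ k.+1) = k.+1%:R *: s ^+ k.
  elim: k => [|k IH]; first by rewrite expr1 expr0 scale1r.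
  by rewrite exprS Dder IH Ds mul1r -scalerAr -exprS -[k.+2]addn1 natrD scalerDl
     scale1r addrC.
elim: n u {nil} => [|n IH] u k.
  by move=> /= ->; exists 0; rewrite linear0 mulr0.
rewrite iterSr => /(IH _ k.+1)[w Ew].
have nz : k.+1%:R != 0 :> K by rewrite (proj1 (pcharf0P K) charK).
exists (k.+1%:R^-1 *: (s ^+ k.+1 * u - w)).
rewrite linearZ linearB /= Dder DX Ew addrK -scalerAl scalerA mulVf //.
by rewrite scale1r.
Qed.

End LND.

Lemma locally_nilpotent_order (K : fieldType) (V : lmodType K)
    (D : {linear V -> V}) u :
  (exists n, iter n D u = 0) -> u != 0 ->
  exists2 n, iter n D u != 0 & iter n.+1 D u = 0.
Proof.
case; elim=> [|n IH] /= E u0; first by rewrite E eqxx in u0.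
have [/IH|ne] := eqVneq (iter n D u) 0; first exact.
by exists n.
Qed.

Lemma factorially_closed (K : fieldType)
    (D : {linear {mpoly K[2]} -> {mpoly K[2]}})
    u v :
  [pchar K] =i pred0 -> derivation D -> locally_nilpotent D ->
  u * v != 0 -> D (u * v) = 0 -> D u = 0.
Proof.
move=> charK Dder nil uv0 Duv.
have [u0 v0] : u != 0 /\ v != 0 by move: uv0; rewrite mulf_eq0 negb_or => /andP.
have [m m1 m2] := locally_nilpotent_order (nil u) u0.
have [n n1 n2] := locally_nilpotent_order (nil v) v0.
have higher (w : {mpoly K[2]}) (k l : nat) :
    iter k D w = 0 -> (k <= l)%N -> iter l D w = 0.
  by move=> E /subnK <-; rewrite iterD E iter_linear0.
case: m m1 m2 => [_ /= //|m m1 m2].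
(* [m.+1] and [n] are the last orders at which the iterates of [D] on [u] and [v] are nonzero, so
   only the term [i = n] of the Leibniz sum survives. *)
have : iter (m.+1 + n) D (u * v) != 0.
  rewrite derivation_leibniz // (bigD1 (inord n)) //= inordK; last lia.
  rewrite addnK big1 ?addr0 => [|i ne].
    rewrite -mulr_natr mulf_neq0 ?mulf_neq0 //.
    rewrite -mpolyC_nat mpolyC_eq0 (proj1 (pcharf0P K) charK) -lt0n bin_gt0.
    lia.
  have ne' : (i : nat) <> n.
    by move=> E; case/negP: ne; apply/eqP/val_inj; rewrite /= inordK; lia.
  have [lt|lt] := ltnP n i.
    by rewrite (higher v _ _ n2 lt) mulr0 mul0rn.
  rewrite (higher u _ _ m2) ?mul0r ?mul0rn //; lia.
by rewrite addSn iterSr Duv iter_linear0 eqxx.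
Qed.

Section Divisibility.
Variable R : idomainType.
Implicit Types a b c p : R.

Lemma dividesB a b c : divides a b -> divides a c -> divides a (b - c).
Proof. by case=> x -> [y ->]; exists (x - y); rewrite mulrBr. Qed.

Lemma divides_mulr a b c : divides a b -> divides a (b * c).
Proof. by case=> x ->; exists (x * c); rewrite mulrA. Qed.

Lemma divides_mull a b c : divides a b -> divides a (c * b).
Proof. by rewrite mulrC; apply: divides_mulr. Qed.

Lemma divides_trans a b c : divides a b -> divides b c -> divides a c.
Proof. by case=> x -> [y ->]; exists (x * y); rewrite mulrA. Qed.

Lemma prime_divides_prod p (I : Type) (s : seq I) (F : I -> R) :
  prime_element p -> divides p (\prod_(i <- s) F i) ->
  exists i, divides p (F i).
Proof.
move=> [p0 pu pp]; elim: s => [|i s IH]; first by rewrite big_nil => /pu.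
by rewrite big_cons => /pp[] // H; exists i.
Qed.

End Divisibility.

Section BaseChangeDerivation.
Variables (n : nat) (K L : fieldType) (iota : {rmorphism K -> L}).
Notation A := {mpoly K[n]}.
Variable D : {linear A -> A}.

Lemma base_change_derivation : derivation D -> derivation (base_change iota D).
Proof.
move=> Dder u v; elim/(@base_change_ind n K L iota): u => [f|u1 u2 E1 E2|c u E].
- elim/(@base_change_ind n K L iota): v => [g|v1 v2 E1 E2|c v E].
  + by rewrite -rmorphM !base_change_map -!rmorphM -rmorphD -Dder.
  + by rewrite mulrDr linearD E1 E2 linearD !mulrDr; ring.
  + by rewrite -!scalerAr !linearZZ E scalerDr -!scalerAr.
- by rewrite mulrDl linearD E1 E2 linearD !mulrDl; ring.
- by rewrite -!scalerAl !linearZZ E scalerDr -!scalerAl.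
Qed.

Lemma base_change_locally_nilpotent :
  locally_nilpotent D -> locally_nilpotent (base_change iota D).
Proof.
move=> nil u; elim/(@base_change_ind n K L iota): u => [f|u v [k Ek] [l El]|
  c u [k E]].
- have [k E] := nil f; exists k.
  have -> : iter k (base_change iota D) (map_mpoly iota f) =
            map_mpoly iota (iter k D f).
    by elim: k {E} => [//|k IH]; rewrite !iterS IH base_change_map.
  by rewrite E rmorph0.
- exists (k + l)%N; rewrite -[u]scale1r iter_linearP {1}addnC !iterD Ek El.
  by rewrite !iter_linear0 scaler0 addr0.
- by exists k; rewrite -[_ *: u]addr0 iter_linearP E scaler0 iter_linear0 addr0.
Qed.

End BaseChangeDerivation.

Section DivideDerivation.
Variables (K : fieldType).
Notation A := {mpoly K[2]}.
Variables (D : {linear A -> A}) (p : A).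
Hypothesis p0 : p != 0.
Hypothesis pD : forall u, divides p (D u).

Lemma divide_derivation : exists D' : {linear A -> A}, forall u, D u = p * D' u.
Proof.
pose f u := proj1_sig (constructive_indefinite_description _ (pD u)).
have fE u : D u = p * f u.
  exact: proj2_sig (constructive_indefinite_description _ (pD u)).
have flin : linear f.
  move=> a u v; apply: (mulfI p0).
  by rewrite -fE linearP mulrDr -scalerAr -!fE.
pose D' : {linear A -> A} := HB.pack f (GRing.isLinear.Build K A A *:%R f flin).
by exists D'.
Qed.

End DivideDerivation.

Lemma msize_proper_factor (K : fieldType) n (p q : {mpoly K[n]}) :
  prime_element p -> p * q != 0 -> (msize q < msize (p * q))%N.
Proof.
move=> [p0 pu _] pq0; have q0 : q != 0 by move: pq0;
  rewrite mulf_eq0 negb_or => /andP[].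
rewrite msizeM // addnC; apply: ltn_predD; rewrite ltnNge; apply/negP => p1.
apply: pu; move: p0; rewrite (msize1_polyC p1) mpolyC_eq0;
  set c := p@_0%MM => c0.
by exists (c^-1)%:MP; rewrite -mpolyCM mulfV.
Qed.

(* If the prime [p] divides [D s] but not [D] itself, then [D] acts on the
   domain [A / p], of transcendence degree one, as a nonzero locally nilpotent
   derivation killing [s]; hence [s] is algebraic modulo [p]. *)
Lemma algebraic_mod_prime (K : fieldType)
    (D : {linear {mpoly K[2]} -> {mpoly K[2]}}) p s :
  [pchar K] =i pred0 -> derivation D -> locally_nilpotent D ->
  prime_element p -> D p = 0 -> divides p (D s) ->
  (exists v, ~ divides p (D v)) ->
  exists2 q : {poly K}, q != 0 & divides p (horner_alg s q).
Proof.
move=> charK Dder nil pprime Dp ps [v npv]; have [p0 pu pp] := pprime.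
have [t [nut put]] : exists t, ~ divides p (D t) /\ divides p (D (D t)).
  apply: NNPP => H; have {}H m : ~ divides p (iter m.+1 D v).
    elim: m => [//|m IH] d; apply: H; exists (iter m D v); split=> //.
  have [m Em] := nil v; apply: (H m); rewrite iterS Em linear0.
  by exists 0; rewrite mulr0.
have [E [E0 HE]] := algebraically_dependent3 s t p0.
have : divides p (eval2 s t E`_0).
  have szE : (0 < size E)%N.
    by rewrite size_poly_gt0; apply: contraNneq E0 => ->; rewrite coef0.
  move: HE; rewrite -(prednK szE) big_ord_recl /= expr0 mulr1 => /eqP.
  rewrite addr_eq0 => /eqP ->; exists (- \sum_(i < (size E).-1)
    eval2 s t E`_(lift ord0 i) * p ^+ i).
  rewrite mulrN mulr_sumr; congr (- _); apply: eq_bigr => i _.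
  by rewrite /bump /= add1n exprS mulrCA.
(* Modulo [p], the map [D] sends Q(s, t) to Q'(s, t) times [D t], and [D t] cancels. Repeated
   differentiation in the outer variable leaves a nonzero polynomial in [s] alone. *)
move: E0; have [n] := ubnP (size E`_0); elim: n (E`_0) => // n IH Q szQ Q0 pQ.
have [Q1|Q1] := leqP (size Q) 1.
  move: Q0 pQ; rewrite (size1_polyC Q1) polyC_eq0 eval2C => q0 pq.
  by exists Q`_0.
apply: (IH Q^`()).
- by rewrite ltnS in szQ; apply: leq_trans szQ; apply: lt_size_deriv.
- apply: contraNneq Q0 => /(congr1 (fun P : {poly {poly K}} => P`_(size Q).-2)).
  rewrite coef_deriv coef0 -lead_coef_eq0 lead_coefE.
  have -> : (size Q).-2.+1 = (size Q).-1 by case: (size Q) Q1 => [|[]].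
  move/eqP; rewrite -mulr_natr mulf_eq0 -polyC_natr polyC_eq0.
  rewrite (proj1 (pcharf0P K) charK) => /orP[//|].
  by case: (size Q) Q1 => [|[]].
have [x Ex] := derivation_eval2 Dder s t Q.
have : divides p (D (eval2 s t Q)).
  by case: pQ => y ->; exists (D y); rewrite Dder Dp mul0r add0r.
move=> H; have {H} : divides p (eval2 s t Q^`() * D t).
  have := dividesB H (divides_mull x ps).
  by rewrite Ex addrC addKr.
by case/pp.
Qed.

(* Induction on the degree of [D s].  A prime factor [p] of [D s] either divides
   [D], which is then replaced by [D / p], or, by the previous lemma and after
   extending [K], divides some [s - c], which is then replaced by
   [(s - c) / p].  When [D s] is constant, [D] is surjective. *)
Theorem LND_image_ideal (K : fieldType)
    (D : {linear {mpoly K[2]} -> {mpoly K[2]}}) s :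
  [pchar K] =i pred0 -> derivation D -> locally_nilpotent D ->
  D s != 0 -> D (D s) = 0 -> forall u v, exists w, D u * v = D w.
Proof.
have [n] := ubnP (msize (D s)).
(* The field is generalized too, because one case of the induction enlarges it. *)
elim: n K D s => // n IH K D s szn charK Dder nil h0 Dh.
have [h1|h1] := leqP (msize (D s)) 1.
  move: h0; rewrite (msize1_polyC h1) mpolyC_eq0;
    set c := (D s)@_0%MM => c0 u v.
  have Ds' : D (c^-1 *: s) = 1.
    by rewrite linearZ /= (msize1_polyC h1) -/c -mul_mpolyC -mpolyCM mulVf.
  have [w Ew] := derivation_surjective Dder charK Ds' nil (D u * v).
  by exists w.
have [p pprime [q Eq]] := prime_divisor_mpoly2 h1; have [p0 pu pp] := pprime.
have Dp : D p = 0.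
  by apply: (factorially_closed (v := q)) => //; rewrite -Eq.
have Dq : D q = 0.
  by apply: (factorially_closed (v := p)) => //; rewrite mulrC -Eq.
have ltq : (msize q < n)%N.
  rewrite ltnS in szn; apply: leq_trans szn; rewrite Eq.
  by apply: msize_proper_factor; rewrite -?Eq.
have [pD|] := classic (forall u, divides p (D u)).
  have [D' ED'] := divide_derivation p0 pD.
  have D's : D' s = q by apply: (mulfI p0); rewrite -ED' -Eq.
  have D'p : D' p = 0 by apply: (mulfI p0); rewrite -ED' Dp mulr0.
  have D'der : derivation D'.
    by move=> u v; apply: (mulfI p0); rewrite -ED' Dder !ED'; ring.
  have DpX k : D (p ^+ k) = 0.
    elim: k => [|k IHk]; first by rewrite expr0 derivation1.
    by rewrite exprS Dder Dp IHk mul0r mulr0 addr0.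
  have iterD' k u : iter k D u = p ^+ k * iter k D' u.
    elim: k => [|k IHk]; first by rewrite mul1r.
    by rewrite !iterS IHk Dder DpX mul0r add0r ED' mulrA -exprSr.
  have D'nil : locally_nilpotent D'.
    move=> u; have [k Ek] := nil u; exists k.
    apply: (mulfI (expf_neq0 k p0)); by rewrite -iterD' Ek mulr0.
  move=> u v; have [|||w Ew] := IH K D' s _ charK D'der D'nil _ _ u v.
  - by rewrite D's.
  - by rewrite D's; apply: contraNneq h0 => z; rewrite Eq z mulr0.
  - by rewrite D's; apply: (mulfI p0); rewrite -ED' Dq mulr0.
  by exists w; rewrite !ED' -mulrA Ew.
move=> /not_all_ex_not nD.
have ps : divides p (D s) by exists q.
have [f f0 pf] := algebraic_mod_prime charK Dder nil pprime Dp ps nD.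
have [L [iota [r [[rho ret] Ef]]]] := splitting_extension f0.
pose DL := base_change iota D; pose m := map_mpoly (n := 2) iota.
have charL : [pchar L] =i pred0 by move=> x; rewrite (fmorph_pchar iota) charK.
have szm g : msize (m g) = msize g.
  by rewrite !msizeE (perm_big _ (msupp_map_mpoly g (fmorph_inj iota))).
have m0 g : g != 0 -> m g != 0 by rewrite -!msize_poly_eq0 szm.
(* The image of [p] may factor over [L], so one of its prime divisors takes its place. *)
have [p' p'prime p'p] : exists2 p', prime_element p' & divides p' (m p).
  apply: prime_divisor_mpoly2; rewrite szm ltnNge; apply/negP => p1.
  apply: pu; move: p0; rewrite (msize1_polyC p1) mpolyC_eq0.
  by set c := p@_0%MM => c0; exists (c^-1)%:MP; rewrite -mpolyCM mulfV.
have DLder : derivation DL by apply: base_change_derivation.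
have DLnil : locally_nilpotent DL by apply: base_change_locally_nilpotent.
have DLs : DL (m s) = m (D s) by apply: base_change_map.
have [q' Eq'] : divides p' (m (D s)).
  by apply: divides_trans p'p _; exists (m q); rewrite -rmorphM -Eq.
have DLDLs : DL (m (D s)) = 0 by rewrite [LHS]base_change_map Dh rmorph0.
have mh0 := m0 _ h0.
have [p'0 p'u p'p'] := p'prime.
have DLp' : DL p' = 0.
  by apply: (factorially_closed (v := q')) => //; rewrite -Eq'.
have DLq' : DL q' = 0.
  by apply: (factorially_closed (v := p')) => //; rewrite mulrC -Eq'.
(* Over [L] the multiple f(s) of [p'] is a constant times a product of factors s - c, and [p']
   divides one of these. The quotient [s'] has derivative [q'], of smaller degree than [D s]. *)
have [c [s' Es']] : exists c, divides p' (m s - c%:MP).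
  have : divides p' (m (horner_alg s f)).
    by apply: divides_trans p'p _; case: pf => x ->; exists (m x);
      rewrite -rmorphM.
  have -> : m (horner_alg s f) =
      (iota (lead_coef f))%:MP * \prod_(c <- r) (m s - c%:MP).
    have -> : m (horner_alg s f) = horner_alg (m s) (map_poly iota f).
      elim/poly_ind: (f) => [|g c IHg]; first by rewrite !rmorph0 [LHS]rmorph0.
      rewrite !(rmorphD, rmorphM) /= map_polyX map_polyC !horner_algX.
      rewrite !horner_algC !alg_mpolyC -IHg [LHS]rmorphD /= rmorphM.
      by rewrite [map_mpoly _ _%:MP]map_mpolyC.
    rewrite Ef -mul_polyC rmorphM /= horner_algC alg_mpolyC rmorph_prod /=.
    congr (_ * _); apply: eq_bigr => c _.
    by rewrite rmorphB /= horner_algX horner_algC alg_mpolyC.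
  case/p'p'; last by move/(prime_divides_prod p'prime).
  case=> x Ex; case: p'u; exists ((iota (lead_coef f))^-1%:MP * x).
  rewrite mulrCA -Ex -mpolyCM mulVf // fmorph_eq0 lead_coef_eq0 //.
have DLs' : DL s' = q'.
  apply: (mulfI p'0); rewrite -Eq' -DLs.
  have -> : m s = p' * s' + c%:MP by rewrite -Es' subrK.
  rewrite linearD DLder DLp' mul0r add0r -[c%:MP]mulr1 mul_mpolyC.
  by rewrite linearZZ (derivation1 DLder) scaler0 addr0.
move=> u v; have [|||w Ew] := IH L DL s' _ charL DLder DLnil _ _ (m u) (m v).
- rewrite DLs' ltnS in szn *; apply: leq_trans szn.
  rewrite -(szm (D s)) Eq'; apply: msize_proper_factor => //.
  by rewrite -Eq'.
- by rewrite DLs'; apply: contraNneq mh0 => z; rewrite Eq' z mulr0.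
- by rewrite DLs'.
have E : DL w = m (D u * v).
  by rewrite -Ew [RHS]rmorphM; congr (_ * _); apply: base_change_map.
by have [g Eg] := base_change_descent ret E; exists g.
Qed.

(** * Unipotent automorphisms *)

Lemma poly_eq0_on_nat (R : idomainType) (p : {poly R}) : [pchar R] =i pred0 ->
  (forall k : nat, p.[k%:R] = 0) -> p = 0.
Proof.
move=> charR H; apply/eqP/negPn/negP => p0.
have := max_poly_roots (rs := [seq k%:R | k <- iota 0 (size p)]) p0.
rewrite size_map size_iota ltnn => E; suff: false by []; apply: E.
  by apply/allP => x /mapP[k _ ->]; rewrite /root H.
rewrite map_inj_in_uniq ?iota_uniq // => x y _ _.
have inj (a b : nat) : (a <= b)%N -> a%:R = b%:R :> R -> a = b.
  move=> le E; apply/eqP; rewrite eqn_leq le /= -subn_eq0.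
  by rewrite -(proj1 (pcharf0P R) charR) natrB // E subrr.
by move=> E; case: (leqP x y) => [/inj ->//|/ltnW/inj ->].
Qed.

Section Binomial.
Variable K : fieldType.
Hypothesis charK : [pchar K] =i pred0.

Fixpoint binomial_poly j : {poly K} :=
  if j is i.+1 then i.+1%:R^-1 *: (binomial_poly i * ('X - i%:R%:P)) else 1.

Lemma horner_binomial_poly j (k : nat) :
  (binomial_poly j).[k%:R] = 'C(k, j)%:R.
Proof.
elim: j => [|j IH] /=; first by rewrite hornerC bin0.
have nz : j.+1%:R != 0 :> K by rewrite (proj1 (pcharf0P K) charK).
rewrite hornerZ hornerM IH hornerXsubC; apply: (mulfI nz).
rewrite mulVKf // -natrM mul_bin_left natrM.
have [le|lt] := leqP j k; first by rewrite natrB // mulrC.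
by rewrite bin_small // mul0r mulr0.
Qed.

End Binomial.

Section Unipotent.
Variables (K : fieldType).
Notation A := {mpoly K[2]}.
Variables psi eps : {linear A -> A}.
Hypothesis psiE : forall u, psi u = u + eps u.
Hypothesis charK : [pchar K] =i pred0.
Hypothesis psi1 : psi 1 = 1.
Hypothesis psiM : forall u v, psi (u * v) = psi u * psi v.

Hypothesis eps_nil : locally_nilpotent eps.

Let charA : [pchar A] =i pred0.
Proof.
apply/pcharf0P => n; rewrite -mpolyC_nat mpolyC_eq0.
exact: (proj1 (pcharf0P K) charK).
Qed.

(** The binomial expansion of (1 + eps)^k, cut off by local nilpotency at a bound independent of
    [k]. *)
Lemma flow_interpolation u : exists n, forall k : nat,
  (\sum_(j < n) map_poly (in_alg A) (binomial_poly K j) *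
     (iter j eps u)%:P).[k%:R] = iter k psi u.
Proof.
have [n En] := eps_nil u; exists n => k; rewrite horner_sum.
transitivity (\sum_(j < n) iter j eps u *+ 'C(k, j)).
  apply: eq_bigr => j _; rewrite hornerM hornerC -[RHS]mulr_natl; congr (_ * _).
  by rewrite -(rmorph_nat (in_alg A)) horner_map horner_binomial_poly //
    rmorph_nat.
case: n En => [|n] En.
  rewrite big_ord0; elim: k => [|k IH]; first by rewrite -[LHS]En.
  by rewrite iterS -IH linear0.
elim: k => [|k IH].
  by rewrite big_ord_recl bin0 mulr1n big1 ?addr0.
rewrite iterS -IH psiE linear_sum [X in _ = _ + X]big_ord_recr.
rewrite [X in _ = X + _]big_ord_recl /= linearMn -iterS En mul0rn addr0 -addrA.
rewrite -big_split big_ord_recl /= !bin0; congr (_ + _); apply: eq_bigr => j _.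
by rewrite /bump linearMn -iterS add1n -mulrnDr -binS.
Qed.

Let flow_exists u :
  exists p : {poly A}, forall k : nat, p.[k%:R] = iter k psi u.
Proof.
have [n En] := flow_interpolation u.
by exists (\sum_(j < n) map_poly (in_alg A) (binomial_poly K j) *
  (iter j eps u)%:P).
Qed.

(* [flow u] interpolates the orbit of [u], and [log_fun u] is its velocity at
   time [0]. *)
Definition flow u : {poly A} :=
  proj1_sig (constructive_indefinite_description _ (flow_exists u)).

Lemma flowP u (k : nat) : (flow u).[k%:R] = iter k psi u.
Proof. by rewrite /flow; case: constructive_indefinite_description. Qed.

Lemma flow_unique u p : (forall k : nat, p.[k%:R] = iter k psi u) -> flow u = p.
Proof.
move=> H; apply/eqP; rewrite -subr_eq0; apply/eqP.
by apply: poly_eq0_on_nat => // k; rewrite hornerD hornerN flowP H subrr.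
Qed.

Lemma flow_explicit u : exists n, flow u =
  \sum_(j < n) map_poly (in_alg A) (binomial_poly K j) * (iter j eps u)%:P.
Proof.
have [n En] := flow_interpolation u; exists n.
by apply: flow_unique => k; rewrite En.
Qed.

Lemma flow0 u : (flow u).[0] = u.
Proof. exact: flowP u 0. Qed.

Lemma flow_linear a u v : flow (a *: u + v) = a%:MP *: flow u + flow v.
Proof.
apply: flow_unique => k.
by rewrite hornerD hornerZ !flowP mul_mpolyC iter_linearP.
Qed.

Lemma flowM u v : flow (u * v) = flow u * flow v.
Proof.
apply: flow_unique => k; rewrite hornerM !flowP.
by elim: k => //= k <-; rewrite psiM.
Qed.

Definition log_fun u : A := (flow u)`_1.

Lemma log_is_linear : linear log_fun.
Proof. by move=> a u v;
  rewrite /log_fun flow_linear coefD coefZ mul_mpolyC. Qed.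

Definition log_endo : {linear A -> A} :=
  HB.pack log_fun (GRing.isLinear.Build K A A *:%R log_fun log_is_linear).

Lemma log_derivation : derivation log_endo.
Proof.
move=> u v; rewrite /= /log_fun flowM coefM big_ord_recl big_ord1 /=.
by rewrite -!horner_coef0 !flow0 addrC.
Qed.

(** By uniqueness, the flow of [psi v] arises from that of [v] by applying [psi] to the
    coefficients. *)
Lemma log_iter_psi u k : log_fun (iter k psi u) = iter k psi (log_fun u).
Proof.
have comm v : log_fun (psi v) = psi (log_fun v).
  rewrite /log_fun (_ : flow (psi v) = map_poly psi (flow v)) ?coef_map //.
  apply: flow_unique => m.
  have -> : (map_poly psi (flow v)).[m%:R] = psi (flow v).[m%:R].
    rewrite !(horner_coef_wide _ (size_poly _ _)) horner_coef linear_sum.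
    apply: eq_bigr => i _; rewrite coef_map psiM /=; congr (_ * _).
    elim: (i : nat) => [|l IHl]; first by rewrite expr0 psi1.
    by rewrite !exprS psiM -IHl linearMn psi1.
  by rewrite flowP -iterSr.
by elim: k => //= k IH; rewrite comm IH.
Qed.

(** The flow of psi^k u is that of [u] translated in time by [k]; its linear coefficient is the
    derivative at [k]. *)
Lemma flow_log u : flow (log_fun u) = (flow u)^`().
Proof.
apply: flow_unique => k; rewrite -log_iter_psi /log_fun.
have -> : flow (iter k psi u) = flow u \Po ('X + k%:R%:P).
  apply: flow_unique => m; rewrite horner_comp !hornerE -natrD flowP.
  by rewrite iterD.
have := coef_deriv (flow u \Po ('X + k%:R%:P)) 0; rewrite mulr1n => <-.
by rewrite deriv_comp -horner_coef0 hornerM horner_comp !hornerE derivD derivX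
  derivC !hornerE.
Qed.

Lemma flow_iter_log u n : flow (iter n log_endo u) = (flow u)^`(n).
Proof. by elim: n => //= n IH; rewrite flow_log IH. Qed.

Lemma log_nilpotent : locally_nilpotent log_endo.
Proof.
move=> u; exists (size (flow u)).
by rewrite -[LHS]flow0 flow_iter_log derivn_poly0 // horner0.
Qed.

(** The series eps - eps^2/2 + ... of the logarithm: every term of index at least 1 contains a
    factor [eps]. *)
Lemma log_image_sub u : exists w, log_endo u = eps w.
Proof.
have [n E] := flow_explicit u; rewrite /= /log_fun E coef_sum.
case: n {E} => [|n]; first by exists 0; rewrite big_ord0 linear0.
rewrite big_ord_recl /= rmorph1 mul1r coefC add0r.
exists (\sum_(i < n) (binomial_poly K i.+1)`_1 *: iter i eps u).
rewrite linear_sum; apply: eq_bigr => i _; rewrite linearZZ -iterS.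
by rewrite coefMC coef_map mulr_algl.
Qed.

(** Taylor's formula for the flow between times 0 and 1, that is, eps = D + D^2/2! + ... with D the
    logarithm. *)
Lemma eps_image_sub u : exists w, eps u = log_endo w.
Proof.
have -> : eps u = \sum_(i < (size (flow u)).-1) (flow u)`_i.+1.
  have -> : eps u = (flow u).[1%:R] - (flow u).[0%:R].
    by rewrite !flowP /= psiE addrAC subrr add0r.
  rewrite horner_coef0 horner_coef;
    case: (size (flow u)) (size_poly_eq0 (flow u)).
    by move=> /esym/eqP ->; rewrite coef0 !big_ord0 subrr.
  move=> m _; rewrite big_ord_recl expr0 mulr1 addrAC subrr add0r.
  by apply: eq_bigr => i _; rewrite expr1n mulr1.
exists (\sum_(i < (size (flow u)).-1) (i.+1)`!%:R^-1 *: iter i log_endo u).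
rewrite linear_sum; apply: eq_bigr => i _; rewrite linearZZ -iterS.
rewrite -[iter _ _ u]flow0 flow_iter_log horner_coef0 coef_derivn addn0 ffactnn.
rewrite -scaler_nat scalerA mulVf ?scale1r //.
by rewrite (proj1 (pcharf0P K) charK) -lt0n fact_gt0.
Qed.

(** [eps] and its logarithm have the same image, and the logarithm is a locally nilpotent
    derivation. The last iterate but one of [u'] before 0 serves as the element [s] of
    [LND_image_ideal]. *)
Theorem unipotent_image_ideal u v : exists w, eps u * v = eps w.
Proof.
have [u' Eu] := eps_image_sub u; rewrite Eu.
suff [w ->] : exists w, log_endo u' * v = log_endo w by apply: log_image_sub.
have [->|nz] := eqVneq (log_endo u') 0; first by exists 0;
  rewrite mul0r linear0.
have u'0 : u' != 0 by apply: contraNneq nz => ->; rewrite linear0.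
have [[|n] n1 n2] := locally_nilpotent_order (log_nilpotent u') u'0.
  by case/negP: nz; rewrite -n2.
exact: (LND_image_ideal (s := iter n log_endo u')) log_derivation log_nilpotent
  _ _ _ _.
Qed.

End Unipotent.

(** * Generalized eigenspaces *)

Lemma iter_linear_sum (K : nzRingType) (V : lmodType K) (f : {linear V -> V}) k
    (I : Type) (r : seq I) (F : I -> V) :
  iter k f (\sum_(i <- r) F i) = \sum_(i <- r) iter k f (F i).
Proof.
by elim: k => //= k ->; rewrite linear_sum.
Qed.

Section Eigen.
Variables (K : fieldType) (n0 : nat).
Notation A := {mpoly K[n0]}.
Variable phi : {linear A -> A}.
Hypothesis phi1 : phi 1 = 1.
Hypothesis phiM : forall u v, phi (u * v) = phi u * phi v.
Implicit Types (l m c : K) (u v w : A) (d : seq (K * A)).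

Definition shift_fun l u := phi u - l *: u.

Lemma shift_is_linear l : linear (shift_fun l).
Proof.
move=> a u v; rewrite /shift_fun linearP !scalerDr scalerN !scalerA.
by rewrite (mulrC l) opprD addrACA.
Qed.

(* Sealed by [Qed], so that simplification does not unfold [shift l] to the
   underlying function. *)
Fact shift_sig l : {f : {linear A -> A} | forall u, f u = phi u - l *: u}.
Proof.
by exists (HB.pack_for {linear A -> A} (shift_fun l)
  (GRing.isLinear.Build K A A *:%R (shift_fun l) (shift_is_linear l))).
Qed.

Definition shift l : {linear A -> A} := sval (shift_sig l).

Lemma shiftE l u : shift l u = phi u - l *: u.
Proof. exact: svalP (shift_sig l) u. Qed.

Lemma phi_shift l u : phi (shift l u) = shift l (phi u).
Proof. by rewrite !shiftE linearB linearZZ. Qed.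

Lemma shift_comm l m u : shift l (shift m u) = shift m (shift l u).
Proof.
by rewrite (shiftE m u) linearB linearZZ -phi_shift -shiftE.
Qed.

Lemma iter_comm (f g : A -> A) k u : (forall v, f (g v) = g (f v)) ->
  iter k f (g u) = g (iter k f u).
Proof. by move=> fg; elim: k => //= k ->. Qed.

Definition gen l u := exists k, iter k (shift l) u = 0.

Lemma gen0 l : gen l 0. Proof. by exists 0%N. Qed.

Lemma gen_le l u k k' : iter k (shift l) u = 0 -> (k <= k')%N ->
  iter k' (shift l) u = 0.
Proof. by move=> E /subnK <-; rewrite iterD E iter_linear0. Qed.

Lemma genP l a u v : gen l u -> gen l v -> gen l (a *: u + v).
Proof.
move=> [i Ei] [j Ej]; exists (i + j)%N; rewrite iter_linearP.
by rewrite (gen_le Ei) ?leq_addr // (gen_le Ej) ?leq_addl // scaler0 addr0.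
Qed.

Lemma genD l u v : gen l u -> gen l v -> gen l (u + v).
Proof. by move=> gu gv; rewrite -[u]scale1r; apply: genP. Qed.

Lemma genZ l a u : gen l u -> gen l (a *: u).
Proof. by move=> gu; rewrite -[_ *: _]addr0; apply: genP (gen0 l). Qed.

Lemma gen_sum l (I : Type) (r : seq I) (P : pred I) (F : I -> A) :
  (forall i, P i -> gen l (F i)) -> gen l (\sum_(i <- r | P i) F i).
Proof.
by move=> H; apply: (big_ind (gen l)) => //; [apply: gen0 | apply: genD].
Qed.

Lemma gen_shift l m u : gen l u -> gen l (shift m u).
Proof.
move=> [k E]; exists k; rewrite iter_comm; last by move=> v; apply: shift_comm.
by rewrite E linear0.
Qed.

Lemma gen_unshift l u : gen l (shift l u) -> gen l u.
Proof. by move=> [k E]; exists k.+1; rewrite iterSr. Qed.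

(** The twisted Leibniz rule (phi - l m)(u v) = (phi - l) u phi(v) + l u (phi - m) v lowers the sum
    of the two nilpotency orders. *)
Lemma genM l m u v : gen l u -> gen m v -> gen (l * m) (u * v).
Proof.
move=> [i Ei] [j Ej]; have [N] := ubnP (i + j)%N.
elim: N i j u v Ei Ej => // N IH [|i] [|j] u v.
- by move=> /= -> _ _; rewrite mul0r; apply: gen0.
- by move=> /= -> _ _; rewrite mul0r; apply: gen0.
- by move=> _ /= -> _; rewrite mulr0; apply: gen0.
move=> Ei Ej szN; apply: gen_unshift.
have -> : shift (l * m) (u * v) = shift l u * phi v + l *: (u * shift m v).
  rewrite !shiftE phiM mulrBl mulrBr scalerBr -!scalerAl -!scalerAr scalerA.
  by rewrite addrA subrK.
apply: genD.
  apply: (IH i j.+1); [by rewrite -iterSr | | by rewrite addSn ltnS in szN].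
  rewrite (iter_comm (f := shift m) (g := phi)) ?Ej ?linear0 // => w.
  by rewrite phi_shift.
apply/genZ/(IH i.+1 j) => //; first by rewrite -iterSr.
by rewrite addnS ltnS in szN.
Qed.

(** On [gen l] the operator phi - m is the nonzero scalar l - m plus the locally nilpotent phi -
    l. *)
Lemma gen_shift_surj l m u : l != m -> gen l u ->
  exists2 w, gen l w & shift m w = u.
Proof.
move=> lm [k]; elim: k u => [|k IH] u.
  by move=> /= ->; exists 0; [apply: gen0 | rewrite linear0].
rewrite iterSr => E; have [w gw Ew] := IH _ E.
have c0 : l - m != 0 by rewrite subr_eq0.
exists ((l - m)^-1 *: (u - w)).
  apply: genZ; rewrite -scaleN1r addrC; apply: genP => //.
  by exists k.+1; rewrite iterSr.
rewrite linearZZ linearB Ew; apply: (scalerI c0).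
rewrite scalerA mulfV // scale1r !shiftE scalerBl.
by rewrite opprB [LHS]addrC addrA subrK.
Qed.

Lemma gen_shift_inj l m u : l != m -> gen l u -> shift m u = 0 -> u = 0.
Proof.
move=> lm [k Ek] E.
have Eu : shift l u = (m - l) *: u.
  by move/eqP: E; rewrite !shiftE subr_eq0 => /eqP ->; rewrite scalerBl.
have : iter k (shift l) u = (m - l) ^+ k *: u.
  elim: k {Ek} => [|k IH]; first by rewrite expr0 scale1r.
  by rewrite iterS IH linearZZ Eu scalerA exprSr.
rewrite Ek => /esym/eqP; rewrite scaler_eq0 expf_eq0 subr_eq0 eq_sym (negPf lm).
by rewrite andbF => /eqP.
Qed.

Lemma gen_independent (s : seq K) (f : K -> A) :
  uniq s -> (forall l, l \in s -> gen l (f l)) ->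
  \sum_(l <- s) f l = 0 -> forall l, l \in s -> f l = 0.
Proof.
elim: s f => // l0 s IH f /= /andP[l0s us] gf.
rewrite big_cons => E; have [k Ek] := gf l0 (mem_head _ _).
have ne l : l \in s -> l != l0 by apply: contraTneq => ->.
have fs l : l \in s -> f l = 0.
  move=> ls; have gl : gen l (f l) by apply: gf; rewrite inE ls orbT.
  have : iter k (shift l0) (f l) = 0.
    apply: (IH (fun m => iter k (shift l0) (f m))) => //.
      move=> m ms; have gm : gen m (f m) by apply: gf; rewrite inE ms orbT.
      by elim: k {Ek} => //= k; apply: gen_shift.
    rewrite -iter_linear_sum; move/eqP: E; rewrite addrC addr_eq0 => /eqP ->.
    by rewrite -scaleN1r -[_ *: _]addr0 iter_linearP Ek scaler0 iter_linear0
      addr0.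
  elim: k {Ek} => //= k IHk /(gen_shift_inj (ne l ls)) H; apply: IHk; apply: H.
  by elim: k => //= k; apply: gen_shift.
move=> l; rewrite inE => /orP[/eqP ->|/fs //].
by move: E; rewrite big_seq big1 ?addr0 // => m /fs.
Qed.

(** Decompositions are lists of pairs in which an eigenvalue may repeat, so they add by
    concatenation and multiply entrywise; [part] collects the repetitions and does not depend on the
    list chosen. *)
Definition wf d := forall x, x \in d -> gen x.1 x.2.
Definition total d := \sum_(x <- d) x.2.
Definition part l d := \sum_(x <- d | x.1 == l) x.2.

Lemma gen_part l d : wf d -> gen l (part l d).
Proof.
move=> wd; rewrite /part big_seq_cond; apply: gen_sum => x /andP[xd /eqP <-].
exact: wd.
Qed.

Lemma total_parts d : total d = \sum_(l <- undup [seq x.1 | x <- d]) part l d.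
Proof.
rewrite /total (exchange_big_dep xpredT) //= [LHS]big_seq [RHS]big_seq.
apply: eq_bigr => x xd; rewrite -big_filter (eq_filter (a2 := pred1 x.1)).
  by rewrite filter_pred1_uniq ?undup_uniq ?mem_undup ?map_f // big_seq1.
by move=> l; rewrite /= eq_sym.
Qed.

Lemma part_eq0 d l : wf d -> total d = 0 -> part l d = 0.
Proof.
move=> wd; rewrite total_parts => E.
have [ls|nls] := boolP (l \in undup [seq x.1 | x <- d]).
  by apply: (gen_independent (undup_uniq _) _ E) => // m _; apply: gen_part.
rewrite /part big_seq_cond big1 // => x /andP[xd /eqP xl].
by case/negP: nls; rewrite mem_undup -xl map_f.
Qed.

Lemma wf_cat d d' : wf d -> wf d' -> wf (d ++ d').
Proof. by move=> w w' x; rewrite mem_cat => /orP[/w|/w']. Qed.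

Lemma total_cat d d' : total (d ++ d') = total d + total d'.
Proof. by rewrite /total big_cat. Qed.

Lemma part_cat l d d' : part l (d ++ d') = part l d + part l d'.
Proof. by rewrite /part big_cat. Qed.

Definition dlift (f : A -> A) d := [seq (x.1, f x.2) | x <- d].

Lemma wf_dlift f d : (forall l u, gen l u -> gen l (f u)) -> wf d ->
  wf (dlift f d).
Proof. by move=> gf wd x /mapP[y yd ->] /=; apply: gf; apply: wd. Qed.

Lemma total_dlift (f : {linear A -> A}) d : total (dlift f d) = f (total d).
Proof. by rewrite /total big_map linear_sum. Qed.

Lemma part_dlift l (f : {linear A -> A}) d : part l (dlift f d) = f (part l d).
Proof. by rewrite /part big_map linear_sum. Qed.

Lemma part_unique l d d' : wf d -> wf d' -> total d = total d' ->
  part l d = part l d'.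
Proof.
move=> w w' E; apply/eqP; rewrite -subr_eq0 -scaleN1r.
pose opp : {linear A -> A} := GRing.scale (-1).
rewrite -[_ *: _]/(opp _) -part_dlift -part_cat part_eq0 //.
  by apply: wf_cat => //; apply: wf_dlift => // m u; apply: genZ.
by rewrite total_cat total_dlift -E /= scaleN1r subrr.
Qed.

Definition dmul d d' := [seq (x.1 * y.1, x.2 * y.2) | x <- d, y <- d'].

Lemma wf_dmul d d' : wf d -> wf d' -> wf (dmul d d').
Proof.
move=> w w' z /allpairsP[[x y] /= [xd yd ->]] /=.
by apply: genM; [apply: w | apply: w'].
Qed.

Lemma total_dmul d d' : total (dmul d d') = total d * total d'.
Proof.
rewrite /total big_allpairs_dep mulr_suml; apply: eq_bigr => x _.
by rewrite mulr_sumr.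
Qed.

Definition dexp d k := iter k (dmul d) [:: (1, 1)].

Lemma gen1_const c : gen 1 c%:MP.
Proof.
by exists 1%N; rewrite /= shiftE scale1r -[c%:MP]mulr1 mul_mpolyC
  linearZZ phi1 subrr.
Qed.

Lemma wf_dexp d k : wf d -> wf (dexp d k).
Proof.
move=> w; elim: k => [|k IH] /=; last exact: wf_dmul.
by move=> x; rewrite inE => /eqP -> /=; apply: gen1_const.
Qed.

Lemma total_dexp d k : total (dexp d k) = total d ^+ k.
Proof.
elim: k => [|k IH]; first by rewrite /total big_seq1.
by rewrite /= total_dmul -/(dexp d k) IH exprS.
Qed.

Definition decomposable (P : K -> Prop) v :=
  exists d, [/\ wf d, total d = v & forall x, x \in d -> P x.1].

Lemma decomposable_all (P : K -> Prop) :
  P 1 -> (forall l m, P l -> P m -> P (l * m)) ->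
  (forall i : 'I_n0, decomposable P 'X_i) -> forall v, decomposable P v.
Proof.
move=> P1 PM PX v; rewrite (mpolyE v).
have dC c : decomposable P c%:MP.
  exists [:: (1, c%:MP)]; split; last by move=> x; rewrite inE => /eqP ->.
    by move=> x; rewrite inE => /eqP -> /=; apply: gen1_const.
  by rewrite /total big_seq1.
have dM u w : decomposable P u -> decomposable P w -> decomposable P (u * w).
  move=> [d [w1 <- P1']] [d' [w2 <- P2']]; exists (dmul d d'); split.
  - exact: wf_dmul.
  - exact: total_dmul.
  - by move=> z /allpairsP[[x y] /= [xd yd ->]] /=; apply: PM; auto.
have dD u w : decomposable P u -> decomposable P w -> decomposable P (u + w).
  move=> [d [w1 <- P1']] [d' [w2 <- P2']]; exists (d ++ d'); split.
  - exact: wf_cat.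
  - exact: total_cat.
  - by move=> x; rewrite mem_cat => /orP[]; auto.
apply: (big_ind (decomposable P)) => [|u w|m _];
  [by rewrite -(mpolyC0 n0 K); apply: dC | exact: dD |].
rewrite -mul_mpolyC; apply: (dM _ _ (dC _)); rewrite mpolyXE_id.
apply: (big_ind (decomposable P)) => [|u w|i _]; [exact: dC 1 | exact: dM |].
by elim: (m i) => [|k IH]; rewrite ?expr0 ?exprS; [apply: dC 1 | apply: dM].
Qed.

(** phi - c is onto on every eigenspace except that of [c]. With c = 1, only the part at 1 can keep
    an element out of the image. *)
Lemma shift_decomposition c d : wf d ->
  exists2 d', wf d' & shift c (total d') = total d - part c d.
Proof.
elim: d => [|x d IH] wd.
  by exists [::] => //; rewrite /total /part !big_nil linear0 subrr.
have [|d' wd' Ed'] := IH; first by move=> y yd; apply: wd; rewrite inE yd orbT.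
have gx := wd x (mem_head _ _); rewrite /total /part !big_cons.
have [E|ne] := eqVneq x.1 c.
  by exists d'; rewrite //= opprD addrACA subrr add0r Ed'.
have [w gw Ew] := gen_shift_surj ne gx; exists ((x.1, w) :: d').
  by move=> y; rewrite inE => /orP[/eqP -> //|]; apply: wd'.
by rewrite /total big_cons linearD /= Ew -/(total d') Ed' addrA.
Qed.

Lemma decomposable_roots (rs : seq K) v :
  foldl (fun u c => shift c u) v rs = 0 -> decomposable (fun=> True) v.
Proof.
elim: rs v => [|c rs IH] v /=.
  by move=> ->; exists [::]; split=> //; rewrite /total big_nil.
case/IH=> d [wd Ed _]; have [d' wd' Ed'] := shift_decomposition c wd.
(* [shift c] sends [total d'] to [shift c v] without its part at [c], so the remainder
   [v - total d'] is a generalized eigenvector for [c]. *)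
exists ((c, v - total d') :: d'); split=> //.
  move=> x; rewrite inE => /orP[/eqP -> /=|]; last exact: wd'.
  apply: gen_unshift; rewrite linearB Ed' Ed opprB addrC subrK.
  exact: gen_part.
by rewrite /total big_cons subrK.
Qed.

End Eigen.

(** * Eigenvalues of finite order *)

Section Cases.
Variable K : fieldType.
Notation A := {mpoly K[2]}.
Variable phi : {linear A -> A}.
Hypothesis charK : [pchar K] =i pred0.
Hypothesis phi1 : phi 1 = 1.
Hypothesis phiM : forall u v, phi (u * v) = phi u * phi v.
Hypothesis dec : forall v, decomposable phi (fun=> True) v.

Local Notation eps := (shift phi 1).
Local Notation gen := (gen phi).
Local Notation wf := (wf phi).

Definition img f := exists w, eps w = f.

Definition img_absorbing := forall f, (forall m, (0 < m)%N -> img (f ^+ m)) ->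
  forall g, exists n, forall m, (n < m)%N -> img (f ^+ m * g).

Lemma phi_eps u : phi u = u + eps u.
Proof. by rewrite shiftE scale1r addrC subrK. Qed.

Lemma img0 : img 0. Proof. by exists 0; rewrite linear0. Qed.

Lemma imgD u v : img u -> img v -> img (u + v).
Proof. by move=> [x <-] [y <-]; exists (x + y); rewrite linearD. Qed.

Lemma img_sub_part d : wf d -> img (total d - part 1 d).
Proof. by case/(shift_decomposition 1) => d' _ <-; exists (total d'). Qed.

Lemma img_part0 d : wf d -> part 1 d = 0 -> img (total d).
Proof. by move=> wd E; have := img_sub_part wd; rewrite E subr0. Qed.

Lemma part_img d : wf d -> img (total d) ->
  exists2 b, gen 1 b & part 1 d = eps b.
Proof.
move=> wd [g Eg]; have [d' [wd' Ed' _]] := dec g.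
exists (part 1 d'); first exact: gen_part.
rewrite -part_dlift; apply: (part_unique (phi := phi)) => //.
  by apply: wf_dlift wd' => l u; apply: gen_shift.
by rewrite total_dlift Ed' Eg.
Qed.

Lemma eps_const c : eps c%:MP = 0.
Proof.
by rewrite shiftE scale1r -[c%:MP]mulr1 mul_mpolyC linearZZ phi1 subrr.
Qed.

Lemma constant_eigenvalue l u : gen l u -> (msize u <= 1)%N -> u != 0 -> l = 1.
Proof.
move=> gu /msize1_polyC Eu u0; apply/eqP/negPn/negP => l1.
case/negP: u0; apply/eqP/(gen_shift_inj l1 gu).
by rewrite Eu eps_const.
Qed.

(** Here [eps] kills [B], so elements of the image have no part at 1. Multiplication cannot create
    one: a nonzero product of eigenvalue 1 would be constant, its factors too, and constants have
    eigenvalue 1. *)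
Lemma img_absorbing_trivial :
  (forall b, gen 1 b -> (msize b <= 1)%N) -> img_absorbing.
Proof.
move=> B1; suff ideal f g : img f -> img (f * g).
  move=> f Hf g; exists 0%N => m m0; exact/ideal/Hf.
have [d [wd <- _]] := dec f; have [d' [wd' <- _]] := dec g.
move=> /(part_img wd)[b gb]; rewrite (msize1_polyC (B1 b gb)) eps_const => P0.
pose e := [seq x <- d | x.1 != 1].
have we : wf e by move=> x; rewrite mem_filter => /andP[_]; apply: wd.
have -> : total d = total e.
  rewrite /total big_filter (bigID (fun x => x.1 == 1)) /=.
  by rewrite -[X in X + _]/(part 1 d) P0 add0r.
rewrite -total_dmul; apply: img_part0; first exact: wf_dmul.
rewrite /part big_seq_cond big1 // => z /andP[/allpairsP[[x y] /= [xe yd ->]]].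
move=> /= /eqP E; apply/eqP/negPn/negP => nz.
have xg := we _ xe; have yg := wd' _ yd.
have := B1 (x.2 * y.2); rewrite -E => /(_ (genM phiM xg yg)).
have [x0 y0] : x.2 != 0 /\ y.2 != 0.
  by move: nz; rewrite mulf_eq0 negb_or => /andP.
rewrite msizeM // => le1.
have x1 : (msize x.2 <= 1)%N.
  have arith m n : (n != 0)%N -> ((m + n).-1 <= 1)%N -> (m <= 1)%N by lia.
  by apply: arith le1; rewrite msize_poly_eq0.
by move: xe; rewrite mem_filter (constant_eigenvalue xg x1 x0) eqxx.
Qed.

Lemma phi_horner_alg u (q : {poly K}) :
  phi (horner_alg u q) = horner_alg (phi u) q.
Proof.
elim/poly_ind: q => [|q c IH]; first by rewrite !rmorph0 linear0.
rewrite !(rmorphD, rmorphM) /= !horner_algX !horner_algC linearD phiM IH.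
by rewrite linearZZ phi1.
Qed.

Lemma binomial_poly_diff j :
  binomial_poly K j.+1 \Po ('X + 1) - binomial_poly K j.+1 = binomial_poly K j.
Proof.
apply/eqP; rewrite -subr_eq0; apply/eqP/poly_eq0_on_nat => // k.
rewrite !(hornerD, hornerN) horner_comp.
have -> : ('X + 1 : {poly K}).[k%:R] = k.+1%:R by rewrite !hornerE natr1.
rewrite !horner_binomial_poly // binS natrD.
by rewrite addrAC addrK subrr.
Qed.

(** [eps] acts on the binomial polynomials in [s] as a difference operator. If n + 1 steps kill [b],
    then n steps give a constant, and a multiple of binom(s, n), which has the preimage binom(s,
    n+1), lowers the order. *)
Lemma eps_surjective s :
  eps s = 1 -> (forall p, eps p = 0 -> (msize p <= 1)%N) ->
  forall f, img f.
Proof.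
move=> Es K1 f; have [d [wd <- _]] := dec f.
rewrite -[total d](subrK (part 1 d)); apply: imgD; first exact: img_sub_part.
have [n] := gen_part 1 wd; elim: n (part 1 d) => [|n IH] b.
  by move=> /= ->; apply: img0.
have epsS j : eps (horner_alg s (binomial_poly K j.+1)) =
    horner_alg s (binomial_poly K j).
  rewrite shiftE scale1r phi_horner_alg phi_eps Es -(binomial_poly_diff j).
  rewrite rmorphB; congr (_ - _).
  elim/poly_ind: (binomial_poly K j.+1) => [|q c IHq];
    first by rewrite !rmorph0.
  rewrite comp_polyD comp_polyM comp_polyX comp_polyC !(rmorphD, rmorphM) /=.
  by rewrite !horner_algX !horner_algC IHq scale1r.
move=> E; have Ec := msize1_polyC (K1 (iter n eps b) E);
  set c := (_ @_ _) in Ec.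
pose S := horner_alg s (binomial_poly K n).
have ES : iter n eps S = 1.
  rewrite /S; elim: (n) => [|j IHj]; first by rewrite rmorph1.
  by rewrite iterSr epsS.
have : img (- c *: S + b).
  by apply: IH; rewrite iter_linearP ES Ec -mul_mpolyC mulr1 mpolyCN addNr.
move=> /imgD H; rewrite -[b](addKr (- c *: S)) addrC; apply: H.
exists (c *: horner_alg s (binomial_poly K n.+1)).
by rewrite linearZZ epsS scaleNr opprK.
Qed.

(** The quotient of phi^N - l^N by phi - l. *)
Definition geometric_fun N l u := \sum_(i < N) l ^+ (N.-1 - i) *: iter i phi u.

Lemma geometric_is_linear N l : linear (geometric_fun N l).
Proof.
move=> a u v; rewrite /geometric_fun scaler_sumr -big_split.
by apply: eq_bigr => i _; rewrite /= iter_linearP scalerDr !scalerA mulrC.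
Qed.

Fact geometric_sig N l : {f : {linear A -> A} | f =1 geometric_fun N l}.
Proof.
by exists (HB.pack_for {linear A -> A} (geometric_fun N l)
    (GRing.isLinear.Build K A A *:%R (geometric_fun N l)
      (geometric_is_linear N l))).
Qed.

Definition geometric N l : {linear A -> A} := sval (geometric_sig N l).

Lemma geometric_def N l u :
  geometric N l u = \sum_(i < N) l ^+ (N.-1 - i) *: iter i phi u.
Proof. exact: svalP (geometric_sig N l) u. Qed.

Lemma geometric_comm N l m u :
  geometric N l (shift phi m u) = shift phi m (geometric N l u).
Proof.
rewrite !geometric_def linear_sum; apply: eq_bigr => i _; rewrite linearZZ.
by congr (_ *: _); apply: iter_comm => v; rewrite phi_shift.
Qed.

Lemma geometricE N l u :
  iter N phi u - l ^+ N *: u = shift phi l (geometric N l u).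
Proof.
rewrite shiftE geometric_def linear_sum scaler_sumr -sumrB.
rewrite (eq_bigr (fun i : 'I_N => l ^+ (N - i.+1) *: iter i.+1 phi u
    - l ^+ (N - i) *: iter i phi u)) => [|i _].
  rewrite -(big_mkord xpredT (fun i => l ^+ (N - i.+1) *: iter i.+1 phi u
    - l ^+ (N - i) *: iter i phi u)).
  rewrite (telescope_sumr (fun i => l ^+ (N - i) *: iter i phi u)) //.
  by rewrite subnn subn0 expr0 scale1r.
rewrite linearZZ scalerA -exprS; congr (_ ^+ _ *: _ - _ ^+ _ *: _).
  by have := ltn_ord i; lia.
by have := ltn_ord i; lia.
Qed.

Lemma iter_phi1 N : iter N phi 1 = 1.
Proof. by elim: N => //= N ->. Qed.

Lemma iter_phiM N u v : iter N phi (u * v) = iter N phi u * iter N phi v.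
Proof. by elim: N => //= N ->; rewrite phiM. Qed.

(* On the generalized eigenspace for [1] the operator [geometric N 1] is [N]
   plus a nilpotent one. *)
Lemma geometric_surjective N c : (0 < N)%N -> gen 1 c ->
  exists2 w, gen 1 w & geometric N 1 w = c.
Proof.
move=> N0 [k]; elim: k c => [|k IH] c.
  by move=> /= ->; exists 0; [apply: gen0 | rewrite linear0].
move=> E.
pose T u := \sum_(i < N) geometric i 1 u.
have geoE u : geometric N 1 u = N%:R *: u + eps (T u).
  rewrite /T linear_sum geometric_def.
  rewrite (eq_bigr (fun i : 'I_N => u + eps (geometric i 1 u))) => [|i _].
    by rewrite big_split /= sumr_const card_ord scaler_nat.
  by rewrite -geometricE !expr1n !scale1r addrC subrK.
have [w gw Ew] : exists2 w, gen 1 w & geometric N 1 w = eps (T c).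
  apply: IH; rewrite -iterSr /T iter_linear_sum big1 // => i _.
  rewrite (iter_comm (g := geometric i 1)) ?E ?linear0 // => v.
  by rewrite geometric_comm.
have nz : N%:R != 0 :> K by rewrite (proj1 (pcharf0P K) charK) -lt0n.
exists (N%:R^-1 *: (c - w)).
  apply: genZ; rewrite -scaleN1r addrC; apply: genP => //.
  by exists k.+1.
by rewrite linearZZ linearB Ew geoE addrK scalerA mulVf // scale1r.
Qed.

(** The i-th power of the operator that scales each [gen l] by [l]. It is multiplicative because
    eigenvalues multiply; for N-th roots of unity the twists are the conjugates, and their sum
    isolates the part at 1. *)
Definition twist i (d : seq (K * A)) : A := \sum_(x <- d) x.1 ^+ i *: x.2.

Lemma twist_dmul i (d d' : seq (K * A)) :
  twist i (dmul d d') = twist i d * twist i d'.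
Proof.
rewrite /twist big_allpairs_dep mulr_suml; apply: eq_bigr => x _.
rewrite mulr_sumr; apply: eq_bigr => y _ /=.
by rewrite exprMn -scalerAl -scalerAr scalerA.
Qed.

Lemma twist_dexp i (d : seq (K * A)) k : twist i (dexp d k) = twist i d ^+ k.
Proof.
elim: k => [|k IH]; first by rewrite /twist big_seq1 /= expr1n scale1r.
by rewrite /= twist_dmul -/(dexp d k) IH exprS.
Qed.

Lemma sum_twist N (d : seq (K * A)) : (forall x, x \in d -> x.1 ^+ N = 1) ->
  \sum_(i < N) twist i d = N%:R *: part 1 d.
Proof.
move=> dN; rewrite exchange_big /part [in RHS]big_mkcond scaler_sumr /=.
rewrite !big_seq; apply: eq_bigr => x xd.
rewrite -scaler_suml sum_expr_unity ?dN //; case: ifP => // _.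
by rewrite scale0r scaler0.
Qed.

Lemma img_absorbing_unity N : (0 < N)%N ->
  (forall v, decomposable phi (fun l => l ^+ N = 1) v) -> img_absorbing.
Proof.
move=> N0 decN.
pose epsN_fun u := iter N phi u - u.
have psi_lin : linear (iter N phi) by move=> a u v; rewrite iter_linearP.
pose psi : {linear A -> A} := HB.pack_for {linear A -> A} (iter N phi)
  (GRing.isLinear.Build K A A *:%R (iter N phi) psi_lin).
pose epsN : {linear A -> A} := psi \- idfun.
have epsNE l u : l ^+ N = 1 -> epsN u = shift phi l (geometric N l u).
  by move=> lN; rewrite -geometricE lN scale1r.
have nil : locally_nilpotent epsN.
  move=> u; have [d [wd <- dN]] := decN u.
  rewrite /total; elim: d wd dN => [|x d IH] wd dN.
    by exists 0%N; rewrite big_nil.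
  have [||i Ei] := IH; try by move=> y yd; [apply: wd || apply: dN];
    rewrite inE yd orbT.
  have [j Ej] := wd x (mem_head _ _).
  have xN := dN x (mem_head _ _).
  have Ej' : iter j epsN x.2 = 0.
    have -> : iter j epsN x.2 =
        iter j (geometric N x.1) (iter j (shift phi x.1) x.2).
      elim: (j) => // m IHm; rewrite iterS IHm (epsNE x.1) // -geometric_comm.
      rewrite [RHS]iterS; congr (geometric _ _ _); rewrite iterS.
      rewrite (iter_comm (f := geometric N x.1) (g := shift phi x.1)) // => v.
      by rewrite geometric_comm.
    by rewrite Ej iter_linear0.
  exists (i + j)%N; rewrite big_cons -[x.2]scale1r iter_linearP {1}iterD Ej'.
  by rewrite addnC iterD Ei !iter_linear0 scaler0 addr0.
have idealJ u v : exists w, epsN u * v = epsN w.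
  apply: (unipotent_image_ideal (psi := psi)) => //.
  - by move=> w; rewrite /= addrC subrK.
  - exact: iter_phi1.
  - exact: iter_phiM.
pose J u := exists w, epsN w = u.
have Jimg u : J u -> img u.
  by case=> w <-; rewrite (epsNE 1) ?expr1n //; exists (geometric N 1 w).
(* phi^N - 1 is [eps] composed with [geometric N 1], which is onto on the eigenspace of 1. *)
have J_of b : gen 1 b -> J (eps b).
  move=> /(geometric_surjective N0)[w _ <-]; exists w.
  by rewrite (epsNE 1) ?expr1n.
move=> f Hf g; have [d [wd Ed dN]] := decN f.
have JN u v : J u -> J (u * v).
  by case=> w <-; have [w' ->] := idealJ w v; exists w'.
have Jf : J (f ^+ N).
  have -> : f = twist 0 d.
    rewrite -Ed /twist; apply: eq_bigr => x _; by rewrite expr0 scale1r.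
  have -> : N = size [seq twist i d | i <- iota 0 N].
    by rewrite size_map size_iota.
  apply: (power_sums_ideal (J := J)) => //.
  - by exists 0; rewrite linear0.
  - by move=> u v [x <-] [y <-]; exists (x - y); rewrite linearB.
  - move=> u m [w Ew]; exists (m.+1%:R^-1 *: w); rewrite linearZZ Ew.
    rewrite -scaler_nat scalerA mulVf ?scale1r //.
    by rewrite (proj1 (pcharf0P K) charK).
  - move=> m m0.
    rewrite big_map (_ : iota 0 N = index_iota 0 N) ?big_mkord; last first.
      by rewrite /index_iota subn0.
    (* The m-th power sum of the conjugates is [N] times the part of f^m at 1; as f^m is in the
       image, this part is [eps] of an element of [B], hence in [J]. *)
    have -> : \sum_(i < N) twist i d ^+ m = N%:R *: part 1 (dexp d m).
      rewrite -sum_twist; first by apply: eq_bigr => i _; rewrite twist_dexp.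
      elim: (m) => [|k IHk] x.
        by rewrite inE => /eqP -> /=; rewrite expr1n.
      case/allpairsP => -[y z] /= [yd zd ->] /=.
      by rewrite exprMn dN // IHk // mulr1.
    have [||b gb ->] := @part_img (dexp d m).
    - exact: wf_dexp.
    - by rewrite total_dexp Ed; apply: Hf.
    have [w Ew] := J_of b gb; by exists (N%:R *: w); rewrite linearZZ Ew.
  - by apply/mapP; exists 0%N => //; rewrite mem_iota.
exists N => m ltm; apply: Jimg.
by rewrite -(subnKC (ltnW ltm)) exprD -mulrA; apply: JN.
Qed.

End Cases.

(** * Eigenvalues of infinite order *)

Lemma expr_inj (K : fieldType) (x : K) :
  x != 0 -> (forall k, (0 < k)%N -> x ^+ k != 1) -> injective (GRing.exp x).
Proof.
move=> x0 xX; have neq i j : (i < j)%N -> x ^+ i <> x ^+ j.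
  move=> lt /eqP; rewrite -(subnK (ltnW lt)) exprD -[X in X == _]mul1r.
  rewrite (inj_eq (mulIf (expf_neq0 i x0))) eq_sym (negPf (xX _ _)) //.
  by rewrite subn_gt0.
by move=> i j E; case: (ltngtP i j) => // /neq; [case | case; rewrite E].
Qed.

Lemma iotaE0 n : index_iota 0 n = iota 0 n.
Proof. by rewrite /index_iota subn0. Qed.

Lemma common_exponent (T : eqType) (s : seq T) (P : nat -> T -> Prop) :
  (forall k m x, P k x -> P (k * m)%N x) ->
  (forall x, x \in s -> exists2 k, (0 < k)%N & P k x) ->
  exists2 N, (0 < N)%N & forall x, x \in s -> P N x.
Proof.
move=> PM; elim: s => [|x s IH] H; first by exists 1%N.
have [k k0 Pk] := H x (mem_head _ _).
have [y ys|N N0 PN] := IH; first by apply: H; rewrite inE ys orbT.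
exists (k * N)%N => [|y]; first by rewrite muln_gt0 k0.
by rewrite inE => /orP[/eqP ->|/PN]; [apply: PM | rewrite mulnC; apply: PM].
Qed.

Section Eigenvalues.
Variable K : fieldType.
Notation A := {mpoly K[2]}.
Variable phi : {linear A -> A}.
Hypothesis charK : [pchar K] =i pred0.
Hypothesis phi1 : phi 1 = 1.
Hypothesis phiM : forall u v, phi (u * v) = phi u * phi v.
Hypothesis dec : forall v, decomposable phi (fun=> True) v.

Local Notation eps := (shift phi 1).
Local Notation gen := (gen phi).
Local Notation wf := (wf phi).

Lemma gen_exp l u k : gen l u -> gen (l ^+ k) (u ^+ k).
Proof.
move=> g; elim: k => [|k IH]; last by rewrite !exprS; apply: genM.
by rewrite !expr0 -(mpolyC1 2 K); apply: gen1_const.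
Qed.

Lemma gen1M l u v : gen 1 u -> gen l v -> gen l (u * v).
Proof. by move=> gu gv; rewrite -[l]mul1r; apply: genM. Qed.

Lemma gen1_horner_alg u (q : {poly K}) : gen 1 u -> gen 1 (horner_alg u q).
Proof.
move=> gu; rewrite horner_algE; apply: gen_sum => i _; apply: genZ.
by rewrite -(expr1n K i); apply: gen_exp.
Qed.

Lemma gen1_eval2 u v (Q : {poly {poly K}}) :
  gen 1 u -> gen 1 v -> gen 1 (eval2 u v Q).
Proof.
move=> gu gv; rewrite eval2E; apply: gen_sum => i _.
by apply: gen1M; [apply: gen1_horner_alg | rewrite -(expr1n K i);
  apply: gen_exp].
Qed.

Lemma nonzero_decomposition v :
  exists d, [/\ wf d, total d = v & forall x, x \in d -> x.2 != 0].
Proof.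
have [d [wd <- _]] := dec v; exists [seq x <- d | x.2 != 0]; split.
- by move=> x; rewrite mem_filter => /andP[_]; apply: wd.
- rewrite /total big_filter [RHS](bigID (fun x => x.2 != 0)) /=.
  by rewrite [X in _ = _ + X]big1 ?addr0 // => x /negPn/eqP.
- by move=> x; rewrite mem_filter => /andP[].
Qed.

Lemma decomposable_common (P : nat -> K -> Prop) :
  (forall k m l, P k l -> P (k * m)%N l) -> (forall k, P k 1) ->
  (forall k l m, P k l -> P k m -> P k (l * m)) ->
  (forall l a, gen l a -> a != 0 -> exists2 k, (0 < k)%N & P k l) ->
  exists2 N, (0 < N)%N & forall v, decomposable phi (P N) v.
Proof.
move=> PX P1 PM H.
have Pd (d : seq (K * A)) : wf d -> (forall x, x \in d -> x.2 != 0) ->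
    exists2 N, (0 < N)%N & forall x, x \in d -> P N x.1.
  move=> wd d0; apply: (common_exponent (P := fun k x => P k x.1)).
    by move=> k m x; apply: PX.
  by move=> x xd; apply: H (wd _ xd) (d0 _ xd).
have [d [wd Ed d0]] := nonzero_decomposition 'X_ord0.
have [e [we Ee e0]] := nonzero_decomposition 'X_ord_max.
have [M M0 HM] := Pd d wd d0; have [N N0 HN] := Pd e we e0.
exists (M * N)%N; first by rewrite muln_gt0 M0.
apply: (decomposable_all phi1 phiM (P1 _) (PM _)).
case=> [[|[|//]] lt].
  exists d; split; [exact: wd | | by move=> x /HM; apply: PX].
  by rewrite Ed (_ : Ordinal lt = ord0) //; apply: val_inj.
exists e; split; [exact: we | | by move=> x /HN; rewrite mulnC; apply: PX].
by rewrite Ee (_ : Ordinal lt = ord_max) //; apply: val_inj.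
Qed.

(** [phi] fixes [p] and translates [s] by the fixed r = eps s, so the relation holds at s + k r for
    every [k]. Hence Q(p, Y) vanishes as a polynomial in Y, and [p] is transcendental over [K]. *)
Lemma independent_of_slice p s (Q : {poly {poly K}}) :
  eps p = 0 -> (1 < msize p)%N -> eps s != 0 -> eps (eps s) = 0 ->
  eval2 p s Q = 0 -> Q = 0.
Proof.
move=> Ep p1 r0 Er E; set r := eps s in r0 Er.
have fix_eps u : eps u = 0 -> phi u = u by move=> H; rewrite phi_eps H addr0.
have phi_ev t : phi (eval2 p t Q) = eval2 p (phi t) Q.
  elim/poly_ind: (Q) => [|P q IH]; first by rewrite !rmorph0 linear0.
  rewrite !(rmorphD, rmorphM) /= !eval2X !eval2C linearD phiM IH.
  by rewrite (phi_horner_alg phi1 phiM) (fix_eps p Ep).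
have ev k : eval2 p (s + k%:R * r) Q = 0.
  elim: k => [|k IH]; first by rewrite mul0r addr0.
  have -> : s + k.+1%:R * r = phi (s + k%:R * r).
    have phir : phi (k%:R * r) = k%:R * r.
      by rewrite mulr_natl linearMn (fix_eps r).
    rewrite linearD phir phi_eps -/r -addrA -[k.+1]addn1 natrD mulrDl mul1r.
    by rewrite [r + _]addrC.
  by rewrite -phi_ev IH linear0.
pose G := map_poly (horner_alg p) Q.
have G0 : G = 0.
  have charA : [pchar A] =i pred0.
    apply/pcharf0P => n; rewrite -mpolyC_nat mpolyC_eq0.
    exact: (proj1 (pcharf0P K) charK).
  have : G \Po (s%:P + r *: 'X) = 0.
    apply: poly_eq0_on_nat => // k; rewrite horner_comp !hornerE mulrC.
    exact: ev.
  move/eqP; rewrite comp_poly2_eq0 // ?polyC_eq0; last first.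
    by rewrite addrC size_polyDl size_scale ?size_polyX // size_polyC;
      case: eqP.
  by move/eqP.
apply/polyP => i; rewrite coef0; apply: (transcendental_mpoly p1).
by rewrite -coef_map -/G G0 coef0.
Qed.

(** In a relation between [p], [s] and [a] the k-th power of [a] has eigenvalue l^k. Were no
    positive power of [l] equal to 1, the part at 1 would be a relation between [p] and [s]
    alone. *)
Lemma eigenvalue_unity p s l a :
  eps p = 0 -> (1 < msize p)%N -> eps s != 0 -> eps (eps s) = 0 ->
  gen 1 p -> gen 1 s -> gen l a -> a != 0 -> exists2 k, (0 < k)%N & l ^+ k = 1.
Proof.
move=> Ep p1 r0 Er gp gs ga a0; apply: NNPP => nl.
have nl' k : l ^+ k.+1 != 1 by apply/eqP => H; apply: nl; exists k.+1.
have [E [E0 HE]] := algebraically_dependent3 p s a0.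
case/negP: E0; apply/eqP/(independent_of_slice Ep p1 r0 Er).
pose d := [seq (l ^+ k, eval2 p s E`_k * a ^+ k) | k <- iota 0 (size E)].
have wd : wf d.
  by move=> x /mapP[k _ ->] /=; apply: gen1M;
    [apply: gen1_eval2 | apply: gen_exp].
have Et : total d = 0.
  rewrite -[RHS]HE /total big_map -[iota 0 _](iotaE0 (size E)).
  by rewrite big_mkord.
have := part_eq0 1 wd Et; rewrite /part big_map.
case szE : (size E) => [|n].
  by move/eqP: szE; rewrite size_poly_eq0 => /eqP ->; rewrite coef0 rmorph0.
rewrite /= big_cons expr0 eqxx mulr1 big_seq_cond big1 ?addr0 // => k.
by rewrite mem_iota; case: k => [//|k]; rewrite (negPf (nl' k)) andbF.
Qed.

(** If all the l^i m^j were distinct, a relation over K[b] would split into single monomials in [a]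
    and [c], and its coefficients would vanish because [b] is transcendental. *)
Lemma dependent_eigenvalues b l m a c :
  gen 1 b -> (1 < msize b)%N -> gen l a -> gen m c -> a != 0 -> c != 0 ->
  exists i j i' j', (i, j) <> (i', j') /\ l ^+ i * m ^+ j = l ^+ i' * m ^+ j'.
Proof.
move=> gb b1 ga gc a0 c0; apply: NNPP => H.
have inj i j i' j' : l ^+ i * m ^+ j = l ^+ i' * m ^+ j' -> (i, j) = (i', j').
  by move=> E; apply: NNPP => ne; apply: H; exists i, j, i', j'.
have [E [E0 HE]] := algebraically_dependent3 b a c0.
case/negP: E0; apply/eqP/polyP => j; rewrite coef0.
apply: (transcendental_mpoly b1).
have [big|small] := leqP (size E`_0) j; first by rewrite nth_default ?rmorph0.
have szE : (0 < size E)%N.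
  by rewrite lt0n; apply: contraTneq small => /eqP;
    rewrite size_poly_eq0 => /eqP ->;
    rewrite coef0 size_poly0.
pose F (x : nat * nat) := (l ^+ x.2 * m ^+ x.1,
  horner_alg b E`_(x.1)`_(x.2) * a ^+ x.2 * c ^+ x.1).
pose X := [seq (k, j) | k <- iota 0 (size E), j <- iota 0 (size E`_k)].
have wd : wf (map F X).
  move=> x /mapP[y _ ->] /=; apply: genM => //; last exact: gen_exp.
  by apply: gen1M; [apply: gen1_horner_alg | apply: gen_exp].
have Et : total (map F X) = 0.
  rewrite -[RHS]HE /total big_map big_allpairs_dep.
  rewrite -[iota 0 _](iotaE0 (size E)) big_mkord.
  apply: eq_bigr => k _; rewrite eval2E mulr_suml.
  by rewrite -[iota 0 _](iotaE0 (size E`_k)) big_mkord.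
have := part_eq0 (l ^+ j) wd Et; rewrite /part big_map.
have uX : uniq X.
  rewrite allpairs_uniq_dep ?iota_uniq // => [k _|]; first exact: iota_uniq.
  by case=> k i [k' i'] _ _ /= [-> ->].
rewrite -big_filter (eq_filter (a2 := pred1 (0%N, j))); last first.
  case=> k i /=; apply/eqP/eqP => [|[-> ->]]; last by rewrite mulr1.
  by rewrite -[l ^+ j]mulr1 -(expr0 m) => /inj[-> ->].
rewrite filter_pred1_uniq //; last first.
  by apply/allpairsPdep; exists 0%N, j; rewrite !mem_iota.
rewrite big_seq1 /= mulr1 => /eqP;
  rewrite mulf_eq0 expf_eq0 (negPf a0) andbF orbF.
by move/eqP.
Qed.

(* If every eigenvalue is [0] or a root of unity, any [rho] of infinite order
   works, and [2] is one. *)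
Lemma weights_exist b : gen 1 b -> (1 < msize b)%N ->
  exists rho N, [/\ rho != 0, forall k, (0 < k)%N -> rho ^+ k != 1, (0 < N)%N &
    forall v, decomposable phi (fun l => l = 0 \/
      exists i j, l ^+ N * rho ^+ i = rho ^+ j) v].
Proof.
move=> gb b1.
suff [rho [rho0 rhoX H]] : exists rho, [/\ rho != 0,
    forall k, (0 < k)%N -> rho ^+ k != 1 &
    forall l a, gen l a -> a != 0 -> exists2 k, (0 < k)%N &
      l = 0 \/ exists i j, l ^+ k * rho ^+ i = rho ^+ j].
  have [||||N N0 HN] := @decomposable_common
      (fun k l => l = 0 \/ exists i j, l ^+ k * rho ^+ i = rho ^+ j).
  - move=> k m l [->|[i [j E]]]; [by left | right].
    by exists (i * m)%N, (j * m)%N; rewrite !exprM -exprMn E.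
  - by move=> k; right; exists 0%N, 0%N; rewrite expr1n mul1r.
  - move=> k l m [->|[i [j E]]]; first by left; rewrite mul0r.
    move=> [->|[i' [j' E']]]; first by left; rewrite mulr0.
    by right; exists (i + i')%N, (j + j')%N; rewrite exprMn !exprD mulrACA E E'.
  - exact: H.
  by exists rho, N.
have [[rho [c [gc c0 rho0 rhoX]]]|nex] := classic (exists rho c,
  [/\ gen rho c, c != 0, rho != 0 & forall k, (0 < k)%N -> rho ^+ k != 1]).
  exists rho; split=> // l a ga a0.
  have [->|l0] := eqVneq l 0; first by exists 1%N => //; left.
  have [i [j [i' [j' [ne E]]]]] := dependent_eigenvalues gb b1 ga gc a0 c0.
  have step (x y x' y' : nat) :
      (x < x')%N -> l ^+ x * rho ^+ y = l ^+ x' * rho ^+ y' ->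
      exists2 k, (0 < k)%N & l = 0 \/ exists i j, l ^+ k * rho ^+ i = rho ^+ j.
    move=> lt H; exists (x' - x)%N; first by rewrite subn_gt0.
    right; exists y', y; apply: (mulfI (expf_neq0 x l0)).
    by rewrite mulrA -exprD subnKC // ltnW.
  have [lt|lt|eq] := ltngtP i i'; first exact: step E.
    by apply: step (esym E).
  case: ne; congr (_, _) => //; apply: (expr_inj rho0 rhoX).
  by move: E; rewrite eq => /(mulfI (expf_neq0 i' l0)).
exists 2%:R; split.
- by rewrite (proj1 (pcharf0P K) charK).
- move=> k k0; rewrite -natrX -subr_eq0 -(natrB _ (n := 1)) ?expn_gt0 //.
  by rewrite (proj1 (pcharf0P K) charK) subn_eq0 -ltnNge -[1%N]/(2 ^ 0)%N
    ltn_exp2l.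
move=> l a ga a0; have [->|l0] := eqVneq l 0; first by exists 1%N => //; left.
have [k k0 E] : exists2 k, (0 < k)%N & l ^+ k = 1.
  apply: NNPP => nk; apply: nex; exists l, a; split=> // k k0.
  by apply/eqP => E; apply: nk; exists k.
by exists k => //; right; exists 0%N, 0%N; rewrite E mul1r.
Qed.

End Eigenvalues.

(** * Grading by integer weights *)

Lemma uniq_map_inj (T T' : eqType) (f : T -> T') (s : seq T) x y :
  uniq (map f s) -> x \in s -> y \in s -> f x = f y -> x = y.
Proof.
elim: s => //= z s IH /andP[nz us].
rewrite !inE => /orP[/eqP ->|xs] /orP[/eqP ->|ys] // E.
- by case/negP: nz; rewrite E map_f.
- by case/negP: nz; rewrite -E map_f.
- exact: IH.
Qed.

Section Weights.
Variable K : fieldType.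
Notation A := {mpoly K[2]}.
Variable phi : {linear A -> A}.
Hypothesis charK : [pchar K] =i pred0.
Hypothesis phi1 : phi 1 = 1.
Hypothesis phiM : forall u v, phi (u * v) = phi u * phi v.
Hypothesis dec : forall v, decomposable phi (fun=> True) v.
Variables (rho : K) (n : nat).
Hypothesis rho0 : rho != 0.
Hypothesis rhoX : forall k, (0 < k)%N -> rho ^+ k != 1.
Hypothesis n0 : (0 < n)%N.

Local Notation gen := (gen phi).
Local Notation wf := (wf phi).

Let rho_inj : injective (GRing.exp rho) := expr_inj rho0 rhoX.

(* The entry [(l, u, e)] of a list weighted with offset [k] contributes the
   weight [e - k] to the eigenvector [u], where [l ^+ n = rho ^ (e - k)]; the
   offset keeps exponents natural.  The eigenvalue [0] has no weight. *)
Implicit Type T : seq (K * A * nat).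

Definition weighted k T := forall x, x \in T ->
  gen x.1.1 x.1.2 /\ (x.1.1 = 0 \/ x.1.1 ^+ n * rho ^+ k = rho ^+ x.2).

Definition unweighted T := [seq x.1 | x <- T].

Definition wmul T T' := [seq (x.1.1 * y.1.1, x.1.2 * y.1.2, (x.2 + y.2)%N) |
  x <- T, y <- T'].

Definition wexp T m := iter m (wmul T) [:: (1, 1, 0%N)].

(** The twist by [i.+1], graded by weight. The exponent [i.+1] instead of [i] removes the eigenvalue
    0, whose power 0 would be 1. *)
Definition wpoly i T : {poly A} :=
  \sum_(x <- T) (x.1.1 ^+ i.+1 *: x.1.2)%:P * 'X^(x.2).

Lemma wf_unweighted k T : weighted k T -> wf (unweighted T).
Proof. by move=> wT x /mapP[y /wT[gy _] ->]. Qed.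

Lemma weighted_wmul k k' T T' : weighted k T -> weighted k' T' ->
  weighted (k + k') (wmul T T').
Proof.
move=> wT wT' z /allpairsP[[x y] /= [/wT[gx Ex] /wT'[gy Ey] ->]] /=.
split; first exact: genM.
case: Ex => [->|Ex]; first by left; rewrite mul0r.
case: Ey => [->|Ey]; first by left; rewrite mulr0.
by right; rewrite exprMn !exprD mulrACA Ex Ey.
Qed.

Lemma weighted_wexp k T m : weighted k T -> weighted (k * m) (wexp T m).
Proof.
move=> wT; elim: m => [|m IH] /=; last by rewrite mulnS; apply: weighted_wmul.
move=> x; rewrite inE => /eqP -> /=; split; last first.
  by right; rewrite muln0 expr1n mul1r.
by rewrite -(mpolyC1 2 K); apply: gen1_const.
Qed.

Lemma wpoly_wmul i T T' : wpoly i (wmul T T') = wpoly i T * wpoly i T'.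
Proof.
rewrite /wpoly big_allpairs_dep mulr_suml; apply: eq_bigr => x _.
rewrite mulr_sumr; apply: eq_bigr => y _ /=.
rewrite exprMn -scalerA exprD mulrACA -polyCM; congr (_%:P * _).
by rewrite -scalerAl -scalerAr !scalerA.
Qed.

Lemma wpoly_wexp i T m : wpoly i (wexp T m) = wpoly i T ^+ m.
Proof.
elim: m => [|m IH]; last by rewrite /= wpoly_wmul -/(wexp T m) IH exprS.
by rewrite /wpoly big_seq1 /= expr1n scale1r expr0 mulr1.
Qed.

Lemma total_wmul T T' :
  total (unweighted (wmul T T')) = total (unweighted T) * total (unweighted T').
Proof.
rewrite /total /unweighted !big_map big_allpairs_dep mulr_suml.
by apply: eq_bigr => x _; rewrite mulr_sumr.
Qed.

Lemma total_wexp T m :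
  total (unweighted (wexp T m)) = total (unweighted T) ^+ m.
Proof.
elim: m => [|m IH]; first by rewrite /total big_map big_seq1.
by rewrite /= total_wmul -/(wexp T m) IH exprS.
Qed.

(** As [rho] has infinite order, degree [k] retains exactly the nonzero eigenvalues with l^n = 1;
    the sum over [i] then filters out l = 1. *)
Lemma sum_wpoly_coef k T : weighted k T ->
  \sum_(i < n) (wpoly i T)`_k = n%:R *: part 1 (unweighted T).
Proof.
move=> wT; rewrite /part big_map [in RHS]big_mkcond scaler_sumr /=.
transitivity (\sum_(x <- T) \sum_(i < n)
    (x.1.1 ^+ i.+1 *: x.1.2) * (k == x.2)%:R).
  rewrite exchange_big; apply: eq_bigr => i _.
  by rewrite coef_sum; apply: eq_bigr => x _; rewrite coefCM coefXn.
rewrite !big_seq; apply: eq_bigr => x xT; have [gx Ex] := wT x xT.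
rewrite -mulr_suml -scaler_suml.
have -> : \sum_(i < n) x.1.1 ^+ i.+1 = x.1.1 * \sum_(i < n) x.1.1 ^+ i.
  by rewrite mulr_sumr; apply: eq_bigr => i _; rewrite exprS.
case: Ex => [->|Ex].
  by rewrite mul0r scale0r mul0r eq_sym oner_eq0 scaler0.
have [Ek|nk] := eqVneq k x.2.
  have xn : x.1.1 ^+ n = 1.
    by apply: (mulIf (expf_neq0 k rho0)); rewrite mul1r Ex Ek.
  rewrite mulr1 sum_expr_unity //; case: eqP => [->|_]; first by rewrite mul1r.
  by rewrite mulr0 scale0r scaler0.
rewrite mulr0; case: eqP => [E|_]; last by rewrite scaler0.
by case/eqP: nk; apply: rho_inj; rewrite -Ex E expr1n mul1r.
Qed.

Lemma weighted_exists (d : seq (K * A)) : wf d ->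
  (forall x, x \in d ->
    x.1 = 0 \/ exists i j, x.1 ^+ n * rho ^+ i = rho ^+ j) ->
  exists k T, weighted k T /\ unweighted T = d.
Proof.
elim: d => [|x d IH] wd H; first by exists 0%N, [::].
have [||k [T [wT ET]]] := IH.
- by move=> y yd; apply: wd; rewrite inE yd orbT.
- by move=> y yd; apply: H; rewrite inE yd orbT.
(* Raising the offset along with all exponents preserves the weights and makes room for a new entry
   of weight j - i. *)
have raise i : weighted (k + i) [seq (y.1, (y.2 + i)%N) | y <- T].
  move=> y /mapP[z /wT[gz Ez] ->] /=; split=> //.
  by case: Ez => [->|Ez]; [left | right; rewrite !exprD mulrA Ez].
have unraise i : unweighted [seq (y.1, (y.2 + i)%N) | y <- T] = d.
  by rewrite -ET /unweighted -map_comp.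
have [x0|[i [j Ex]]] := H x (mem_head _ _).
  exists (k + 0)%N, ((x, 0%N) :: [seq (y.1, (y.2 + 0)%N) | y <- T]); split.
    move=> y; rewrite inE => /orP[/eqP ->|]; last exact: raise.
    by split; [apply: wd; rewrite mem_head | left].
  by rewrite /= unraise.
exists (k + i)%N, ((x, (j + k)%N) :: [seq (y.1, (y.2 + i)%N) | y <- T]); split.
  move=> y; rewrite inE => /orP[/eqP ->|]; last exact: raise.
  split; first by apply: wd; rewrite mem_head.
  by right; rewrite /= addnC !exprD mulrA Ex.
by rewrite /= unraise.
Qed.

Lemma part1_off_weight k T : weighted k T ->
  (forall x, x \in T -> x.1.1 = 0 \/ x.2 <> k) -> part 1 (unweighted T) = 0.
Proof.
move=> wT H; rewrite /part big_map big_seq_cond big1 // => x /andP[xT /eqP E].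
have [x0|ne] := H x xT; first by move/eqP: E; rewrite x0 eq_sym oner_eq0.
have [_ [x0|Ex]] := wT x xT; first by move/eqP: E; rewrite x0 eq_sym oner_eq0.
by case: ne; apply: rho_inj; rewrite -Ex E expr1n mul1r.
Qed.

Lemma wmul_bound T T' (P1 P2 P3 : nat -> Prop) :
  (forall e e', P1 e -> P2 e' -> P3 (e + e')%N) ->
  (forall x, x \in T -> x.1.1 = 0 \/ P1 x.2) ->
  (forall x, x \in T' -> x.1.1 = 0 \/ P2 x.2) ->
  forall x, x \in wmul T T' -> x.1.1 = 0 \/ P3 x.2.
Proof.
move=> H H1 H2 z /allpairsP[[x y] /= [xT yT' ->]] /=.
have [->|p1] := H1 x xT; first by left; rewrite mul0r.
have [->|p2] := H2 y yT'; first by left; rewrite mulr0.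
by right; apply: H.
Qed.

(** When all weights of [T] have one strict sign, those of its m-th power are at least [m] in
    absolute value and outgrow the bounded weights of [T']. *)
Lemma eventually_off_weight k T : weighted k T ->
  (forall x, x \in T -> x.1.1 = 0 \/ (k < x.2)%N) \/
  (forall x, x \in T -> x.1.1 = 0 \/ (x.2 < k)%N) ->
  forall k' T', weighted k' T' ->
  exists N, forall m, (N < m)%N -> part 1 (unweighted (wmul (wexp T m) T')) = 0.
Proof.
move=> wT H k' T' wT'.
suff [N HN] : exists N, forall m, (N < m)%N -> forall x,
    x \in wmul (wexp T m) T' -> x.1.1 = 0 \/ x.2 <> (k * m + k')%N.
  exists N => m /HN; apply: part1_off_weight.
  by apply: weighted_wmul => //; apply: weighted_wexp.
case: H => H.
  have Hm m x : x \in wexp T m -> x.1.1 = 0 \/ (m * k.+1 <= x.2)%N.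
    elim: m x => [|m IH] x; first by right.
    apply: (@wmul_bound T (wexp T m) (fun e => k < e)%N
      (fun e => m * k.+1 <= e)%N (fun e => m.+1 * k.+1 <= e)%N) => //
      e e' lt le.
    by rewrite mulSn; apply: leq_add.
  exists k' => m ltm; apply: (@wmul_bound (wexp T m) T'
    (fun e => m * k.+1 <= e)%N
    (fun=> True) (fun e => e <> k * m + k')%N) => [e e' le _||x xT'].
  - by apply/eqP; rewrite gtn_eqF //; nia.
  - exact: Hm.
  - by right.
have Hm m x : x \in wexp T m -> x.1.1 = 0 \/ (x.2 + m <= m * k)%N.
  elim: m x => [|m IH] x; first by rewrite inE => /eqP -> /=; right.
  apply: (@wmul_bound T (wexp T m) (fun e => e < k)%N
    (fun e => e + m <= m * k)%N (fun e => e + m.+1 <= m.+1 * k)%N) => //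
      e e' lt le.
  by rewrite mulSn; lia.
pose G := \max_(x <- T') x.2.
exists G => m ltm; apply: (@wmul_bound (wexp T m) T' (fun e => e + m <= m * k)%N
  (fun e => e <= G)%N (fun e => e <> k * m + k')%N) => [e e' le le'||x xT'].
- by apply/eqP; rewrite ltn_eqF //; nia.
- exact: Hm.
- by right; rewrite /G (big_rem x) //= leq_maxl.
Qed.

(** Entries of equal weight cannot cancel, their eigenvalues being distinct. *)
Lemma wpoly_coef_neq0 k T x i : weighted k T ->
  uniq [seq y.1.1 | y <- T] -> x \in T -> x.1.1 != 0 -> x.1.2 != 0 ->
  (wpoly i T)`_(x.2) != 0.
Proof.
move=> wT uT xT l0 u0.
pose d := [seq (y.1.1, y.1.1 ^+ i.+1 *: y.1.2) | y <- T & y.2 == x.2].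
have Ed : (wpoly i T)`_(x.2) = total d.
  rewrite /total big_map big_filter [RHS]big_mkcond coef_sum.
  apply: eq_bigr => y _; rewrite coefCM coefXn eq_sym.
  by case: eqP; rewrite ?mulr1 ?mulr0.
have wd : wf d.
  move=> y /mapP[z]; rewrite mem_filter => /andP[_ /wT[gz _]] -> /=.
  exact: genZ.
have Pd : part x.1.1 d = x.1.1 ^+ i.+1 *: x.1.2.
  rewrite /part big_map big_filter_cond -big_filter.
  rewrite (eq_in_filter (a2 := pred1 x)); last first.
    move=> y yT /=; apply/andP/eqP => [[_ /eqP E]|->]; last by rewrite !eqxx.
    exact: (uniq_map_inj uT).
  by rewrite filter_pred1_uniq ?(map_uniq uT) // big_seq1.
rewrite Ed; apply: contraTneq isT => /(part_eq0 x.1.1 wd); rewrite Pd => /eqP.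
by rewrite scaler_eq0 expf_eq0 (negPf l0) (negPf u0) andbF.
Qed.

(** Division by the lowest power X^e0 gives polynomials with nonzero constant term and common degree
    e1 - e0, and the position of weight 0 becomes k - e0. The constant term theorem applies over the
    fraction field. *)
Lemma straddling_weights k T : weighted k T ->
  uniq [seq y.1.1 | y <- T] ->
  (forall x, x \in T -> x.1.1 != 0 /\ x.1.2 != 0) ->
  (exists2 x, x \in T & (x.2 <= k)%N) -> (exists2 x, x \in T & (k <= x.2)%N) ->
  ~ (forall m, (0 < m)%N -> \sum_(i < n) (wpoly i T ^+ m)`_(k * m) = 0).
Proof.
move=> wT uT nzT [y0 y0T ley0] [y1 y1T ley1] H.
have [x0 [x0T min0]] := ex_minimizer (fun x : K * A * nat => x.2)
  (ex_intro (fun x => x \in T) _ y0T).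
pose M := \max_(x <- T) x.2.
have leM x : x \in T -> (x.2 <= M)%N.
  by move=> xT; rewrite /M (big_rem x) //= leq_maxl.
have [x1 [x1T max1]] := ex_minimizer (fun x : K * A * nat => M - x.2)%N
  (ex_intro (fun x => x \in T) _ y1T).
have max1' x : x \in T -> (x.2 <= x1.2)%N.
  have arith a b : (M - b <= M - a)%N -> (a <= M)%N -> (a <= b)%N by lia.
  by move=> xT; apply: arith (max1 x xT) (leM x xT).
set e0 := x0.2 in min0; set e1 := x1.2 in max1 max1'.
have le0k : (e0 <= k)%N := leq_trans (min0 _ y0T) ley0.
have lek1 : (k <= e1)%N := leq_trans ley1 (max1' _ y1T).
pose q i : {poly A} :=
  \sum_(x <- T) (x.1.1 ^+ i.+1 *: x.1.2)%:P * 'X^(x.2 - e0).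
have Eq i : wpoly i T = q i * 'X^e0.
  rewrite /wpoly /q mulr_suml !big_seq; apply: eq_bigr => x xT.
  by rewrite -mulrA -exprD subnK // min0.
have q0 i : (q i)`_0 != 0.
  have [l0 u0] := nzT _ x0T; have := wpoly_coef_neq0 i wT uT x0T l0 u0.
  by rewrite Eq coefMXn ltnn subnn.
have szq i : size (q i) = (e1 - e0).+1.
  have [l0 u0] := nzT _ x1T; have := wpoly_coef_neq0 i wT uT x1T l0 u0.
  rewrite Eq coefMXn ltnNge (min0 _ x1T) /= => ne.
  apply/eqP; rewrite eqn_leq; apply/andP; split; last first.
    by rewrite ltnNge; apply: contra ne => le; rewrite nth_default.
  rewrite /q big_seq; apply: leq_trans (size_sum _ _ _) _.
  apply/bigmax_leqP_seq => x xT _.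
  rewrite mul_polyC (leq_trans (size_scale_leq _ _)) // size_polyXn ltnS.
  by rewrite leq_sub2r // max1'.
have charA : [pchar A] =i pred0.
  by apply/pcharf0P => m; rewrite -mpolyC_nat mpolyC_eq0;
     apply: (proj1 (pcharf0P K) charK).
have charF : [pchar {fraction A}] =i pred0.
  apply/pcharf0P => m; rewrite -(rmorph_nat (@tofrac A)) tofrac_eq0.
  exact: (proj1 (pcharf0P A) charA).
apply: (@no_vanishing_constant_terms {fraction A} n (k - e0) (e1 - k)
  (fun i => map_poly (@tofrac A) (q i))) => //.
- by move=> i; rewrite coef_map tofrac_eq0.
- move=> i; rewrite size_map_inj_poly ?rmorph0 ?szq //; last first.
    by move=> u v /eqP; rewrite tofrac_eq => /eqP.
  by congr _.+1; rewrite addnC addnBA // subnK.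
move=> m m0; transitivity (tofrac (\sum_(i < n) (wpoly i T ^+ m)`_(k * m))).
  rewrite rmorph_sum; apply: eq_bigr => i _; rewrite -rmorphXn coef_map.
  rewrite Eq exprMn -exprM coefMXn mulnBl ltnNge leq_mul2r le0k orbT.
  by [].
by rewrite H // rmorph0.
Qed.

Lemma img_absorbing_weights :
  (forall b, gen 1 b -> shift phi 1 b = 0) ->
  (forall v, decomposable phi (fun l => l = 0 \/
      exists i j, l ^+ n * rho ^+ i = rho ^+ j) v) ->
  img_absorbing phi.
Proof.
move=> eps0 decw f Hf g.
have [d [wd Ed Pd]] := decw f.
(* Repeated eigenvalues are merged and vanishing parts dropped, so that no extreme coefficient can
   cancel. *)
pose s := [seq l <- undup [seq x.1 | x <- d] | (l != 0) && (part l d != 0)].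
pose d1 := [seq (l, part l d) | l <- s].
have wd1 : wf d1 by move=> x /mapP[l _ ->]; apply: gen_part.
have [|k [T1 [wT1 ET1]]] := weighted_exists wd1.
  move=> x /mapP[l]; rewrite mem_filter mem_undup => /andP[_ /mapP[y yd ->]] ->.
  exact: (Pd y yd).
(* The part at 0 is restored to make the total [f]; having eigenvalue 0, it satisfies every weight
   condition. *)
pose T := ((0, part 0 d), 0%N) :: T1.
have wT : weighted k T.
  move=> x; rewrite inE => /orP[/eqP ->|]; last exact: wT1.
  by split; [apply: gen_part | left].
have totT : total (unweighted T) = f.
  rewrite /= ET1 /total big_cons big_map -Ed total_parts /s big_filter.
  set r := undup _.
  rewrite [RHS](bigID (fun l => (l != 0) && (part l d != 0))) /= addrC.
  congr (_ + _); transitivity (\sum_(l <- r | l == 0) part l d).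
    rewrite -big_filter (eq_filter (a2 := pred1 0)) //.
    have [r0|nr0] := boolP (0 \in r).
      by rewrite filter_pred1_uniq ?undup_uniq // big_seq1.
    rewrite big_filter big1_seq => [|l /= /andP[/eqP -> l0]]; last first.
      by rewrite l0 in nr0.
    rewrite /part big1_seq // => x /= /andP[/eqP x0 xd].
    by case/negP: nr0; rewrite mem_undup -x0 map_f.
  rewrite big_mkcond [RHS]big_mkcond; apply: eq_bigr => l _.
  by rewrite negb_and !negbK; case: eqP => //= _; case: eqP.
have [dg [wdg Edg Pdg]] := decw g.
have [k' [T' [wT' ET']]] := weighted_exists wdg Pdg.
have uT1 : uniq [seq y.1.1 | y <- T1].
  have -> : [seq y.1.1 | y <- T1] = s.
    have -> : [seq y.1.1 | y <- T1] = [seq x.1 | x <- unweighted T1].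
      by rewrite /unweighted -map_comp.
    by rewrite ET1 -map_comp map_id.
  by rewrite filter_uniq // undup_uniq.
have nzT1 x : x \in T1 -> x.1.1 != 0 /\ x.1.2 != 0.
  move=> xT; have : x.1 \in d1 by rewrite -ET1 map_f.
  by case/mapP => l; rewrite mem_filter => /andP[/andP[l0 u0] _] ->.
have [N HN] : exists N, forall m, (N < m)%N ->
    part 1 (unweighted (wmul (wexp T m) T')) = 0.
  apply: (@eventually_off_weight k T wT _ k' T' wT'); apply: NNPP => nH.
  apply: (straddling_weights wT1 uT1 nzT1).
  - apply: NNPP => H; apply: nH; left=> x; rewrite inE => /orP[/eqP ->|xT].
      by left.
    by right; rewrite ltnNge; apply/negP => le; apply: H; exists x.
  - apply: NNPP => H; apply: nH; right=> x; rewrite inE => /orP[/eqP ->|xT].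
      by left.
    by right; rewrite ltnNge; apply/negP => le; apply: H; exists x.
  (* The sum is [n] times the part of f^m at 1. This part lies in eps(B), because f^m is in the
     image, and [eps] vanishes on [B]. *)
  move=> m m0; transitivity (\sum_(i < n) (wpoly i (wexp T m))`_(k * m)).
    apply: eq_bigr => i _; rewrite wpoly_wexp.
    suff -> : wpoly i T = wpoly i T1 by [].
    by rewrite {1}/wpoly big_cons /= expr0n scale0r mul0r add0r.
  have wTm : weighted (k * m) (wexp T m) by apply: weighted_wexp.
  rewrite (sum_wpoly_coef wTm).
  have [|b gb ->] := part_img dec (wf_unweighted wTm).
    by rewrite total_wexp totT; apply: Hf.
  by rewrite eps0 // scaler0.
exists N => m /HN P0.
have <- : total (unweighted (wmul (wexp T m) T')) = f ^+ m * g.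
  by rewrite total_wmul total_wexp totT ET' Edg.
apply: img_part0 P0; apply: (@wf_unweighted (k * m + k')).
by apply: weighted_wmul wT'; apply: weighted_wexp.
Qed.

End Weights.

(** * Reduction to split eigenvalues *)

Lemma img_absorbing_split (K : fieldType)
    (phi : {linear {mpoly K[2]} -> {mpoly K[2]}}) :
  [pchar K] =i pred0 -> phi 1 = 1 ->
  (forall u v, phi (u * v) = phi u * phi v) ->
  (forall v, decomposable phi (fun=> True) v) -> img_absorbing phi.
Proof.
move=> charK phi1 phiM dec.
have [B1|/not_all_ex_not[b nb]] :=
    classic (forall b, gen phi 1 b -> (msize b <= 1)%N).
  exact: img_absorbing_trivial.
have [gb b1] : gen phi 1 b /\ (1 < msize b)%N.
  by have [gb /negP] := imply_to_and _ _ nb; rewrite -ltnNge.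
have [eps0|/not_all_ex_not[b' nb']] :=
    classic (forall b, gen phi 1 b -> shift phi 1 b = 0).
  have [rho [N [rho0 rhoX N0 decw]]] := weights_exist charK phi1 phiM dec gb b1.
  exact: (img_absorbing_weights charK phi1 phiM dec rho0 rhoX N0 eps0 decw).
have [gb' /eqP eb'] := imply_to_and _ _ nb'.
have b'0 : b' != 0 by apply: contraNneq eb' => ->; rewrite linear0.
have [[|k] r0 Er] := locally_nilpotent_order gb' b'0.
  by case/negP: eb'; rewrite -Er.
(* [eps s] is nonzero and fixed, so [phi] translates [s] by it. *)
set s := iter k (shift phi 1) b'; have gs : gen phi 1 s.
  by rewrite /s; elim: (k) => //= j; apply: gen_shift.
have [K1|/not_all_ex_not[p np]] :=
    classic (forall p, shift phi 1 p = 0 -> (msize p <= 1)%N).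
  have Ec := msize1_polyC (K1 (shift phi 1 s) Er); set c := _@_0%MM in Ec.
  have c0 : c != 0.
    by apply: contraNneq r0 => z; rewrite iterS -/s Ec z mpolyC0.
  have surj : forall f, img phi f.
    apply: (eps_surjective charK phi1 phiM dec (s := c^-1 *: s)) => //.
    by rewrite linearZZ Ec -mul_mpolyC -mpolyCM mulVf.
  by move=> f _ g; exists 0%N => m _; apply: surj.
have [Ep /negP] := imply_to_and _ _ np; rewrite -ltnNge => p1.
have gp : gen phi 1 p by exists 1%N.
have [||||N N0 decN] :=
    decomposable_common phi1 phiM dec (P := fun k l => l ^+ k = 1).
- by move=> i j l E; rewrite exprM E expr1n.
- by move=> i; rewrite expr1n.
- by move=> i l m El Em; rewrite exprMn El Em mulr1.
- move=> l a; exact: (eigenvalue_unity charK phi1 phiM Ep p1 r0 Er gp gs).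
exact: (img_absorbing_unity charK phi1 phiM dec N0 decN).
Qed.

(** * Annihilating polynomials, and descent from the splitting field *)

Section OperatorPolynomials.
Variables (K : fieldType) (V : lmodType K) (f : {linear V -> V}).

Definition op_eval (p : {poly K}) v := \sum_(i < size p) p`_i *: iter i f v.

Lemma op_eval_wide n (p : {poly K}) v : (size p <= n)%N ->
  op_eval p v = \sum_(i < n) p`_i *: iter i f v.
Proof.
move=> le; rewrite /op_eval (big_ord_widen n (fun i => p`_i *: iter i f v)) //.
rewrite big_mkcond; apply: eq_bigr => i _; case: ltnP => // lei.
by rewrite nth_default // scale0r.
Qed.

Lemma op_eval_linear p a u v :
  op_eval p (a *: u + v) = a *: op_eval p u + op_eval p v.
Proof.
rewrite /op_eval scaler_sumr -big_split; apply: eq_bigr => i _ /=.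
by rewrite iter_linearP scalerDr !scalerA mulrC.
Qed.

Lemma op_eval0 p : op_eval p 0 = 0.
Proof. by rewrite /op_eval big1 // => i _; rewrite iter_linear0 scaler0. Qed.

Lemma op_evalD p q v : op_eval (p + q) v = op_eval p v + op_eval q v.
Proof.
pose n := maxn (size p) (size q).
rewrite !(@op_eval_wide n) ?leq_maxl ?leq_maxr ?(leq_trans (size_polyD _ _)) //.
by rewrite -big_split; apply: eq_bigr => i _; rewrite coefD scalerDl.
Qed.

Lemma op_evalZ a p v : op_eval (a *: p) v = a *: op_eval p v.
Proof.
rewrite (op_eval_wide (n := size p)) ?size_scale_leq // scaler_sumr.
by apply: eq_bigr => i _; rewrite coefZ scalerA.
Qed.

Lemma op_evalMX p v : op_eval (p * 'X) v = op_eval p (f v).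
Proof.
rewrite (op_eval_wide (n := (size p).+1)); last first.
  by have [->|p0] := eqVneq p 0; rewrite ?mul0r ?size_poly0 // size_mulX.
rewrite big_ord_recl coefMX eqxx scale0r add0r /op_eval.
by apply: eq_bigr => i _; rewrite coefMX /= -iterSr.
Qed.

Lemma op_evalC c v : op_eval c%:P v = c *: v.
Proof.
by rewrite (op_eval_wide (n := 1)) ?size_polyC_leq1 // big_ord1 coefC.
Qed.

Lemma op_evalM p q v : op_eval (p * q) v = op_eval p (op_eval q v).
Proof.
elim/poly_ind: q v => [|q c IH] v.
  by rewrite mulr0 -[0]polyC0 op_evalC scale0r op_eval0.
rewrite mulrDr mulrA !op_evalD !op_evalMX IH op_evalC mulrC mul_polyC op_evalZ.
by rewrite addrC -op_eval_linear addrC.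
Qed.

Lemma op_eval_roots (r : seq K) v :
  op_eval (\prod_(c <- r) ('X - c%:P)) v = foldl (fun u c => f u - c *: u) v r.
Proof.
elim: r v => [|c r IH] v /=; first by rewrite big_nil -polyC1 op_evalC scale1r.
rewrite big_cons mulrC op_evalM -IH; congr (op_eval _ _).
rewrite -['X]mul1r op_evalD op_evalMX -polyCN -polyC1 !op_evalC.
by rewrite scale1r scaleNr.
Qed.

Lemma foldl_shift_opp (r : seq K) v :
  foldl (fun u c => f u - c *: u) (- v) r =
  - foldl (fun u c => f u - c *: u) v r.
Proof.
elim: r v => //= c r IH v.
by rewrite -IH linearN scalerN opprB addrC opprK.
Qed.

End OperatorPolynomials.

Lemma decomposable_annihilated (K : fieldType) n
    (phi delta : {linear {mpoly K[n]} -> {mpoly K[n]}}) (r : seq K) v :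
  (forall u, delta u = u - phi u) ->
  foldl (fun u c => delta u - c *: u) v r = 0 ->
  decomposable phi (fun=> True) v.
Proof.
move=> deltaE E0; apply: (@decomposable_roots K n phi [seq 1 - c | c <- r]).
elim: r v E0 => //= c r IH v E0; apply: IH.
have -> : shift phi (1 - c) v = - (delta v - c *: v).
  by rewrite shiftE deltaE scalerBl scale1r !opprB addrCA.
by rewrite foldl_shift_opp E0 oppr0.
Qed.

Lemma lin_span_coordinates (K : fieldType) (V : lmodType K) (b : seq V) v :
  lin_span (fun u => u \in b) v ->
  exists c : 'I_(size b) -> K, v = \sum_j c j *: b`_j.
Proof.
case=> n [c [u [ub ->]]].
pose P w := exists c : 'I_(size b) -> K, w = \sum_j c j *: b`_j.
apply: (big_ind P).
- by exists (fun=> 0); rewrite big1 // => j _; rewrite scale0r.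
- move=> x y [cx ->] [cy ->]; exists (fun j => cx j + cy j).
  by rewrite -big_split; apply: eq_bigr => j _; rewrite scalerDl.
move=> i _; have lt : (index (u i) b < size b)%N by rewrite index_mem ub.
exists (fun j => if j == Ordinal lt then c i else 0).
rewrite (bigD1 (Ordinal lt)) //= eqxx nth_index ?ub // big1 ?addr0 // => j.
by move/negPf ->; rewrite scale0r.
Qed.

(** The first n + 1 iterates lie in the span of n vectors; a relation between them is read off the
    kernel of the coordinate matrix. *)
Lemma locally_finite_annihilator (K : fieldType) (V : lmodType K)
    (delta : {linear V -> V}) v : locally_finite delta ->
  exists2 p : {poly K}, p != 0 & op_eval delta p v = 0.
Proof.
move=> /(_ v)[b Hb]; set n := size b.
have [C HC] : exists C : 'I_n.+1 -> {ffun 'I_n -> K},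
    forall i : 'I_n.+1, iter i delta v = \sum_j C i j *: b`_j.
  apply: (fin_all_exists (P := fun (i : 'I_n.+1) (c : {ffun 'I_n -> K}) =>
    iter i delta v = \sum_j c j *: b`_j)) => i.
  have [|c Ec] := @lin_span_coordinates K V b (iter i delta v).
    apply/Hb; exists 1%N, (fun=> 1), (fun=> iter i delta v).
    by split=> [_|]; [exists i | rewrite big_ord1 scale1r].
  by exists [ffun j => c j]; rewrite Ec; apply: eq_bigr => j _; rewrite ffunE.
pose M : 'M[K]_(n.+1, n) := \matrix_(i, j) C i j.
have : kermx M != 0.
  rewrite kermx_eq0 /row_free neq_ltn; apply/orP; left.
  by rewrite ltnS; apply: rank_leq_col.
case/rowV0Pn => w /sub_kermxP wM w0.
exists (rVpoly w).
  by apply: contraNneq w0 => E; rewrite -[w]rVpolyK E linear0.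
rewrite (op_eval_wide _ _ (n := n.+1)) ?size_poly //.
transitivity (\sum_j (w *m M) 0 j *: b`_j); last first.
  by rewrite wM big1 // => j _; rewrite mxE scale0r.
under [RHS]eq_bigr => j _ do rewrite mxE scaler_suml.
rewrite exchange_big; apply: eq_bigr => i _.
rewrite coef_rVpoly_ord HC scaler_sumr; apply: eq_bigr => j _.
by rewrite scalerA mxE.
Qed.

Theorem theorem1p4 (K : fieldType) (charK0 : [pchar K] =i pred0)
    (delta : {linear {mpoly K[2]} -> {mpoly K[2]}})
    (delta_Eder : is_E_derivation delta)
    (delta_lf : locally_finite delta) :
  Mathieu_subspace (image_of delta).
Proof.
split.
  split; first by exists 0; rewrite linear0.
  by move=> a u v [x <-] [y <-]; exists (a *: x + y); rewrite linearP.
case: delta_Eder => phi Ephi f _ fX g.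
have [p0 p00 Ep0] := locally_finite_annihilator 'X_ord0 delta_lf.
have [p1 p10 Ep1] := locally_finite_annihilator 'X_ord_max delta_lf.
(* One polynomial for both variables, hence one splitting field. Annihilating the variables is
   enough, since decomposable elements form a subalgebra. *)
pose p := p0 * p1.
have Ep i : op_eval delta p 'X_i = 0.
  case: i => [[|[|//]] lt].
    by rewrite /p mulrC op_evalM (_ : Ordinal lt = ord0) ?Ep0 ?op_eval0 //;
      apply: val_inj.
  by rewrite /p op_evalM (_ : Ordinal lt = ord_max) ?Ep1 ?op_eval0 //;
    apply: val_inj.
have pn0 : p != 0 by rewrite mulf_neq0.
have [L [iota [r [[rho ret] Er]]]] := splitting_extension pn0.
pose m := map_mpoly (n := 2) iota.
pose phiL := base_change iota phi; pose deltaL := base_change iota delta.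
have charL : [pchar L] =i pred0 by move=> x; rewrite (fmorph_pchar iota) charK0.
have phiLm u : phiL (m u) = m (phi u) by apply: base_change_map.
have deltaLm u : deltaL (m u) = m (delta u) by apply: base_change_map.
have phiL1 : phiL 1 = 1.
  have m1 : m 1 = 1 by apply: rmorph1.
  by rewrite -m1 phiLm (rmorph1 phi).
have phiLM u v : phiL (u * v) = phiL u * phiL v.
  elim/(@base_change_ind 2 K L iota): u => [u'|u1 u2 E1 E2|c u' E].
  - elim/(@base_change_ind 2 K L iota): v => [v'|v1 v2 E1 E2|c v' E].
    + by rewrite -rmorphM !phiLm rmorphM [LHS]rmorphM.
    + by rewrite mulrDr !linearD E1 E2 mulrDr.
    + by rewrite -scalerAr !linearZZ E -scalerAr.
  - by rewrite mulrDl !linearD E1 E2 mulrDl.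
  - by rewrite -scalerAl !linearZZ E -scalerAl.
have deltaLE u : deltaL u = u - phiL u.
  elim/(@base_change_ind 2 K L iota): u => [u'|u1 u2 E1 E2|c u' E].
  - by rewrite deltaLm phiLm -rmorphB -Ephi opprB addrC subrK.
  - by rewrite !linearD E1 E2 addrACA.
  - by rewrite [deltaL _]linearZZ [phiL _]linearZZ E scalerBr.
have decX i : decomposable phiL (fun=> True) 'X_i.
  have mX : m 'X_i = 'X_i by apply: map_mpolyX.
  have E0 : foldl (fun u c => deltaL u - c *: u) 'X_i r = 0.
    have lc0 : iota (lead_coef p) != 0 by rewrite fmorph_eq0 lead_coef_eq0.
    apply: (scalerI lc0); rewrite scaler0 -op_eval_roots -op_evalZ -Er -mX.
    transitivity (m (op_eval delta p 'X_i)); last by rewrite Ep [LHS]rmorph0.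
    rewrite /op_eval size_map_poly [RHS]raddf_sum; apply: eq_bigr => j _.
    rewrite coef_map [RHS]map_mpolyZ; congr (_ *: _).
    by elim: (j : nat) => [//|k IHk]; rewrite !iterS IHk; apply: deltaLm.
  exact: (decomposable_annihilated deltaLE E0).
have decL v : decomposable phiL (fun=> True) v.
  exact: (decomposable_all phiL1 phiLM I (fun _ _ _ _ => I) decX).
(* [eps] is phi - 1, the opposite of delta, so preimages differ by a sign. *)
have img_delta w : img phiL w <-> image_of deltaL w.
  split=> -[x <-]; exists (- x).
    by rewrite deltaLE shiftE scale1r linearN opprK addrC.
  by rewrite deltaLE shiftE scale1r linearN opprK addrC.
have [k k0|N HN] :=
    img_absorbing_split charL phiL1 phiLM decL (f := m f) _ (m g).
  apply/img_delta; have [v Ev] := fX k k0; exists (m v).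
  by rewrite deltaLm Ev [LHS]rmorphXn.
exists N => k /HN /img_delta[w Ew].
have E : deltaL w = m (f ^+ k * g) by rewrite Ew [RHS]rmorphM /= rmorphXn.
by have [v Ev] := base_change_descent ret E; exists v.
Qed.
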